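(* For every $\Psi\in\mathrm{MAVal}_k(\mathbb{R}^n)$ there exists a unique homogeneous, symmetric polynomial $Q[\Psi]$ on $(\mathbb{C}^n)^k$ of degree $(2,\dots,2)$ such that for all $\phi\in C_c(\mathbb{R}^n)$ \begin{align*} \mathcal{F}(\mathrm{GW}(\Psi[\phi]))[z_1,\dots,z_k]=\frac{(-1)^k}{k!}Q[\Psi](z_1,\dots,z_k)\mathcal{F}(\phi)\left[\sum_{j=1}^{k}z_j\right]. \end{align*} In particular, $Q[\Psi]=0$ if and only if $\Psi=0$.
   Context: $\mathrm{MAVal}_k(\mathbb{R}^n)$ is the space of continuous valuations $\Psi:\mathrm{Conv}(\mathbb{R}^n,\mathbb{R})\to\mathcal{M}(\mathbb{R}^n)$ (finite-valued convex functions, complex Radon measures) that are dually epi-translation invariant, locally determined, translation equivariant and $k$-homogeneous. $\Psi[\phi](f)=\int\phi\,d\Psi(f)$ is a complex-valued continuous dually epi-translation invariant $k$-homogeneous valuation; $\mathrm{GW}(\mu)$ denotes its Goodey-Weil distribution, the unique symmetric compactly supported distribution on $(\mathbb{R}^n)^k$ with $\mathrm{GW}(\mu)[f_1\otimes\dots\otimes f_k]=\bar\mu(f_1,\dots,f_k)$ (polarization) for smooth convex $f_i$; $\mathcal{F}$ is the Fourier-Laplace transform, $\mathcal{F}(\mathrm{GW}(\mu))[z_1,\dots,z_k]=\mathrm{GW}(\mu)[e^{i\langle z_1,\cdot\rangle}\otimes\dots\otimes e^{i\langle z_k,\cdot\rangle}]$. Homogeneous of degree $(2,\dots,2)$ means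 $2$-homogeneous in each argument. *)

(* Defs.v *)
From HB Require Import structures.
From mathcomp Require Import all_boot all_order all_algebra all_fingroup.
From mathcomp Require Import all_classical all_reals all_analysis.
From mathcomp Require Import complex.
Set Implicit Arguments. Unset Strict Implicit. Unset Printing Implicit Defensive.
Import Order.TTheory GRing.Theory Num.Theory.
Import numFieldNormedType.Exports.
Local Open Scope ring_scope.
Local Open Scope classical_set_scope.

Section MAValDefs.
Variable R : realType.
Local Notation C := R[i].

Definition cR (x : R) : C := Complex x 0.
Definition cI : C := Complex 0 1.
Definition reC (z : C) : R := complex.Re z.
Definition imC (z : C) : R := complex.Im z.
Definition cexp (w : C) : C := cR (expR (reC w)) * (cR (cos (imC w)) + cI * cR (sin (imC w))).

Definition dotR n (y x : 'rV[R]_n) : R := \sum_(i < n) y 0 i * x 0 i.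
Definition dotC n (w : 'rV[C]_n) (x : 'rV[R]_n) : C := \sum_(i < n) w 0 i * cR (x 0 i).

Definition convexR n (f : 'rV[R]_n -> R) : Prop :=
  forall (x y : 'rV[R]_n) (t : R), 0 <= t <= 1 ->
    f (t *: x + (1 - t) *: y) <= t * f x + (1 - t) * f y.

Definition supp n (phi : 'rV[R]_n -> C) : set 'rV[R]_n := closure [set x | phi x != 0].
Definition Cc n (phi : 'rV[R]_n -> C) : Prop :=
  continuous (fun x => reC (phi x)) /\ continuous (fun x => imC (phi x)) /\
  compact (supp phi).

(* complex Radon measure on R^n, given by its integration functional
   phi |-> \int phi d mu on C_c(R^n): C-linear and, for every compact K,
   bounded by c_K * sup|phi| on functions supported in K *)
Definition radon n (L : ('rV[R]_n -> C) -> C) : Prop :=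
  (forall (a : C) phi psi, Cc phi -> Cc psi ->
     L (fun x => a * phi x + psi x) = a * L phi + L psi) /\
  (forall K : set 'rV[R]_n, compact K -> exists c : R,
     forall phi (M : R), Cc phi -> supp phi `<=` K ->
       (forall x, `|phi x| <= cR M) -> `|L phi| <= cR (c * M)).

Definition cvgC (u : nat -> C) (l : C) : Prop :=
  (fun j => reC (u j)) @ \oo --> reC l /\ (fun j => imC (u j)) @ \oo --> imC l.

(* Psi f phi stands for \int phi dPsi(f).  MAVal_k(R^n): *)
Definition MAVal n (k : nat) (Psi : ('rV[R]_n -> R) -> ('rV[R]_n -> C) -> C) : Prop :=
  (forall f, convexR f -> radon (Psi f)) /\
  (forall f g, convexR f -> convexR g -> convexR (fun x => Num.min (f x) (g x)) ->
     forall phi, Cc phi ->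
       Psi (fun x => Num.max (f x) (g x)) phi + Psi (fun x => Num.min (f x) (g x)) phi
       = Psi f phi + Psi g phi) /\
  (* continuity: Conv carries the (metrizable) topology of epi-convergence, i.e.
     locally uniform convergence; M(R^n) the weak-* (vague) topology *)
  (forall (F : nat -> 'rV[R]_n -> R) f, (forall j, convexR (F j)) -> convexR f ->
     (forall K : set 'rV[R]_n, compact K -> forall e : R, 0 < e ->
        \forall j \near \oo, forall x, K x -> `|F j x - f x| < e) ->
     forall phi, Cc phi -> cvgC (fun j => Psi (F j) phi) (Psi f phi)) /\
  (forall f, convexR f -> forall (y : 'rV[R]_n) (c : R) phi, Cc phi ->
     Psi (fun x => f x + dotR y x + c) phi = Psi f phi) /\
  (forall f g (U : set 'rV[R]_n), convexR f -> convexR g -> open U ->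
     (forall x, U x -> f x = g x) ->
     forall phi, Cc phi -> supp phi `<=` U -> Psi f phi = Psi g phi) /\
  (forall f, convexR f -> forall (y : 'rV[R]_n) phi, Cc phi ->
     Psi (fun x => f (x - y)) phi = Psi f (fun x => phi (x + y))) /\
  (forall f, convexR f -> forall t : R, 0 < t -> forall phi, Cc phi ->
     Psi (fun x => t * f x) phi = cR (t ^+ k) * Psi f phi).

Definition polar n k (mu : ('rV[R]_n -> R) -> C) (fs : 'I_k -> 'rV[R]_n -> R) : C :=
  (k`!%:R)^-1 * \sum_(S : {set 'I_k})
      (-1) ^+ (k - #|S|) * mu (fun x => \sum_(i in S) fs i x).

Definition iterD (V : normedModType R) (vs : seq V) (g : V -> R) : V -> R :=
  foldr (fun v h => fun a => derive h a v) g vs.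
Definition smooth (V : normedModType R) (g : V -> R) : Prop :=
  forall vs : seq V, continuous (iterD vs g) /\
    (forall a v, derivable (iterD vs g) a v).
Definition smoothC (V : normedModType R) (g : V -> C) : Prop :=
  smooth (fun x => reC (g x)) /\ smooth (fun x => imC (g x)).

(* (R^n)^k is modelled as k x n real matrices, row j being the j-th point *)
(* compactly supported distribution on (R^n)^k : C-linear functional on smooth
   functions with |T g| <= c * max_{|alpha| <= N} sup_K |d^alpha g| *)
Definition cdistr k n (T : ('M[R]_(k, n) -> C) -> C) : Prop :=
  (forall (a : C) g h, smoothC g -> smoothC h ->
     T (fun x => a * g x + h x) = a * T g + T h) /\
  (exists K : set 'M[R]_(k, n), compact K /\ exists (N : nat) (c : R),
     forall g (M : R), smoothC g ->
       (forall vs : seq 'M[R]_(k, n), (size vs <= N)%N ->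
          (forall v, v \in vs -> `|v| <= 1) ->
          forall x, K x -> `|iterD vs (fun y => reC (g y)) x| <= M /\
                           `|iterD vs (fun y => imC (g y)) x| <= M) ->
       `|T g| <= cR (c * M)).

Definition tensorR k n (fs : 'I_k -> 'rV[R]_n -> R) : 'M[R]_(k, n) -> C :=
  fun z => cR (\prod_(j < k) fs j (row j z)).

Definition isGW n k (mu : ('rV[R]_n -> R) -> C) (T : ('M[R]_(k, n) -> C) -> C) : Prop :=
  cdistr T /\
  (forall (s : 'S_k) g, smoothC g -> T (fun z => g (row_perm s z)) = T g) /\
  (forall fs : 'I_k -> 'rV[R]_n -> R, (forall j, convexR (fs j) /\ smooth (fs j)) ->
     T (tensorR fs) = polar mu fs).

Definition FL k n (T : ('M[R]_(k, n) -> C) -> C) (z : 'M[C]_(k, n)) : C :=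
  T (fun x => \prod_(j < k) cexp (cI * dotC (row j z) (row j x))).

(* Lebesgue integral over R^n as iterated one-dimensional integrals *)
Definition upd (x : nat -> R) (m : nat) (t : R) : nat -> R :=
  fun i => if i == m then t else x i.
Fixpoint iint (m : nat) (g : (nat -> R) -> R) : R :=
  match m with
  | 0 => g (fun _ => 0)
  | m'.+1 => iint m' (fun x => Rintegral (@lebesgue_measure R) setT (fun t => g (upd x m' t)))
  end.
Definition intRn n (h : 'rV[R]_n -> R) : R := iint n (fun x => h (\row_(i < n) x i)).

Definition FT n (phi : 'rV[R]_n -> C) (w : 'rV[C]_n) : C :=
  let g := fun x => phi x * cexp (cI * dotC w x) in
  cR (intRn (fun x => reC (g x))) + cI * cR (intRn (fun x => imC (g x))).

Definition poly22 k n (Q : 'M[C]_(k, n) -> C) : Prop :=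
  exists c : {ffun 'I_k -> 'I_n * 'I_n} -> C, forall z,
    Q z = \sum_(a : {ffun 'I_k -> 'I_n * 'I_n}) c a * \prod_(j < k) (z j (a j).1 * z j (a j).2).
Definition symmQ k n (Q : 'M[C]_(k, n) -> C) : Prop :=
  forall (s : 'S_k) z, Q (row_perm s z) = Q z.

Definition Qrep n k (Psi : ('rV[R]_n -> R) -> ('rV[R]_n -> C) -> C) (Q : 'M[C]_(k, n) -> C) : Prop :=
  poly22 Q /\ symmQ Q /\
  forall phi, Cc phi -> forall T, isGW (fun f => Psi f phi) T ->
    forall z : 'M[C]_(k, n),
      FL T z = (-1) ^+ k / (k`!%:R) * Q z * FT phi (\sum_(j < k) row j z).

End MAValDefs.

(* Main.v *)
(** Write [m(f) = Psi f phi].  Splitting off a kink [w * max(0, <a, x> - c)] by the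
    valuation property shows that [m] is additive along ridge functions of a fixed
    direction, and approximating a smooth ridge function by kinks shows that
    [m (f + t * u(<a, .>))] is affine in [t].  On quadratic forms translation
    equivariance makes [Psi (q_A)] a multiple of Lebesgue measure, and the multiple is
    a form [PH c A] of degree [k] in [A], affine in every rank-one direction.  Hence
    [Psi f phi = \int PH c (D^2 f) phi] first for quadratic forms plus trigonometric
    polynomials (sums of ridge functions), then, by density of trigonometric
    polynomials and averaging over boxes, for every smooth convex [f], and
    [PH c = 0] forces [Psi = 0] by box averages of arbitrary convex [f].  Polarization
    yields the Goodey-Weil distribution explicitly, and since [exp(i <z, .>)] is a
    complex combination of smooth convex functions its Fourier-Laplace transform
    carries the factor [Q], the polarization of [PH c] at the matrices [z_j z_j^T]. *)
Require Import Defs.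
From mathcomp Require Import all_boot all_order all_algebra all_fingroup.
From mathcomp Require Import all_classical all_reals all_analysis.
From mathcomp Require Import complex.
From mathcomp Require Import ring lra.
Set Implicit Arguments. Unset Strict Implicit. Unset Printing Implicit Defensive.
Import Order.TTheory GRing.Theory Num.Theory.
Import numFieldNormedType.Exports.
Local Open Scope ring_scope.
Local Open Scope classical_set_scope.

(** * A real-valued norm and limits on the complex numbers *)

Section ComplexNorm.
Variable R : realType.
Local Notation C := R[i].

(** The obstacle is that [Psi] is defined on convex functions only, so an identity is first
    available on a cone, where the function carries a large quadratic part. As a function of the
    coefficient t of an added [qd a], the valuation is affine for t >= 0; if it agrees with a
    polynomial for large t, it agrees at t = 0. This descent is used three times: for quadratic
    forms, for trigonometric perturbations, and for averages. The second obstacle is that a general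
    convex function is no finite sum of ridge functions, and that uniform approximation does not
    control Hessians. Averaging over boxes twice in every direction cures this: the Hessian of such
    an average is a second difference quotient of a partial average, so it is bounded by the sup
    norm divided by eps^2. One large quadratic then makes a whole sequence of non-convex
    approximants convex. Cosines are the building blocks because they are ridge functions, their
    products are again sums of cosines, and averaging maps each cosine to a cosine of the same
    frequency. *)

Definition nC (z : C) : R := `|reC z| + `|imC z|.

Lemma reC_D (z w : C) : reC (z + w) = reC z + reC w.
Proof. by case: z w => a b [c d]. Qed.
Lemma imC_D (z w : C) : imC (z + w) = imC z + imC w.
Proof. by case: z w => a b [c d]. Qed.
Lemma reC_N (z : C) : reC (- z) = - reC z. Proof. by case: z. Qed.
Lemma imC_N (z : C) : imC (- z) = - imC z. Proof. by case: z. Qed.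
Lemma reC_M (z w : C) : reC (z * w) = reC z * reC w - imC z * imC w.
Proof. by case: z w => a b [c d]. Qed.
Lemma imC_M (z w : C) : imC (z * w) = reC z * imC w + imC z * reC w.
Proof. by case: z w => a b [c d]. Qed.
Lemma reC0 : reC (0 : C) = 0. Proof. by []. Qed.
Lemma imC0 : imC (0 : C) = 0. Proof. by []. Qed.

Lemma C_ext (z w : C) : reC z = reC w -> imC z = imC w -> z = w.
Proof. by case: z w => a b [c d] /= -> ->. Qed.

Lemma cRD (x y : R) : cR (x + y) = cR x + cR y.
Proof. by apply: C_ext; rewrite ?reC_D ?imC_D //= addr0. Qed.
Lemma cRN (x : R) : cR (- x) = - cR x.
Proof. by apply: C_ext; rewrite ?reC_N ?imC_N //= oppr0. Qed.
Lemma cRM (x y : R) : cR (x * y) = cR x * cR y.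
Proof. by apply: C_ext; rewrite ?reC_M ?imC_M //= ?mulr0 ?mul0r ?subr0 ?addr0. Qed.
Lemma cR0 : cR (0 : R) = 0. Proof. by []. Qed.
Lemma cR1 : cR (1 : R) = 1. Proof. by []. Qed.

Lemma C_split (z : C) : z = cR (reC z) + cI R * cR (imC z).
Proof.
by apply: C_ext; rewrite ?reC_D ?imC_D ?reC_M ?imC_M /=;
  rewrite ?mul0r ?mul1r ?mulr0 ?subr0 ?addr0 ?add0r.
Qed.

Lemma nC_ge0 z : 0 <= nC z. Proof. by rewrite addr_ge0. Qed.
Lemma nC0 : nC 0 = 0. Proof. by rewrite /nC reC0 imC0 normr0 addr0. Qed.
Lemma nC_eq0 z : nC z <= 0 -> z = 0.
Proof.
rewrite /nC => h; apply: C_ext; rewrite ?reC0 ?imC0; apply: normr0_eq0; apply/eqP;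
  rewrite eq_le normr_ge0 andbT; apply: le_trans h; by rewrite ?lerDl ?lerDr.
Qed.
Lemma nC_D z w : nC (z + w) <= nC z + nC w.
Proof.
rewrite /nC reC_D imC_D addrACA lerD //; exact: ler_normD.
Qed.
Lemma nC_N z : nC (- z) = nC z. Proof. by rewrite /nC reC_N imC_N !normrN. Qed.
Lemma nC_B z w : nC (z - w) = nC (w - z). Proof. by rewrite -nC_N opprB. Qed.
Lemma nC_M z w : nC (z * w) <= nC z * nC w.
Proof.
rewrite /nC reC_M imC_M mulrDl !mulrDr -!normrM.
have h1 := ler_normB (reC z * reC w) (imC z * imC w).
have h2 := ler_normD (reC z * imC w) (imC z * reC w).
lra.
Qed.
Lemma nC_cR (x : R) : nC (cR x) = `|x|. Proof. by rewrite /nC /= normr0 addr0. Qed.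
Lemma nC_sum (I : Type) (r : seq I) (P : pred I) (F : I -> C) :
  nC (\sum_(i <- r | P i) F i) <= \sum_(i <- r | P i) nC (F i).
Proof.
elim/big_ind2: _ => [|x1 x2 y1 y2 h1 h2|//]; first by rewrite nC0.
by apply: le_trans (nC_D _ _) _; rewrite lerD.
Qed.
Lemma cR_le (x y : R) : (cR x <= cR y) = (x <= y).
Proof. by rewrite /cR lecE /= eqxx. Qed.
(** Together with [nC_le_norm] this trades bounds on the complex-valued modulus for bounds in the
    real-valued l1 norm, at the price of a factor 2. *)
Lemma norm_le_nC z : `|z| <= cR (nC z).
Proof.
rewrite {1}(C_split z); apply: le_trans (ler_normD _ _) _.
rewrite normrM /nC cRD.
have nr (x : R) : `|cR x| = cR `|x|.
  by rewrite normc_def /= expr0n /= addr0 sqrtr_sqr.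
have -> : `|cI R| = 1 by rewrite normc_def /= expr0n /= add0r expr1n sqrtr1.
by rewrite mul1r !nr.
Qed.
Lemma nC_le_norm z (M : R) : `|z| <= cR M -> nC z <= 2 * M.
Proof.
rewrite normc_def /= -/(cR _) cR_le /nC /reC /imC => h.
have h1 : `|complex.Re z| <= M.
  apply: le_trans h; rewrite -sqrtr_sqr ler_wsqrtr // lerDl sqr_ge0 //.
have h2 : `|complex.Im z| <= M.
  apply: le_trans h; rewrite -sqrtr_sqr ler_wsqrtr // lerDr sqr_ge0 //.
lra.
Qed.

Definition clim (u : nat -> C) (l : C) :=
  forall e : R, 0 < e -> exists N, forall j, (N <= j)%N -> nC (u j - l) < e.

Lemma clim_unique u l l' : clim u l -> clim u l' -> l = l'.
Proof.
move=> h h'; apply/eqP; rewrite -subr_eq0; apply/eqP/nC_eq0.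
apply/ler_addgt0Pr => e e0; rewrite add0r.
have e2 : 0 < e / 2 by rewrite divr_gt0.
have [N hN] := h _ e2; have [N' hN'] := h' _ e2.
have := hN (maxn N N') (leq_maxl _ _); have := hN' (maxn N N') (leq_maxr _ _).
set w := u _; rewrite (nC_B w l) => a b.
have := nC_D (l - w) (w - l'); rewrite addrA subrK; lra.
Qed.
Lemma clim_cst l : clim (fun=> l) l.
Proof. by move=> e e0; exists 0%N => j _; rewrite subrr nC0. Qed.
Lemma clim_ext u v l : u =1 v -> clim u l -> clim v l.
Proof. by move=> /funext ->. Qed.
Lemma climD u v l m : clim u l -> clim v m -> clim (fun j => u j + v j) (l + m).
Proof.
move=> h h' e e0; have e2 : 0 < e / 2 by rewrite divr_gt0.
have [N hN] := h _ e2; have [N' hN'] := h' _ e2.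
exists (maxn N N') => j; rewrite geq_max => /andP[/hN a /hN' b].
rewrite opprD addrACA; have := nC_D (u j - l) (v j - m); lra.
Qed.
Lemma climM c u l : clim u l -> clim (fun j => c * u j) (c * l).
Proof.
move=> h e e0; have c0 : 0 < nC c + 1 by rewrite ltr_wpDl ?nC_ge0.
have [N hN] := h (e / (nC c + 1)) (divr_gt0 e0 c0).
exists N => j /hN; rewrite ltr_pdivlMr // => a; rewrite -mulrBr.
apply: le_lt_trans (nC_M _ _) _; apply: le_lt_trans a.
rewrite mulrC ler_wpM2l ?nC_ge0 // lerDl //.
Qed.
Lemma climN u l : clim u l -> clim (fun j => - u j) (- l).
Proof.
move=> /(climM (-1)); rewrite mulN1r; apply: clim_ext => j; by rewrite mulN1r.
Qed.
Lemma climB u v l m : clim u l -> clim v m -> clim (fun j => u j - v j) (l - m).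
Proof. by move=> h /climN h'; apply: climD. Qed.

Lemma cvgC_clim u l : cvgC u l -> clim u l.
Proof.
move=> [/cvgrPdist_lt h1 /cvgrPdist_lt h2] e e0.
have e2 : 0 < e / 2 by rewrite divr_gt0.
have [N _ hN] := h1 _ e2; have [N' _ hN'] := h2 _ e2.
exists (maxn N N') => j; rewrite geq_max => /andP[/hN /= a /hN' /= b].
rewrite nC_B /nC !reC_D !imC_D !reC_N !imC_N; lra.
Qed.

End ComplexNorm.

(** * Uniform continuity, compactly supported functions, bounded functionals *)

Section Topology.
Variable R : realType.
Local Notation C := R[i].

Lemma mx_coord_le m n (x : 'M[R]_(m, n)) i j : `|x i j| <= `|x|.
Proof.
rewrite [leRHS]/Num.norm /= mx_normrE; apply/bigmax_geP; right => /=.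
by exists (i, j).
Qed.

Lemma mx_norm_le m n (x : 'M[R]_(m, n)) (M : R) :
  0 <= M -> (forall i j, `|x i j| <= M) -> `|x| <= M.
Proof.
move=> M0 h; rewrite [leLHS]/Num.norm /= mx_normrE.
by apply/bigmax_leP; split => // -[i j] _; exact: h.
Qed.

Lemma mx_norm_lt m n (x : 'M[R]_(m, n)) (M : R) :
  0 < M -> (forall i j, `|x i j| < M) -> `|x| < M.
Proof.
move=> M0 h; rewrite [ltLHS]/Num.norm /= mx_normrE.
by apply/bigmax_ltP; split => // -[i j] _; exact: h.
Qed.

Lemma continuous_epsP (V W : normedModType R) (f : V -> W) :
  continuous f <-> forall x (e : R), 0 < e ->
    exists2 d : R, 0 < d & forall y, `|x - y| < d -> `|f x - f y| < e.
Proof.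
split => [cf x e e0|h x].
  have /cvgrPdist_lt /(_ _ e0) := cf x.
  by move=> /nbhs_normP[d /= d0 hd]; exists d => // y xy; apply: hd.
apply/cvgrPdist_lt => e e0; have [d d0 hd] := h x e e0.
by apply/nbhs_normP; exists d => //= y; exact: hd.
Qed.

Lemma coord_continuous m n (i : 'I_m) (j : 'I_n) :
  continuous (fun x : 'M[R]_(m, n) => x i j).
Proof.
apply/continuous_epsP => x e e0; exists e => // y; apply: le_lt_trans.
by have := mx_coord_le (x - y) i j; rewrite !mxE.
Qed.

(** Stronger than uniform continuity on K, since the second point may leave K; averages and
    difference steps near the boundary of a ball rely on this. Near-covering compactness is applied
    to d tending to 0 from the right, and the halves leave room for moving the centre. *)
Lemma compact_unif_cont (V W : normedModType R) (f : V -> W) (K : set V) (e : R) :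
  continuous f -> compact K -> 0 < e ->
  exists2 d : R, 0 < d &
    forall x y, K x -> `|x - y| < d -> `|f x - f y| < e.
Proof.
move=> cf /compact_near_coveringP cK e0.
pose P (d : R) (x : V) := forall y, `|x - y| < d -> `|f x - f y| < e.
have : \forall d \near 0^'+, K `<=` P d.
  apply: cK => x Kx.
  have e2 : 0 < e / 2 by rewrite divr_gt0.
  have [d d0 hd] := (continuous_epsP f).1 cf x (e / 2) e2.
  have d2 : 0 < d / 2 by rewrite divr_gt0.
  exists ([set x' | `|x - x'| < d / 2], [set d' | d' < d / 2]) => /=.
    split; first by apply/nbhs_normP; exists (d / 2).
    exact: nbhs_right_lt.
  move=> [x' d'] /= [h1 h2] y h3.
  have a : `|f x - f x'| < e / 2 by apply: hd; lra.
  have b : `|f x - f y| < e / 2.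
    apply: hd; have := ler_normD (x - x') (x' - y); rewrite addrA subrK; lra.
  have := ler_normD (f x' - f x) (f x - f y); rewrite addrA subrK (distrC (f x') (f x)).
  lra.
move=> /(filterI (nbhs_right_gt 0)) /filter_ex [d [d0 hd]].
by exists d => // x y /hd h /h.
Qed.

Definition cball n (B : R) : set 'rV[R]_n := [set x | `|x| <= B].

Lemma compact_cball n B : compact (@cball n B).
Proof.
apply: bounded_closed_compact.
  exists `|B|; split; first by rewrite normr_real.
  move=> M hM x /= hx; rewrite /cball /= in hx.
  by apply: le_trans hx _; apply: le_trans (ler_norm _) (ltW hM).
have -> : @cball n B = Num.norm @^-1` [set y | y <= B] by [].
apply: closed_comp; last exact: closed_le.
by move=> x _; exact: norm_continuous.
Qed.

Lemma compact_sub_cball n (K : set 'rV[R]_n) :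
  compact K -> exists2 B : R, 0 < B & K `<=` cball B.
Proof.
move=> /compact_bounded[M [Mr hM]]; exists (`|M| + 1); first by rewrite ltr_wpDl.
move=> x Kx; apply: hM Kx; apply: le_lt_trans (ler_norm M) _; lra.
Qed.

Lemma CcP n (phi : 'rV[R]_n -> C) :
  Cc phi <-> [/\ continuous (fun x => reC (phi x)),
    continuous (fun x => imC (phi x)) &
    exists2 B : R, 0 < B & forall x, B < `|x| -> phi x = 0].
Proof.
split => [[h1 [h2 h3]]|[h1 h2 [B B0 hB]]].
  split => //; have [B B0 hB] := compact_sub_cball h3; exists B => // x xB.
  apply/eqP; apply/negPn/negP => h.
  have /hB : supp phi x by apply: subset_closure.
  by rewrite /cball /= leNgt xB.
split => //; split => //.
have sK : supp phi `<=` cball B.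
  rewrite /supp; have -> : cball B = closure (@cball n B).
    apply/closure_id; exact: (compact_closed (@norm_hausdorff _ _) (@compact_cball n B)).
  apply: closure_subset => x /=; apply: contra_neqP => /negP.
  by rewrite /cball /= -ltNge; exact: hB.
apply: subclosed_compact sK; last exact: compact_cball.
exact: closed_closure.
Qed.

Lemma Cc_cont n (phi : 'rV[R]_n -> C) : Cc phi ->
  continuous (fun x => reC (phi x)) /\ continuous (fun x => imC (phi x)).
Proof. by case => h [h' _]. Qed.

Lemma supp_sub n (phi : 'rV[R]_n -> C) (K : set 'rV[R]_n) :
  closed K -> (forall x, phi x != 0 -> K x) -> supp phi `<=` K.
Proof.
move=> /closure_id cK h; rewrite [X in _ `<=` X]cK.
by apply: closure_subset => x; exact: h.
Qed.

Lemma rcontD (V : normedModType R) (f g : V -> R) :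
  continuous f -> continuous g -> continuous (fun x => f x + g x).
Proof. by move=> cf cg x; exact: cvgD (cf x) (cg x). Qed.
Lemma rcontM (V : normedModType R) (f g : V -> R) :
  continuous f -> continuous g -> continuous (fun x => f x * g x).
Proof. by move=> cf cg x; exact: cvgM (cf x) (cg x). Qed.
Lemma rcont_cst (V : normedModType R) (a : R) : continuous (fun _ : V => a).
Proof. by move=> x; exact: cvg_cst. Qed.
Lemma rcont_lin (V : normedModType R) (a : R) (f g : V -> R) :
  continuous f -> continuous g -> continuous (fun x => a * f x + g x).
Proof. by move=> cf cg; apply: rcontD => //; apply: rcontM => //; exact: rcont_cst. Qed.
Lemma rcont_sum (V : normedModType R) I (r : seq I) (P : pred I) (g : I -> V -> R) :
  (forall i, P i -> continuous (g i)) -> continuous (fun x => \sum_(i <- r | P i) g i x).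
Proof.
move=> h; elim: r => [|i r IH].
  have -> : (fun x => \sum_(i <- [::] | P i) g i x) = fun=> 0 by apply: funext => x; rewrite big_nil.
  exact: rcont_cst.
have -> : (fun x => \sum_(j <- i :: r | P j) g j x) =
    fun x => if P i then g i x + \sum_(j <- r | P j) g j x else \sum_(j <- r | P j) g j x.
  by apply: funext => x; rewrite big_cons.
have := h i; case: (P i) => // hi.
by apply: rcontD => //; exact: hi.
Qed.
Lemma rcont_prod (V : normedModType R) I (r : seq I) (P : pred I) (g : I -> V -> R) :
  (forall i, P i -> continuous (g i)) -> continuous (fun x => \prod_(i <- r | P i) g i x).
Proof.
move=> h; elim: r => [|i r IH].
  have -> : (fun x => \prod_(i <- [::] | P i) g i x) = fun=> 1 by apply: funext => x; rewrite big_nil.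
  exact: rcont_cst.
have -> : (fun x => \prod_(j <- i :: r | P j) g j x) =
    fun x => if P i then g i x * \prod_(j <- r | P j) g j x else \prod_(j <- r | P j) g j x.
  by apply: funext => x; rewrite big_cons.
have := h i; case: (P i) => // hi.
by apply: rcontM => //; exact: hi.
Qed.
Lemma rcont_comp (V W : normedModType R) (U : normedModType R) (f : V -> W) (g : W -> U) :
  continuous f -> continuous g -> continuous (fun x => g (f x)).
Proof. by move=> cf cg x; apply: (@continuous_comp _ _ _ f g); [exact: cf|exact: cg]. Qed.

Definition ccont (V : normedModType R) (g : V -> C) :=
  continuous (fun x => reC (g x)) /\ continuous (fun x => imC (g x)).

Lemma ccontD (V : normedModType R) (g h : V -> C) :
  ccont g -> ccont h -> ccont (fun x => g x + h x).
Proof.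
move=> [g1 g2] [h1 h2]; split => x.
  under eq_fun do rewrite reC_D; exact: cvgD (g1 x) (h1 x).
under eq_fun do rewrite imC_D; exact: cvgD (g2 x) (h2 x).
Qed.
Lemma ccontM (V : normedModType R) (g h : V -> C) :
  ccont g -> ccont h -> ccont (fun x => g x * h x).
Proof.
move=> [g1 g2] [h1 h2]; split => x.
  under eq_fun do rewrite reC_M; apply: cvgB.
    exact: cvgM (g1 x) (h1 x). 
  exact: cvgM (g2 x) (h2 x).
under eq_fun do rewrite imC_M; apply: cvgD.
  exact: cvgM (g1 x) (h2 x). 
exact: cvgM (g2 x) (h1 x).
Qed.
Lemma ccont_cst (V : normedModType R) (c : C) : ccont (fun _ : V => c).
Proof. by split => x; exact: cvg_cst. Qed.
Lemma ccont_cR (V : normedModType R) (g : V -> R) :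
  continuous g -> ccont (fun x => cR (g x)).
Proof. by move=> h; split => // x; exact: cvg_cst. Qed.
Lemma ccont_sum (V : normedModType R) I (r : seq I) (P : pred I) (g : I -> V -> C) :
  (forall i, P i -> ccont (g i)) -> ccont (fun x => \sum_(i <- r | P i) g i x).
Proof.
move=> h; elim: r => [|i r IH].
  have -> : (fun x => \sum_(i <- [::] | P i) g i x) = fun=> 0 by apply: funext => x; rewrite big_nil.
  exact: ccont_cst.
have -> : (fun x => \sum_(j <- i :: r | P j) g j x) = fun x => if P i then g i x + \sum_(j <- r | P j) g j x else \sum_(j <- r | P j) g j x.
  by apply: funext => x; rewrite big_cons.
have := h i; case: (P i) => // hi.
by apply: ccontD => //; exact: hi.
Qed.
Lemma ccont_prod (V : normedModType R) I (r : seq I) (P : pred I) (g : I -> V -> C) :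
  (forall i, P i -> ccont (g i)) -> ccont (fun x => \prod_(i <- r | P i) g i x).
Proof.
move=> h; elim: r => [|i r IH].
  have -> : (fun x => \prod_(i <- [::] | P i) g i x) = fun=> 1 by apply: funext => x; rewrite big_nil.
  exact: ccont_cst.
have -> : (fun x => \prod_(j <- i :: r | P j) g j x) = fun x => if P i then g i x * \prod_(j <- r | P j) g j x else \prod_(j <- r | P j) g j x.
  by apply: funext => x; rewrite big_cons.
have := h i; case: (P i) => // hi.
by apply: ccontM => //; exact: hi.
Qed.

Lemma ccont_bounded (V : normedModType R) (g : V -> C) (K : set V) :
  ccont g -> compact K -> exists2 M : R, 0 < M & forall x, K x -> nC (g x) <= M.
Proof.
move=> [g1 g2] cK.
have bd (h : V -> R) : continuous h -> exists2 M : R, 0 < M & forall x, K x -> `|h x| <= M.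
  move=> ch; have := continuous_compact (continuous_subspaceT ch) cK.
  move=> /compact_bounded[M [Mr hM]]; exists (`|M| + 1); first by rewrite ltr_wpDl.
  move=> x Kx; apply: (hM (`|M| + 1)); last by exists x.
  apply: le_lt_trans (ler_norm M) _; lra.
have [M1 M10 h1] := bd _ g1; have [M2 M20 h2] := bd _ g2.
exists (M1 + M2); first by rewrite addr_gt0.
by move=> x Kx; rewrite lerD ?h1 ?h2.
Qed.

Lemma CcM n (phi : 'rV[R]_n -> C) (g : 'rV[R]_n -> C) :
  Cc phi -> ccont g -> Cc (fun x => g x * phi x).
Proof.
move=> /CcP[h1 h2 [B B0 hB]] cg; apply/CcP.
have [h1' h2'] := ccontM cg (conj h1 h2); split => //.
by exists B => // x /hB ->; rewrite mulr0.
Qed.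

Lemma Cc_bounded n (phi : 'rV[R]_n -> C) :
  Cc phi -> exists2 M : R, 0 < M & forall x, nC (phi x) <= M.
Proof.
move=> /CcP[h1 h2 [B B0 hB]].
have [M M0 hM] := ccont_bounded (conj h1 h2) (@compact_cball n B).
exists M => // x; have [xB|xB] := leP `|x| B; first exact: hM.
by rewrite hB // nC0 ltW.
Qed.

(** Working form of [radon]: balls replace compact sets, vanishing off a ball replaces the support
    condition, and [nC] replaces the modulus. The constant is taken positive so that it can be
    divided by. *)
Definition cradon n (L : ('rV[R]_n -> C) -> C) : Prop :=
  (forall (a : C) phi psi, Cc phi -> Cc psi ->
     L (fun x => a * phi x + psi x) = a * L phi + L psi) /\
  (forall B : R, exists2 c : R, 0 < c & forall phi (M : R), Cc phi ->
     (forall x, B < `|x| -> phi x = 0) ->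
       (forall x, nC (phi x) <= M) -> nC (L phi) <= c * M).

Lemma radon_cradon n (L : ('rV[R]_n -> C) -> C) : radon L -> cradon L.
Proof.
move=> [h1 h2]; split => // B.
have [c hc] := h2 _ (@compact_cball n B).
exists (2 * (`|c| + 1)); first by rewrite mulr_gt0 // ltr_wpDl.
move=> phi M cphi hB hM.
have M0 : 0 <= M by apply: le_trans (hM 0); exact: nC_ge0.
rewrite -mulrA; have : nC (L phi) <= 2 * (c * M).
  apply: nC_le_norm; apply: hc => //.
    apply: supp_sub; first exact: (compact_closed (@norm_hausdorff _ _) (@compact_cball n B)).
    by move=> x; apply: contra_neqP => /negP; rewrite /cball /= -ltNge; exact: hB.
  move=> x; apply: le_trans (norm_le_nC _) _; rewrite cR_le; exact: hM.
move=> /le_trans; apply; rewrite ler_wpM2l // ler_wpM2r //.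
apply: le_trans (ler_norm c) _; lra.
Qed.

Section CradonTheory.
Variables (n : nat) (L : ('rV[R]_n -> C) -> C).
Hypothesis rL : cradon L.

Lemma Cc0 : Cc (fun _ : 'rV[R]_n => 0 : C).
Proof.
have [a b] := @ccont_cst 'rV[R]_n 0.
by apply/CcP; split => //; exists 1.
Qed.
Lemma CcZ a (phi : 'rV[R]_n -> C) : Cc phi -> Cc (fun x => a * phi x).
Proof. by move=> h; apply: CcM => //; exact: ccont_cst. Qed.
Lemma CcD (phi psi : 'rV[R]_n -> C) : Cc phi -> Cc psi -> Cc (fun x => phi x + psi x).
Proof.
move=> /CcP[h1 h2 [B B0 hB]] /CcP[k1 k2 [B' B0' hB']]; apply/CcP.
have [a b] := ccontD (conj h1 h2) (conj k1 k2); split => //.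
exists (Num.max B B'); first by rewrite lt_max B0.
by move=> x; rewrite gt_max => /andP[/hB -> /hB' ->]; rewrite addr0.
Qed.
Lemma CcB (phi psi : 'rV[R]_n -> C) : Cc phi -> Cc psi -> Cc (fun x => phi x - psi x).
Proof.
move=> h h'; have -> : (fun x => phi x - psi x) = (fun x => phi x + -1 * psi x).
  by apply: funext => x; rewrite mulN1r.
by apply: CcD => //; exact: CcZ.
Qed.
Lemma cradon0 : L (fun=> 0) = 0.
Proof.
have h : L (fun=> 0) = 1 * L (fun=> 0) + L (fun=> 0).
  rewrite -(rL.1 1 _ _ Cc0 Cc0); congr L.
  by apply: funext => x; rewrite mulr0 addr0.
by apply: (@addrI _ (L (fun=> 0))); rewrite addr0 {3}h mul1r.
Qed.
Lemma cradonZ a phi : Cc phi -> L (fun x => a * phi x) = a * L phi.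
Proof.
move=> h; have := rL.1 a _ _ h Cc0; rewrite cradon0 addr0 => <-.
by congr L; apply: funext => x; rewrite addr0.
Qed.
Lemma cradonD phi psi : Cc phi -> Cc psi -> L (fun x => phi x + psi x) = L phi + L psi.
Proof.
move=> h h'; have := rL.1 1 _ _ h h'; rewrite mul1r => <-.
by congr L; apply: funext => x; rewrite mul1r.
Qed.
Lemma cradonB phi psi : Cc phi -> Cc psi -> L (fun x => phi x - psi x) = L phi - L psi.
Proof.
move=> h h'; have -> : (fun x => phi x - psi x) = (fun x => phi x + -1 * psi x).
  by apply: funext => x; rewrite mulN1r.
by rewrite cradonD ?cradonZ ?mulN1r //; exact: CcZ.
Qed.
Lemma cradon_sum I (r : seq I) (F : I -> 'rV[R]_n -> C) :
  (forall i, Cc (F i)) ->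
  Cc (fun x => \sum_(i <- r) F i x) /\
  L (fun x => \sum_(i <- r) F i x) = \sum_(i <- r) L (F i).
Proof.
move=> h; elim: r => [|i r [IH1 IH2]].
  have -> : (fun x => \sum_(i <- [::]) F i x) = fun=> 0 by apply: funext => x; rewrite big_nil.
  rewrite big_nil cradon0; split => //; exact: Cc0.
have e : (fun x => \sum_(j <- i :: r) F j x) = (fun x => F i x + \sum_(j <- r) F j x).
  by apply: funext => x; rewrite big_cons.
by rewrite e big_cons cradonD // IH2; split => //; exact: CcD.
Qed.
(** All functions vanish off one ball, so a single constant of [cradon] serves every index. *)
Lemma cradon_clim (F : nat -> 'rV[R]_n -> C) phi (B : R) :
  (forall j, Cc (F j)) -> Cc phi ->
  (forall j x, B < `|x| -> F j x = 0) -> (forall x, B < `|x| -> phi x = 0) ->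
  (forall e : R, 0 < e -> exists N, forall j, (N <= j)%N ->
     forall x, `|x| <= B -> nC (F j x - phi x) <= e) ->
  clim (fun j => L (F j)) (L phi).
Proof.
move=> cF cphi FB phiB h e e0; have [c c0 hc] := rL.2 B.
have [N hN] := h (e / (2 * c)) (divr_gt0 e0 (mulr_gt0 (ltr0n _ 2) c0)).
exists N => j /hN hj; rewrite -cradonB //.
apply: (@le_lt_trans _ _ (c * (e / (2 * c)))).
  apply: hc; [exact: CcB | by move=> x xB; rewrite FB ?phiB ?subrr|].
  move=> x; have [xB|xB] := leP `|x| B; first exact: hj.
  by rewrite FB ?phiB // subrr nC0 divr_ge0 ?mulr_ge0 ?ltW.
have -> : c * (e / (2 * c)) = e / 2 by field; rewrite gt_eqF.
lra.
Qed.
End CradonTheory.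

End Topology.

(** * One-dimensional integrals over segments *)

Section Integral1.
Variable R : realType.
Notation mu := (@lebesgue_measure R).

Definition lint (a b : R) (f : R -> R) : R := Rintegral mu `[a, b] f.

Lemma lint_integrable (a b : R) (f : R -> R) : continuous f -> mu.-integrable `[a, b] (EFin \o f).
Proof.
move=> cf; apply: continuous_compact_integrable; first exact: segment_compact.
exact: continuous_subspaceT.
Qed.

Lemma lint_lin (a b c : R) (f g : R -> R) : continuous f -> continuous g ->
  lint a b (fun t => c * f t + g t) = c * lint a b f + lint a b g.
Proof.
move=> cf cg; rewrite /lint RintegralD //; last exact: lint_integrable.
  by rewrite RintegralZl //; exact: lint_integrable.
by apply: lint_integrable => x; apply: cvgM; [exact: cvg_cst|exact: cf].
Qed.

Lemma lint_cst (a b c : R) : a <= b -> lint a b (fun=> c) = (b - a) * c.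
Proof.
move=> ab; rewrite /lint Rintegral_cst //= lebesgue_measure_itv /= lte_fin.
case: ltP => [_|ba]; rewrite mulrC ?fineB ?EFinB //=.
have -> : b = a by apply/eqP; rewrite eq_le ba ab.
by rewrite subrr !mul0r.
Qed.

Lemma lint_le (a b : R) (f g : R -> R) : continuous f -> continuous g ->
  (forall t, a <= t <= b -> f t <= g t) -> lint a b f <= lint a b g.
Proof.
move=> cf cg h; apply: le_Rintegral => //; exact: lint_integrable.
Qed.

Lemma lint_eq (a b : R) (f g : R -> R) : (forall t, a <= t <= b -> f t = g t) -> lint a b f = lint a b g.
Proof. by move=> h; apply: eq_Rintegral => t; rewrite inE /= in_itv /= => /h. Qed.

Lemma lint_abs (a b : R) (f : R -> R) (M : R) : a <= b -> continuous f ->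
  (forall t, a <= t <= b -> `|f t| <= M) -> `|lint a b f| <= (b - a) * M.
Proof.
move=> ab cf h.
have cc (c : R) : continuous (fun _ : R => c) by move=> x; exact: cvg_cst.
rewrite ler_norml -mulrN -!lint_cst //; apply/andP; split; apply: lint_le => // t /h;
  by rewrite ler_norml => /andP[].
Qed.

Lemma lint_split (a b c : R) (f : R -> R) : a <= b -> b <= c -> continuous f ->
  lint a c f = lint a b f + lint b c f.
Proof.
move=> ab bc cf; rewrite /lint.
have := @Rintegral_itvB R f (BLeft a) (BRight c) b; rewrite !bnd_simp.
move=> /(_ (lint_integrable _ _ cf) ab bc).
rewrite Rintegral_itv_obnd_cbnd; first by move=> <-; rewrite addrC subrK.
apply: integrableS (lint_integrable a c cf) => //.
by move=> t /=; rewrite !in_itv /= => /andP[h1 h2]; rewrite h2 andbT (le_trans ab) // ltW.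
Qed.

Lemma lint_FTC (a b : R) (f F : R -> R) : a < b -> continuous f ->
  (forall t : R, is_derive t (1 : R) F (f t)) -> lint a b f = F b - F a.
Proof.
move=> ab cf dF.
have cF : continuous F.
  by move=> t; apply: differentiable_continuous; apply/derivable1_diffP; case: (dF t).
rewrite /lint /Rintegral (@continuous_FTC2 R f F a b) //=.
- exact: continuous_subspaceT.
- split.
  + by move=> t _; case: (dF t).
  + exact/cvg_at_right_filter/cF.
  + exact/cvg_at_left_filter/cF.
- by move=> t _; rewrite derive1E; case: (dF t).
Qed.

Lemma Rint_setT (B : R) (f : R -> R) : continuous f -> (forall t, B < `|t| -> f t = 0) ->
  Rintegral mu setT f = lint (- B) B f.
Proof.
move=> cf h; rewrite /lint [RHS]Rintegral_mkcond; congr Rintegral.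
apply: funext => t; rewrite patchE; case: ifPn => //.
rewrite notin_setE /= in_itv /= -ler_norml => /negP; rewrite -ltNge; exact: h.
Qed.

End Integral1.

(** * The iterated integral as a bounded functional *)

Section IteratedIntegral.
Variable R : realType.
Notation mu := (@lebesgue_measure R).

(* [box m B g]: g depends uniformly continuously on its first m coordinates and
   vanishes as soon as one of them leaves [-B, B] *)
Definition box (m : nat) (B : R) (g : (nat -> R) -> R) :=
  (forall e : R, 0 < e -> exists2 d : R, 0 < d & forall x y,
     (forall i, (i < m)%N -> `|x i - y i| < d) -> `|g x - g y| <= e) /\
  (forall x i, (i < m)%N -> B < `|x i| -> g x = 0).

Lemma box_slice_cont m B g x : box m.+1 B g -> continuous (fun t => g (upd x m t)).
Proof.
move=> [h _]; apply/continuous_epsP => t e e0.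
have [d d0 hd] := h (e / 2) (divr_gt0 e0 (ltr0n _ 2)).
exists d => // s ts; apply: (@le_lt_trans _ _ (e / 2)); last lra.
by apply: hd => i _; rewrite /upd; case: eqP => // _; rewrite subrr normr0.
Qed.

Arguments box_slice_cont {m B g} x _.

Lemma box_slice_vanish m (B : R) g x (t : R) : box m.+1 B g -> B < `|t| -> g (upd x m t) = 0.
Proof. by move=> [_ h] Bt; apply: (h _ m) => //; rewrite /upd eqxx. Qed.

Lemma box_Rint m B g x : box m.+1 B g ->
  Rintegral mu setT (fun t => g (upd x m t)) = lint (- B) B (fun t => g (upd x m t)).
Proof.
move=> h; apply: Rint_setT; first exact: box_slice_cont x h.
by move=> t; exact: box_slice_vanish h.
Qed.

(** The invariant behind the inductions on [iint]: integrating out the last coordinate stays in the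
    class. The modulus of continuity is taken at e / (B + B) because the integration interval has
    length B + B. *)
Lemma box_int m (B : R) g : 0 < B -> box m.+1 B g ->
  box m B (fun x => Rintegral mu setT (fun t => g (upd x m t))).
Proof.
move=> B0 bg; split => [e e0|x i im Bx].
  have [d d0 hd] := bg.1 (e / (B + B)) (divr_gt0 e0 (addr_gt0 B0 B0)).
  exists d => // x y hxy; rewrite !(box_Rint _ bg).
  have cx := box_slice_cont x bg; have cy := box_slice_cont y bg.
  have -> : lint (- B) B (fun t => g (upd x m t)) - lint (- B) B (fun t => g (upd y m t)) =
     lint (- B) B (fun t => -1 * g (upd y m t) + g (upd x m t)).
    by rewrite lint_lin // mulN1r addrC.
  have -> : e = (B - - B) * (e / (B + B)) by rewrite opprK; field; rewrite gt_eqF // addr_gt0.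
  apply: lint_abs; [lra| |].
    exact: rcont_lin.
  move=> t _; rewrite mulN1r addrC; apply: hd => i; rewrite ltnS leq_eqVlt /upd.
  case: eqP => [_ _|_ /= im]; first by rewrite subrr normr0.
  exact: hxy.
rewrite (box_Rint _ bg) (@lint_eq _ _ _ _ (fun=> 0)); first by rewrite lint_cst ?mulr0 //; lra.
move=> t _; apply: (bg.2 _ i); first exact: ltnW.
by rewrite /upd ltn_eqF.
Qed.

Lemma box_lin m (B a : R) g h : box m B g -> box m B h -> box m B (fun x => a * g x + h x).
Proof.
move=> [g1 g2] [h1 h2]; split => [e e0|x i im Bx]; last by rewrite (g2 x i) // (h2 x i) // mulr0 addr0.
have a0 : 0 < `|a| + 1 by rewrite ltr_wpDl.
have [d d0 hd] := g1 (e / 2 / (`|a| + 1)) (divr_gt0 (divr_gt0 e0 (ltr0n _ 2)) a0).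
have [d' d0' hd'] := h1 (e / 2) (divr_gt0 e0 (ltr0n _ 2)).
exists (Num.min d d'); first by rewrite lt_min d0.
move=> x y hxy.
have k1 : `|g x - g y| <= e / 2 / (`|a| + 1).
  by apply: hd => i /hxy; rewrite lt_min => /andP[].
have k2 : `|h x - h y| <= e / 2.
  by apply: hd' => i /hxy; rewrite lt_min => /andP[].
have -> : a * g x + h x - (a * g y + h y) = a * (g x - g y) + (h x - h y) by ring.
apply: le_trans (ler_normD _ _) _; rewrite normrM.
suff : `|a| * `|g x - g y| <= e / 2 by lra.
move: k1; rewrite ler_pdivlMr // => k1; apply: le_trans k1.
by rewrite mulrC ler_wpM2l // lerDl.
Qed.

Lemma iint_lin m (B a : R) g h : 0 < B -> box m B g -> box m B h ->
  iint m (fun x => a * g x + h x) = a * iint m g + iint m h.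
Proof.
move=> B0; elim: m g h => [//|m IH] g h bg bh /=.
rewrite -IH; try exact: box_int.
congr iint; apply: funext => x; rewrite (box_Rint _ (box_lin a bg bh)) (box_Rint _ bg) (box_Rint _ bh).
by rewrite lint_lin //; [exact: box_slice_cont x bg|exact: box_slice_cont x bh].
Qed.

Lemma iint_abs m (B : R) g (M : R) : 0 < B -> box m B g -> (forall x, `|g x| <= M) ->
  `|iint m g| <= (B + B) ^+ m * M.
Proof.
move=> B0; elim: m g M => [|m IH] g M bg hM /=; first by rewrite expr0 mul1r.
rewrite exprSr -mulrA; apply: IH; first exact: box_int.
move=> x; rewrite (box_Rint _ bg) -[X in (B + X) * _](opprK B).
apply: lint_abs; [lra|exact: box_slice_cont x bg|by []].
Qed.

(** If one of the two points lies in the ball, [compact_unif_cont] applies with that point first; if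
    neither does, both values vanish. *)
Lemma box_row n (h : 'rV[R]_n -> R) (B : R) : continuous h ->
  (forall x, B < `|x| -> h x = 0) -> box n B (fun x => h (\row_(i < n) x i)).
Proof.
move=> ch hB; split => [e e0|x i im Bx]; last first.
  apply: hB; apply: lt_le_trans Bx _.
  by have := mx_coord_le (\row_(i < n) x i) 0 (Ordinal im); rewrite mxE.
have [d d0 hd] := compact_unif_cont ch (@compact_cball _ n B) e0.
exists d => // x y hxy.
set X := \row_(i < n) x i; set Y := \row_(i < n) y i.
have XY : `|X - Y| < d by apply: mx_norm_lt => // i j; rewrite !mxE; exact: hxy.
have [hX|hX] := leP `|X| B; first exact: ltW (hd _ _ hX XY).
have [hY|hY] := leP `|Y| B; first by rewrite distrC; apply: ltW (hd _ _ hY _); rewrite distrC.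
by rewrite !hB // subrr normr0 ltW.
Qed.

Lemma intRn_lin n (a : R) (g h : 'rV[R]_n -> R) (B : R) :
  continuous g -> continuous h ->
  (forall x, B < `|x| -> g x = 0) -> (forall x, B < `|x| -> h x = 0) ->
  intRn (fun x => a * g x + h x) = a * intRn g + intRn h.
Proof.
move=> cg ch gB hB; pose B' := Num.max B 1.
have B0 : 0 < B' by rewrite lt_max ltr01 orbT.
apply: (@iint_lin _ B') => //; apply: box_row => // x; rewrite gt_max => /andP[h1 _]; 
  by rewrite ?gB ?hB.
Qed.

Lemma intRn_abs n (g : 'rV[R]_n -> R) (B M : R) : 0 < B ->
  continuous g -> (forall x, B < `|x| -> g x = 0) -> (forall x, `|g x| <= M) ->
  `|intRn g| <= (B + B) ^+ n * M.
Proof. by move=> B0 cg gB hM; apply: iint_abs => //; exact: box_row. Qed.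

(** Shaped like [FT], so that [FT phi w] is convertible to the [Iint] of phi times the
    exponential. *)
Definition Iint n (phi : 'rV[R]_n -> R[i]) : R[i] :=
  cR (intRn (fun x => reC (phi x))) + cI R * cR (intRn (fun x => imC (phi x))).

Lemma reC_Iint n (phi : 'rV[R]_n -> R[i]) : reC (Iint phi) = intRn (fun x => reC (phi x)).
Proof. by rewrite /Iint reC_D reC_M /= mul0r mulr0 subr0 addr0. Qed.
Lemma imC_Iint n (phi : 'rV[R]_n -> R[i]) : imC (Iint phi) = intRn (fun x => imC (phi x)).
Proof. by rewrite /Iint imC_D imC_M /= mul0r mul1r add0r add0r. Qed.

Lemma Iint_cradon n : cradon (@Iint n).
Proof.
split => [a phi psi cp cq|B].
  have /CcP[p1 p2 [B B0 pB]] := cp; have /CcP[q1 q2 [B' B0' qB]] := cq.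
  pose S := Num.max B B'.
  have pS x : S < `|x| -> phi x = 0 by rewrite gt_max => /andP[/pB].
  have qS x : S < `|x| -> psi x = 0 by rewrite gt_max => /andP[_ /qB].
  have k (r1 r2 : R) (f1 f2 f3 : 'rV[R]_n -> R) : continuous f1 -> continuous f2 -> continuous f3 ->
     (forall x, S < `|x| -> [/\ f1 x = 0, f2 x = 0 & f3 x = 0]) ->
     intRn (fun x => r1 * f1 x + (r2 * f2 x + f3 x)) = r1 * intRn f1 + (r2 * intRn f2 + intRn f3).
    move=> c1 c2 c3 hS; rewrite (@intRn_lin _ _ _ _ S) //.
    - rewrite (@intRn_lin _ _ _ _ S) // => x /hS[] //.
    - exact: rcont_lin.
    - by move=> x /hS[].
    - by move=> x /hS[_ -> ->]; rewrite mulr0 addr0.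
  apply: C_ext.
    rewrite reC_Iint reC_D reC_M !reC_Iint imC_Iint -mulNr -addrA -k //; last by move=> x xS; rewrite pS // qS.
    by congr intRn; apply: funext => x; rewrite reC_D reC_M mulNr addrA.
  rewrite imC_Iint imC_D imC_M !imC_Iint reC_Iint -addrA -k //; last by move=> x xS; rewrite pS // qS.
  by congr intRn; apply: funext => x; rewrite imC_D imC_M addrA.
pose B' := Num.max B 1.
have B0 : 0 < B' by rewrite lt_max ltr01 orbT.
exists (2 * (B' + B') ^+ n); first by rewrite mulr_gt0 // exprn_gt0 // addr_gt0.
move=> phi M cp pB pM; rewrite /nC reC_Iint imC_Iint.
have [c1 c2] := Cc_cont cp.
have pB' x : B' < `|x| -> phi x = 0 by rewrite gt_max => /andP[/pB].
have h1 : `|intRn (fun x => reC (phi x))| <= (B' + B') ^+ n * M.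
  apply: intRn_abs => // x; first by move=> /pB' ->.
  by apply: le_trans (pM x); rewrite /nC lerDl.
have h2 : `|intRn (fun x => imC (phi x))| <= (B' + B') ^+ n * M.
  apply: intRn_abs => // x; first by move=> /pB' ->.
  by apply: le_trans (pM x); rewrite /nC lerDr.
by rewrite -mulrA mulrDl mul1r lerD.
Qed.

End IteratedIntegral.

(** * Primitives of compactly supported functions and their difference quotients *)

Section Primitive.
Variable R : realType.

Definition clamp (B s : R) : R := if s < - B then - B else if B < s then B else s.

Lemma clampP (B s : R) : 0 < B ->
  [\/ [/\ s < - B, s < B & clamp B s = - B],
      [/\ B < s, - B < s & clamp B s = B] |
      [/\ - B <= s, s <= B & clamp B s = s]].
Proof.
move=> B0; rewrite /clamp; have [h1|h1] := ltP s (- B); first by constructor 1; split => //; lra.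
have [h2|h2] := ltP B s; first by constructor 2; split => //; lra.
by constructor 3.
Qed.

Lemma clamp_itv (B s : R) : 0 < B -> - B <= clamp B s <= B.
Proof.
by move=> B0; case: (clampP s B0) => -[h h' ->]; apply/andP; split; lra.
Qed.

Lemma clamp_lip (B s t : R) : 0 < B -> `|clamp B s - clamp B t| <= `|s - t|.
Proof.
move=> B0; case: (clampP s B0) => -[h h1 ->]; case: (clampP t B0) => -[h' h1' ->];
  rewrite ?subrr ?normr0 //; rewrite ler_norml; case: (leP 0 (s - t)) => k;
  rewrite ?(ger0_norm k) ?(ltr0_norm k); apply/andP; split; lra.
Qed.

Lemma clamp_id (B s : R) : `|s| <= B -> clamp B s = s.
Proof.
rewrite ler_norml => /andP[h1 h2]; rewrite /clamp.
by case: ltP => [|_]; [lra|]; case: ltP => [|_]; [lra|].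
Qed.

Lemma lint_end (B s t M : R) (f : R -> R) : continuous f -> (forall t, `|f t| <= M) ->
  - B <= s <= B -> - B <= t <= B -> `|lint (- B) s f - lint (- B) t f| <= M * `|s - t|.
Proof.
move=> cf fM; wlog st : s t / t <= s.
  move=> h hs ht; have [st|/ltW st] := leP t s; first exact: h.
  by rewrite distrC (distrC s); apply: h.
move=> hs ht; rewrite (@lint_split _ _ t s) //; last by case/andP: ht.
rewrite addrAC subrr add0r (ger0_norm (_ : 0 <= s - t)) ?subr_ge0 // mulrC.
by apply: lint_abs.
Qed.

(** Clamping makes the primitive constant outside [-B, B]. Where it shortens the interval
    [s, s + h], one endpoint lies outside [-B, B], where f vanishes; hence f s is at most e in size
    and the missing part of h * f s is harmless. *)
Lemma prim_quot (B s h e : R) (f : R -> R) : 0 < B -> 0 < h -> continuous f ->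
  (forall t, B < `|t| -> f t = 0) ->
  (forall t, `|t - s| <= h -> `|f t - f s| <= e) ->
  `|lint (- B) (clamp B (s + h)) f - lint (- B) (clamp B s) f - h * f s| <= h * e.
Proof.
move=> B0 h0 cf fB fe.
set a := clamp B s; set b := clamp B (s + h).
have [ab ba d_id] : [/\ a <= b, b - a <= h & b - a < h -> `|f s| <= e].
  have z : B < `|s| -> `|f s| <= e.
    by move=> /fB ->; have := fe s; rewrite !subrr !normr0; apply; exact: ltW.
  have z' : B < `|s + h| -> `|f s| <= e.
    move=> /fB k; have := fe (s + h); rewrite k sub0r normrN; apply.
    by rewrite addrAC subrr add0r gtr0_norm.
  rewrite /a /b; case: (clampP s B0) => -[k k1 ->]; case: (clampP (s + h) B0) => -[k' k1' ->];
    split; try lra; move=> hlt;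
    first [by exfalso; lra
      |by apply: z; rewrite ltr_normr; apply/orP; left; lra
      |by apply: z; rewrite ltr_normr; apply/orP; right; lra
      |by apply: z'; rewrite ltr_normr; apply/orP; left; lra
      |by apply: z'; rewrite ltr_normr; apply/orP; right; lra].
have [hd|hd] := leP (b - a) 0.
  have -> : b = a by apply/eqP; rewrite eq_le ab andbT; lra.
  rewrite subrr sub0r normrN normrM (gtr0_norm h0); apply: ler_wpM2l; first exact: ltW.
  by apply: d_id; lra.
have sub t : a <= t <= b -> `|t - s| <= h.
  move=> /andP[h1 h2]; rewrite ler_norml; apply/andP; move: hd h1 h2; rewrite /a /b.
  by case: (clampP s B0) => -[k k1 ->]; case: (clampP (s + h) B0) => -[k' k1' ->] *; split; lra.
have aB : - B <= a by case/andP: (clamp_itv s B0).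
rewrite (lint_split aB ab cf) (addrC (lint (- B) a f)) addrK.
have -> : lint a b f - h * f s = lint a b (fun t => 1 * f t + - f s) - (h - (b - a)) * f s.
  by rewrite lint_lin //; [rewrite lint_cst // mul1r; ring|exact: rcont_cst].
apply: le_trans (ler_normB _ _) _.
have k1 : `|lint a b (fun t => 1 * f t + - f s)| <= (b - a) * e.
  apply: lint_abs => //; first by apply: rcont_lin => //; exact: rcont_cst.
  by move=> t /sub /fe; rewrite mul1r.
have k2 : `|(h - (b - a)) * f s| <= (h - (b - a)) * e.
  rewrite normrM ger0_norm; last lra.
  have [->|hh] := eqVneq (h - (b - a)) 0; first by rewrite !mul0r.
  rewrite ler_wpM2l //; first lra.
  by apply: d_id; rewrite lt_def; move: hh; rewrite subr_eq0 => ->.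
apply: le_trans (lerD k1 k2) _; rewrite -mulrDl addrC subrK //.
Qed.

End Primitive.

(** * A continuous bump of integral 1 *)

Section Rho.
Variable R : realType.
Local Notation C := R[i].

(** The kernel 3/4 max(1 - t^2, 0), with the maximum expressed by an absolute value so that
    continuity is immediate; 3/4 normalizes the integral. *)
Definition rho (t : R) : R := 3 / 8 * ((1 - t * t) + `|1 - t * t|).

Lemma rho_cont : continuous rho.
Proof.
apply: rcontM; first exact: rcont_cst.
have c1 : continuous (fun t : R => 1 - t * t).
  move=> t; apply: cvgB; first exact: cvg_cst.
  by apply: cvgM; exact: cvg_id.
by apply: rcontD => //; apply: rcont_comp c1 _; exact: norm_continuous.
Qed.

Lemma rhoE t : `|t| <= 1 -> rho t = 3 / 4 * (1 - t * t).
Proof.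
move=> h; have : 0 <= 1 - t * t.
  by rewrite -expr2 -real_normK ?num_real // subr_ge0 expr_le1.
by move=> k; rewrite /rho ger0_norm //; lra.
Qed.

Lemma rho_out t : 1 < `|t| -> rho t = 0.
Proof.
move=> h; have : 1 - t * t < 0.
  by rewrite -expr2 -real_normK ?num_real // subr_lt0 expr_gt1.
by move=> k; rewrite /rho ltr0_norm //; lra.
Qed.

Lemma rho_abs t : `|rho t| <= 1.
Proof.
have [h|/rho_out ->] := leP `|t| 1; last by rewrite normr0.
rewrite rhoE //; have := sqr_ge0 t; rewrite expr2 => k.
have k' : t * t <= 1.
  by rewrite -expr2 -real_normK ?num_real // expr_le1.
rewrite ger0_norm; lra.
Qed.

Lemma lint_rho (B : R) : 1 <= B -> lint (- B) B rho = 1.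
Proof.
move=> B1.
have -> : lint (- B) B rho = lint (-1) 1 rho.
  rewrite -(@Rint_setT _ B rho rho_cont); last first.
    by move=> t h; apply: rho_out; exact: le_lt_trans B1 h.
  by rewrite (@Rint_setT _ 1 rho rho_cont) // => t; exact: rho_out.
have -> : lint (-1) 1 rho = lint (-1) 1 (fun t => 3 / 4 * (1 - t * t)).
  by apply: lint_eq => t h; rewrite rhoE // ler_norml.
have dF (t : R) : is_derive t (1 : R) (fun t : R => 3 / 4 * t - 1 / 4 * (t * t * t)) (3 / 4 * (1 - t * t)).
  by apply: is_derive_eq; rewrite /= /GRing.scale /=; lra.
have cf : continuous (fun t : R => 3 / 4 * (1 - t * t)).
  apply: rcontM; first exact: rcont_cst.
  move=> t; apply: cvgB; first exact: cvg_cst.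
  by apply: cvgM; exact: cvg_id.
by rewrite (lint_FTC _ cf dF); lra.
Qed.

End Rho.

(** * Translation-invariant functionals kill functions of zero integral along a coordinate *)

Section Haar.
Variable R : realType.
Local Notation C := R[i].

Definition ext n (x : 'rV[R]_n) : nat -> R :=
  fun i => if insub i is Some j then x 0 j else 0.

Lemma ext_ord n (x : 'rV[R]_n) (i : 'I_n) : ext x i = x 0 i.
Proof. by rewrite /ext valK. Qed.

Lemma row_ext n (x : 'rV[R]_n) : \row_(i < n) ext x i = x.
Proof. by apply/rowP => i; rewrite mxE ext_ord. Qed.

Lemma ext_shift n (x : 'rV[R]_n) (m : 'I_n) (h : R) :
  ext (x + h *: delta_mx 0 m) = upd (ext x) m (x 0 m + h).
Proof.
apply: funext => i; rewrite /upd /ext; case: insubP => [j jn ji|].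
  rewrite !mxE eqxx /= -ji; case: eqVneq => [->|jm]; first by rewrite eqxx mulr1.
  by rewrite ifN ?mulr0 ?addr0.
move=> h1; case: eqP => // im; move: h1; by rewrite im ltn_ord.
Qed.

Lemma upd_upd (x : nat -> R) m s t : upd (upd x m s) m t = upd x m t.
Proof. by apply: funext => i; rewrite /upd; case: eqP. Qed.

Lemma upd_id (x : nat -> R) m : upd x m (x m) = x.
Proof. by apply: funext => i; rewrite /upd; case: eqP => // ->. Qed.

Lemma box_ext_cont n m B g : (m <= n)%N -> box m B g ->
  continuous (fun x : 'rV[R]_n => g (ext x)).
Proof.
move=> mn [h _]; apply/continuous_epsP => x e e0.
have [d d0 hd] := h (e / 2) (divr_gt0 e0 (ltr0n _ 2)).
exists d => // y xy; apply: (@le_lt_trans _ _ (e / 2)); last lra.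
apply: hd => i im; have := mx_coord_le (x - y) 0 (Ordinal (leq_trans im mn)).
by rewrite !mxE -!ext_ord /= => h'; exact: le_lt_trans h' xy.
Qed.

Lemma norm_gt_coord n (x : 'rV[R]_n) (B : R) : 0 < B -> B < `|x| ->
  exists i : 'I_n, B < `|x 0 i|.
Proof.
move=> B0 h; apply: contrapT => k; move: h; apply/negP; rewrite -leNgt.
apply: mx_norm_le; first exact: ltW.
move=> i j; rewrite leNgt (ord1 i); apply/negP => h; apply: k; by exists j.
Qed.

Variables (n : nat) (L : ('rV[R]_n -> C) -> C).
Hypothesis rL : cradon L.
Hypothesis tL : forall phi (y : 'rV[R]_n), Cc phi -> L (fun x => phi (x + y)) = L phi.

(** Because the integrals along coordinate m vanish, the primitive [eta] in that coordinate has
    compact support. Then b is a uniform limit of difference quotients of [eta], and each of these,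
    multiplied by w, is killed by the translation-invariant L. The factor w is constant in direction
    m and carries the coordinates beyond m. *)
Lemma Haar_zero (m : 'I_n) (B M : R) (b : (nat -> R) -> R) (w : 'rV[R]_n -> R) :
  0 < B -> box m.+1 B b -> (forall x, `|b x| <= M) ->
  (forall x, lint (- B) B (fun t => b (upd x m t)) = 0) ->
  continuous w -> (forall x, `|w x| <= 1) ->
  (forall (x : 'rV[R]_n) h, w (x + h *: delta_mx 0 m) = w x) ->
  (forall (x : 'rV[R]_n) (i : 'I_n), (m < i)%N -> B < `|x 0 i| -> w x = 0) ->
  L (fun x => cR (b (ext x) * w x)) = 0.
Proof.
move=> B0 bb bM b0 cw w1 wm wB.
pose eta (x : nat -> R) := lint (- B) (clamp B (x m)) (fun t => b (upd x m t)).
have cb (x : nat -> R) := @box_slice_cont R _ _ _ x bb.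
have clB (x : nat -> R) : - B <= clamp B (x m) by case/andP: (clamp_itv (x m) B0).
have beta : box m.+1 B eta.
  split => [e e0|x i im Bx]; last first.
    (* Below -B the primitive is an integral over a point; above B it is the full integral, which is
       0 by [b0]. *)
    rewrite /eta; move: im; rewrite ltnS leq_eqVlt => /orP[/eqP im|im].
      case: (clampP (x m) B0) => -[k k1 ->] //.
        apply/eqP; rewrite -normr_le0; apply: le_trans (lint_abs _ _ (fun t _ => bM _)) _ => //.
        by rewrite subrr mul0r.
      by have : `|x m| <= B; [rewrite ler_norml k k1|rewrite -im leNgt Bx].
    rewrite (@lint_eq _ _ _ _ (fun=> 0)); first by rewrite lint_cst // mulr0.
    move=> t _; apply: (bb.2 _ i); first exact: ltnW.
    by rewrite /upd ltn_eqF.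
  have M0 : 0 <= M by apply: le_trans (bM (fun=> 0)).
  have [d d0 hd] := bb.1 (e / 2 / (B + B)) (divr_gt0 (divr_gt0 e0 (ltr0n _ 2)) (addr_gt0 B0 B0)).
  exists (Num.min d (e / 2 / (M + 1))).
    by rewrite lt_min d0 !divr_gt0 // ltr_wpDl.
  move=> x y hxy.
  have k1 : `|eta x - lint (- B) (clamp B (x m)) (fun t => b (upd y m t))| <= e / 2.
    have -> : eta x - lint (- B) (clamp B (x m)) (fun t => b (upd y m t)) =
       lint (- B) (clamp B (x m)) (fun t => -1 * b (upd y m t) + b (upd x m t)).
      by rewrite lint_lin // mulN1r addrC.
    apply: (@le_trans _ _ ((clamp B (x m) - - B) * (e / 2 / (B + B)))).
      apply: lint_abs => //; first exact: rcont_lin.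
      move=> t _; rewrite mulN1r addrC; apply: hd => i; rewrite ltnS leq_eqVlt /upd.
      case: eqP => [_ _|_ /= im]; first by rewrite subrr normr0.
      by have := hxy i (ltnW im); rewrite lt_min => /andP[].
    apply: (@le_trans _ _ ((B + B) * (e / 2 / (B + B)))); last first.
      have -> // : (B + B) * (e / 2 / (B + B)) = e / 2.
      by field; rewrite gt_eqF // addr_gt0.
    apply: ler_wpM2r; first by rewrite !divr_ge0 ?addr_ge0 ?ltW.
    rewrite opprK lerD2r.
    by case/andP: (clamp_itv (x m) B0).
  have k2 : `|lint (- B) (clamp B (x m)) (fun t => b (upd y m t)) - eta y| <= e / 2.
    apply: le_trans (lint_end (cb y) (fun t => bM _) (clamp_itv _ B0) (clamp_itv _ B0)) _.
    apply: (@le_trans _ _ ((M + 1) * (e / 2 / (M + 1)))).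
      apply: ler_pM => //; first by rewrite lerDl.
      apply: le_trans (clamp_lip _ _ B0) _.
      by have := hxy m (ltnSn m); rewrite lt_min => /andP[_ /ltW].
    have -> // : (M + 1) * (e / 2 / (M + 1)) = e / 2.
    by field; rewrite gt_eqF // ltr_wpDl.
  apply: le_trans (ler_distD (lint (- B) (clamp B (x m)) (fun t => b (upd y m t))) _ _) _; lra.
have CF (g : (nat -> R) -> R) : box m.+1 B g -> Cc (fun x : 'rV[R]_n => cR (g (ext x) * w x)).
  move=> bg; apply/CcP.
  have cg : continuous (fun x : 'rV[R]_n => g (ext x)) by apply: box_ext_cont bg; exact: ltn_ord.
  have [c1 c2] := ccont_cR (rcontM cg cw); split => //.
  exists B => // x /(norm_gt_coord B0)[i Bi].
  have [im|im] := leqP i m; last by rewrite (wB _ i) // mulr0 cR0.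
  by rewrite (bg.2 _ i) ?mul0r ?cR0 // ext_ord.
set F := fun x => cR (b (ext x) * w x).
pose E x := cR (eta (ext x) * w x).
have cF : Cc F by exact: CF.
have cE : Cc E by exact: CF.
have tr (phi : 'rV[R]_n -> C) y : Cc phi -> Cc (fun x => phi (x + y)).
  move=> /CcP[p1 p2 [S S0 pS]]; apply/CcP.
  have ct : continuous (fun x : 'rV[R]_n => x + y).
    by apply/continuous_epsP => x e e0; exists e => // z; rewrite opprD addrACA subrr addr0.
  split; [exact: rcont_comp ct p1|exact: rcont_comp ct p2|].
  exists (S + `|y|); first by rewrite ltr_wpDr.
  move=> x hx; apply: pS; have := ler_normD (x + y) (- y); rewrite addrK normrN; lra.
apply: nC_eq0; have [c c0 hc] := rL.2 (B + 1).
apply/ler_addgt0Pr => e e0; rewrite add0r.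
have [d d0 hd] := bb.1 (e / c) (divr_gt0 e0 c0).
(* h < d makes the modulus of b available; h <= 1 keeps all supports in the ball of radius B + 1 to
   which c belongs. *)
pose h := Num.min (d / 2) 1.
have h0 : 0 < h by rewrite lt_min ltr01 divr_gt0.
have hd' : h < d by rewrite gt_min; apply/orP; left; lra.
have h1 : h <= 1 by rewrite ge_min lexx orbT.
pose v : 'rV[R]_n := h *: delta_mx 0 m.
pose D x := F x - cR h^-1 * (E (x + v) - E x).
have cEv := tr _ v cE.
have -> : L F = L D.
  rewrite (cradonB rL cF); last by apply: CcZ; exact: CcB.
  by rewrite cradonZ //; [rewrite cradonB // tL // subrr mulr0 subr0|exact: CcB].
have -> : e = c * (e / c) by field; rewrite gt_eqF.
apply: hc; first by apply: CcB => //; apply: CcZ; exact: CcB.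
- move=> x hx.
  have vn : `|v| <= 1.
    apply: mx_norm_le => // i j; rewrite !mxE; case: (_ && _); rewrite ?mulr0 ?normr0 //.
    by rewrite mulr1 gtr0_norm.
  have v0 y g : box m.+1 B g -> B < `|y| -> cR (g (ext y) * w y) = 0.
    move=> bg /(norm_gt_coord B0)[i Bi].
    have [im|im] := leqP i m; last by rewrite (wB _ i) // mulr0 cR0.
    by rewrite (bg.2 _ i) ?mul0r ?cR0 // ext_ord.
  have xB : B < `|x| by lra.
  have xvB : B < `|x + v|.
    have := ler_normD (x + v) (- v); rewrite addrK normrN; lra.
  have f0 : F x = 0 by exact: (v0 _ b).
  have e0' : E x = 0 by exact: (v0 _ eta).
  have e1 : E (x + v) = 0 by exact: (v0 _ eta).
  by rewrite /D f0 e0' e1 subrr mulr0 subrr.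
move=> x; rewrite /D /F /E wm ext_shift -/(ext x) -ext_ord.
set X := ext x.
have -> : cR (b X * w x) - cR h^-1 * (cR (eta (upd X m (X m + h)) * w x) - cR (eta X * w x)) =
  cR (h^-1 * w x * - (eta (upd X m (X m + h)) - eta X - h * b X)).
  rewrite -!(cRM, cRN, cRD); congr cR; field; by rewrite gt_eqF.
rewrite nC_cR normrM normrN normrM (gtr0_norm (_ : 0 < h^-1)) ?invr_gt0 //.
have -> : eta (upd X m (X m + h)) = lint (- B) (clamp B (X m + h)) (fun t => b (upd X m t)).
  rewrite /eta; have -> : upd X m (X m + h) m = X m + h by rewrite /upd eqxx.
  by congr lint; apply: funext => t; rewrite upd_upd.
rewrite {1}/eta.
have key : `|lint (- B) (clamp B (X m + h)) (fun t => b (upd X m t)) -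
     lint (- B) (clamp B (X m)) (fun t => b (upd X m t)) - h * b (upd X m (X m))| <= h * (e / c).
  apply: (@prim_quot R B (X m) h (e / c) (fun t => b (upd X m t))) => //.
    by move=> t; exact: box_slice_vanish bb.
  move=> t ht; apply: hd => i _; rewrite /upd; case: eqP => [_|_].
    exact: le_lt_trans hd'.
  by rewrite subrr normr0.
rewrite upd_id in key.
set Y := `|_ - _| in key *.
have hY : h^-1 * Y <= e / c by rewrite mulrC ler_pdivrMr // mulrC.
apply: le_trans hY; rewrite -mulrA ler_pM2l ?invr_gt0 //.
by rewrite -[leRHS]mul1r; apply: ler_wpM2r; [exact: normr_ge0|exact: w1].
Qed.

End Haar.

(** * Uniqueness of Lebesgue measure *)

Section HaarUniqueness.
Variable R : realType.
Local Notation C := R[i].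
Notation mu := (@lebesgue_measure R).

Definition phi0 n (x : 'rV[R]_n) : C := cR (\prod_(i < n) rho (x 0 i)).

Lemma rho_coord_cont n (i : 'I_n) : continuous (fun x : 'rV[R]_n => rho (x 0 i)).
Proof. apply: rcont_comp (@rho_cont R); exact: coord_continuous. Qed.

Lemma phi0_Cc n : Cc (@phi0 n).
Proof.
have c : continuous (fun x : 'rV[R]_n => \prod_(i < n) rho (x 0 i)).
  by apply: rcont_prod => i _; exact: rho_coord_cont.
have [c1 c2] := ccont_cR c; apply/CcP; split => //; exists 1 => // x.
move=> /(norm_gt_coord ltr01)[i hi].
by rewrite /phi0 (bigD1 i) //= rho_out // mul0r cR0.
Qed.

Lemma rho_unif (e : R) : 0 < e -> exists2 d : R, 0 < d &
  forall s t : R, `|s - t| < d -> `|rho s - rho t| <= e.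
Proof.
move=> e0; have [d d0 hd] := compact_unif_cont (@rho_cont R) (@segment_compact R (-1) 1) e0.
exists d => // s t st.
have [h|h] := leP `|s| 1; first by apply: ltW; apply: hd st; rewrite /= in_itv /= -ler_norml.
have [h'|h'] := leP `|t| 1.
  by rewrite distrC; apply: ltW; apply: hd; rewrite ?(distrC t) //= in_itv /= -ler_norml.
by rewrite !rho_out // subrr normr0 ltW.
Qed.

Lemma box_rho m (B M : R) (g : (nat -> R) -> R) : 1 <= B -> box m B g -> (forall x, `|g x| <= M) ->
  box m.+1 B (fun x => rho (x m) * g x).
Proof.
move=> B1 bg gM; split => [e e0|x i]; last first.
  rewrite ltnS leq_eqVlt => /orP[/eqP -> h|im h].
    by rewrite rho_out ?mul0r // (le_lt_trans B1).
  by rewrite (bg.2 _ i) ?mulr0.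
have M0 : 0 <= M by apply: le_trans (gM (fun=> 0)).
have M1 : 0 < M + 1 by rewrite ltr_wpDl.
have [d d0 hd] := bg.1 (e / 2) (divr_gt0 e0 (ltr0n _ 2)).
have [d' d0' hd'] := rho_unif (divr_gt0 (divr_gt0 e0 (ltr0n _ 2)) M1).
exists (Num.min d d'); first by rewrite lt_min d0.
move=> x y hxy.
have k1 : `|g x - g y| <= e / 2.
  by apply: hd => i im; have := hxy i (ltnW im); rewrite lt_min => /andP[].
have k2 : `|rho (x m) - rho (y m)| <= e / 2 / (M + 1).
  by apply: hd'; have := hxy m (ltnSn m); rewrite lt_min => /andP[].
have -> : rho (x m) * g x - rho (y m) * g y = rho (x m) * (g x - g y) + (rho (x m) - rho (y m)) * g y by ring.
apply: le_trans (ler_normD _ _) _; rewrite (normrM (rho (x m))) (normrM (_ - _)).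
have h1 : `|rho (x m)| * `|g x - g y| <= e / 2.
  by apply: le_trans k1; rewrite -[leRHS]mul1r; apply: ler_wpM2r; [exact: normr_ge0|exact: rho_abs].
have h2 : `|rho (x m) - rho (y m)| * `|g y| <= e / 2.
  have -> : e / 2 = e / 2 / (M + 1) * (M + 1) by field; rewrite gt_eqF.
  by apply: ler_pM => //; apply: le_trans (gM y) _; rewrite lerDl.
by apply: le_trans (lerD h1 h2) _; lra.
Qed.

Section Unique.
Variables (n : nat) (L : ('rV[R]_n -> C) -> C).
Hypothesis rL : cradon L.
Hypothesis tL : forall phi (y : 'rV[R]_n), Cc phi -> L (fun x => phi (x + y)) = L phi.

(** Coordinates from m on are filled with bumps: at m = n the function g stands alone, at m = 0 only
    [phi0] is left. One step replaces g by [rho] in its last coordinate times the integral of g over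
    that coordinate; as [rho] has integral 1, the difference has zero integral along it and
    [Haar_zero] applies. *)
Lemma Haar_box (B : R) m (g : (nat -> R) -> R) (M : R) : 1 <= B -> (m <= n)%N -> box m B g ->
  (forall x, `|g x| <= M) ->
  L (fun x => cR (g (ext x) * \prod_(i < n | (m <= i)%N) rho (x 0 i))) = L (@phi0 n) * cR (iint m g).
Proof.
move=> B1; have B0 : 0 < B by apply: lt_le_trans B1.
have cP m' : continuous (fun x : 'rV[R]_n => \prod_(i < n | (m' <= i)%N) rho (x 0 i)).
  by apply: rcont_prod => i _; exact: rho_coord_cont.
have CF m' (h : (nat -> R) -> R) : (m' <= n)%N -> box m' B h ->
    Cc (fun x : 'rV[R]_n => cR (h (ext x) * \prod_(i < n | (m' <= i)%N) rho (x 0 i))).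
  move=> mn bh.
  have [c1 c2] := ccont_cR (rcontM (box_ext_cont mn bh) (cP m')).
  apply/CcP; split => //; exists B => // x /(norm_gt_coord B0)[i Bi].
  have [im|im] := leqP m' i.
    by rewrite (bigD1 i) //= rho_out ?mul0r ?mulr0 // (le_lt_trans B1).
  by rewrite (bh.2 _ i) ?mul0r // ext_ord.
elim: m g M => [|m IH] g M mn bg gM.
  have gc x : g x = g (fun=> 0).
    apply/eqP; rewrite -subr_eq0 -normr_le0; apply/ler_addgt0Pr => e e0; rewrite add0r.
    by have [d _ hd] := bg.1 e e0; exact: hd.
  rewrite mulrC -(cradonZ rL) /=; last exact: phi0_Cc.
  congr L; apply: funext => x; rewrite cRM gc; congr (_ * _).
pose g' x := Rintegral mu setT (fun t => g (upd x m t)).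
have bg' : box m B g' by exact: box_int.
have g'M x : `|g' x| <= (B - - B) * M.
  rewrite /g' (box_Rint _ bg); apply: lint_abs; [lra|exact: (@box_slice_cont _ _ _ _ x bg)|by move=> t _].
have brho := box_rho B1 bg' g'M.
rewrite [iint _ _]/= -/g' -(IH _ _ (ltnW mn) bg' g'M).
apply/eqP; rewrite -subr_eq0 -(cradonB rL); [|exact: CF|exact: CF _ _ (ltnW mn) bg'].
pose b x := -1 * (rho (x m) * g' x) + g x.
pose w (x : 'rV[R]_n) := \prod_(i < n | (m < i)%N) rho (x 0 i).
apply/eqP; rewrite -[RHS](@Haar_zero R n L rL tL (Ordinal mn) B (1 * ((B - - B) * M) + M) b w) //.
- congr L; apply: funext => x; rewrite -cRN -cRD; congr cR.
  rewrite [X in _ - _ * X](bigD1 (Ordinal mn)) //= /b /w -(ext_ord x (Ordinal mn)) /=.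
  have -> : \prod_(i < n | (m <= i)%N && (i != Ordinal mn)) rho (x 0 i) = \prod_(i < n | (m < i)%N) rho (x 0 i).
    by apply: eq_bigl => i; rewrite (ltn_neqAle m) eq_sym andbC.
  by ring.
- exact: box_lin.
- move=> x; rewrite /b mulN1r; apply: le_trans (ler_normD _ _) _; rewrite normrN normrM lerD //.
  by apply: ler_pM => //; exact: rho_abs.
- move=> x; rewrite /b /=.
  have g'u t : g' (upd x m t) = g' x.
    by congr Rintegral; apply: funext => s; rewrite upd_upd.
  have -> : (fun t => -1 * (rho (upd x m t m) * g' (upd x m t)) + g (upd x m t)) =
    (fun t => - g' x * rho t + g (upd x m t)).
    by apply: funext => t; rewrite g'u /upd eqxx; ring.
  rewrite lint_lin; [|exact: rho_cont|exact: (@box_slice_cont _ _ _ _ x bg)].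
  by rewrite lint_rho // mulr1 -(box_Rint _ bg) addrC subrr.
- exact: cP.
- move=> x; rewrite normr_prod; apply: prodr_ile1 => i _; rewrite normr_ge0; exact: rho_abs.
- move=> x h; apply: eq_bigr => i mi; rewrite !mxE eqxx /=.
  have -> : (i == Ordinal mn) = false by apply/eqP => e; move: mi; rewrite e ltnn.
  by rewrite mulr0 addr0.
- move=> x i /= mi h; rewrite /w (bigD1 i) //= rho_out ?mul0r //; exact: le_lt_trans h.
Qed.

Theorem Haar phi : Cc phi -> L phi = L (@phi0 n) * Iint phi.
Proof.
move=> cphi; have /CcP[c1 c2 [B0 B00 hB0]] := cphi.
pose B := Num.max B0 1.
have B1 : 1 <= B by rewrite le_max lexx orbT.
have hB x : B < `|x| -> phi x = 0 by rewrite gt_max => /andP[/hB0].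
have [M M0 hM] := Cc_bounded cphi.
have real (h : 'rV[R]_n -> R) : continuous h -> (forall x, B < `|x| -> h x = 0) ->
    (forall x, `|h x| <= M) -> L (fun x => cR (h x)) = L (@phi0 n) * cR (intRn h).
  move=> ch hh hhM; rewrite -(Haar_box B1 (leqnn n) (box_row ch hh) (fun x => hhM _)).
  congr L; apply: funext => x; rewrite row_ext big_pred0 ?mulr1 // => i.
  by rewrite leqNgt ltn_ord.
have reM x : `|reC (phi x)| <= M by apply: le_trans (hM x); rewrite lerDl.
have imM x : `|imC (phi x)| <= M by apply: le_trans (hM x); rewrite lerDr.
have C1 : Cc (fun x => cR (reC (phi x))).
  have [d1 d2] := ccont_cR c1; apply/CcP; split => //; exists B => [|x /hB -> //].
  exact: lt_le_trans B1.
have C2 : Cc (fun x => cR (imC (phi x))).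
  have [d1 d2] := ccont_cR c2; apply/CcP; split => //; exists B => [|x /hB -> //].
  exact: lt_le_trans B1.
rewrite /Iint mulrDr -real //; last by move=> x /hB ->.
rewrite mulrCA -real //; last by move=> x /hB ->.
rewrite -(cradonZ rL) // -(cradonD rL) //; last exact: CcZ.
by congr L; apply: funext => x; rewrite [LHS]C_split.
Qed.

End Unique.

(** This normalization later makes the Fourier transform of a modulated [phi0] equal to 1 at a
    prescribed point. *)
Lemma Iint_phi0 n : Iint (@phi0 n) = 1.
Proof.
apply: C_ext; rewrite ?reC_Iint ?imC_Iint /=; last first.
  have h : `|intRn (fun _ : 'rV[R]_n => 0 : R)| <= (1 + 1) ^+ n * 0.
    apply: intRn_abs => //; [exact: rcont_cst|by move=> _; rewrite normr0].
  by apply/eqP; rewrite -normr_le0; apply: le_trans h _; rewrite mulr0.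
rewrite /intRn.
have -> : (fun x : nat -> R => \prod_(i < n) rho ((\row_(j < n) x j) 0 i)) =
  (fun x => \prod_(i < n) rho (x i)).
  by apply: funext => x; apply: eq_bigr => i _; rewrite mxE.
elim: n => [|m IH] /=; first by rewrite big_ord0.
rewrite -[RHS]IH; congr iint; apply: funext => x.
have -> : (fun t => \prod_(i < m.+1) rho (upd x m t i)) = (fun t => \prod_(i < m) rho (x i) * rho t + 0).
  apply: funext => t; rewrite big_ord_recr /= addr0 {2}/upd eqxx; congr (_ * _).
  by apply: eq_bigr => i _; rewrite /upd ltn_eqF.
rewrite (@Rint_setT _ 1).
- rewrite lint_lin; [|exact: rho_cont|exact: rcont_cst].
  by rewrite lint_rho // lint_cst ?mulr0 ?mulr1 ?addr0 //; lra.
- by apply: rcont_lin; [exact: rho_cont|exact: rcont_cst].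
- by move=> t /rho_out ->; rewrite mulr0 addr0.
Qed.

End HaarUniqueness.

(** * Convex functions of one variable and their approximation by kinks *)

Section OneDim.
Variable R : realType.

Definition cvx1 (u : R -> R) : Prop := forall s t l : R, 0 <= l <= 1 ->
  u (l * s + (1 - l) * t) <= l * u s + (1 - l) * u t.

Lemma derive_cont (f df : R -> R) :
  (forall s : R, is_derive s (1 : R) f (df s)) -> continuous f.
Proof.
by move=> h s; apply: differentiable_continuous; apply/derivable1_diffP; case: (h s).
Qed.

Lemma MVTle (f df : R -> R) (a b : R) : a <= b ->
  (forall s : R, is_derive s (1 : R) f (df s)) ->
  exists2 c, a <= c <= b & f b - f a = df c * (b - a).
Proof.
move=> ab h; have [-> |ne] := eqVneq a b.
  by exists b; rewrite ?lexx // !subrr mulr0.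
have lab : a < b by rewrite lt_neqAle ne.
have [c] := @MVT R f df a b lab (fun s _ => h s) (continuous_subspaceT (derive_cont h)).
by rewrite in_itv /= => /andP[/ltW h1 /ltW h2] e; exists c; rewrite ?h1.
Qed.

Lemma cvx1_d2 (u du psi : R -> R) : (forall s : R, is_derive s (1 : R) u (du s)) ->
  (forall s : R, is_derive s (1 : R) du (psi s)) -> (forall s, 0 <= psi s) -> cvx1 u.
Proof.
move=> h1 h2 p0.
have mono s t : s <= t -> du s <= du t.
  move=> st; have [c _ e] := MVTle st h2; rewrite -subr_ge0 e.
  by rewrite mulr_ge0 // subr_ge0.
move=> s t l; wlog st : s t l / s <= t.
  move=> H /andP[l0 l1]; have [st|/ltW ts] := leP s t; first by apply: H => //; rewrite l0.
  have hl : 0 <= 1 - l <= 1 by rewrite subr_ge0 l1 gerBl.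
  have -> : l * s + (1 - l) * t = (1 - l) * t + (1 - (1 - l)) * s by ring.
  have := H t s (1 - l) ts hl; lra.
move=> /andP[l0 l1]; set p := l * s + (1 - l) * t.
have sp : s <= p by rewrite /p; nra.
have pt : p <= t by rewrite /p; nra.
have [c1 /andP[_ hc1] e1] := MVTle sp h1; have [c2 /andP[hc2 _] e2] := MVTle pt h1.
have m := mono c1 c2 (le_trans hc1 hc2).
have d1 : p - s = (1 - l) * (t - s) by rewrite /p; ring.
have d2 : t - p = l * (t - s) by rewrite /p; ring.
have : l * (u p - u s) <= (1 - l) * (u t - u p).
  rewrite e1 e2 d1 d2.
  have -> : l * (du c1 * ((1 - l) * (t - s))) = l * (1 - l) * (t - s) * du c1 by ring.
  have -> : (1 - l) * (du c2 * (l * (t - s))) = l * (1 - l) * (t - s) * du c2 by ring.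
  by apply: ler_wpM2l => //; rewrite !mulr_ge0 // subr_ge0.
lra.
Qed.

Definition kap (c s : R) : R := Num.max (s - c) 0.

Lemma kap_conv c : cvx1 (kap c).
Proof.
move=> s t l /andP[l0 l1]; rewrite /kap ge_max; apply/andP.
have k (x : R) : x <= Num.max x 0 /\ 0 <= Num.max x 0 by rewrite !le_max !lexx orbT.
have [a1 a2] := k (s - c); have [b1 b2] := k (t - c).
set A := Num.max (s - c) 0 in a1 a2 *; set B := Num.max (t - c) 0 in b1 b2 *.
have l1' : 0 <= 1 - l by lra.
have h1 := ler_wpM2l l0 a1; have h2 := ler_wpM2l l1' b1.
have h3 := mulr_ge0 l0 a2; have h4 := mulr_ge0 l1' b2.
by split; lra.
Qed.

Lemma cvx1_lin (a : R) u v : 0 <= a -> cvx1 u -> cvx1 v -> cvx1 (fun s => a * u s + v s).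
Proof.
move=> a0 cu cv s t l hl; have := cv s t l hl; have := ler_wpM2l a0 (cu s t l hl); lra.
Qed.
Lemma cvx1_cst (a : R) : cvx1 (fun=> a).
Proof. by move=> s t l _; lra. Qed.
Lemma cvx1_sum (m : nat) (w c : nat -> R) : (forall i, 0 <= w i) ->
  cvx1 (fun s => \sum_(i < m) w i * kap (c i) s).
Proof.
move=> w0; elim: m => [|m IH].
  have -> : (fun s => \sum_(i < 0) w i * kap (c i) s) = fun=> 0.
    by apply: funext => s; rewrite big_ord0.
  exact: cvx1_cst.
have -> : (fun s => \sum_(i < m.+1) w i * kap (c i) s) =
  (fun s => w m * kap (c m) s + \sum_(i < m) w i * kap (c i) s).
  by apply: funext => s; rewrite big_ord_recr /= addrC.
by apply: cvx1_lin => //; exact: kap_conv.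
Qed.

Lemma cvx1_lim (U : nat -> R -> R) u : (forall j, cvx1 (U j)) ->
  (forall s (e : R), 0 < e -> exists N, forall j, (N <= j)%N -> `|U j s - u s| <= e) -> cvx1 u.
Proof.
move=> cU h s t l hl; apply/ler_addgt0Pr => e e0.
have e3 : 0 < e / 4 by rewrite divr_gt0.
have [N1 h1] := h s _ e3; have [N2 h2] := h t _ e3.
have [N3 h3] := h (l * s + (1 - l) * t) _ e3.
pose j := maxn N1 (maxn N2 N3).
have := h1 j (leq_maxl _ _); have := h2 j; have := h3 j.
rewrite /j !leq_max !leqnn !orbT => /(_ isT) k3 /(_ isT) k2 k1.
have := cU j s t l hl; case/andP: hl => l0 l1.
move: k1 k2 k3; rewrite !ler_norml => /andP[a1 a2] /andP[b1 b2] /andP[c1 c2] cv.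
have l1' : 0 <= 1 - l by lra.
have m1 := ler_wpM2l l0 a2; have m2 := ler_wpM2l l1' b2.
lra.
Qed.

Definition kprim (u du : R -> R) (t x : R) : R := du x * (t - x) + u x.

(* [kprim u du t] is a primitive of c |-> psi c (t - c), so each cell of the
   Riemann sum is controlled by the mean value theorem *)
Lemma kink_cell (u du psi : R -> R) (m La S t h c : R) :
  (forall s : R, is_derive s (1 : R) u (du s)) ->
  (forall s : R, is_derive s (1 : R) du (psi s)) -> (forall s, 0 <= psi s <= m) ->
  (forall s s', `|psi s - psi s'| <= La * `|s - s'|) -> 0 <= La ->
  0 <= t <= S -> 0 <= c -> 0 < h ->
  `|kprim u du t (Num.min (c + h) t) - kprim u du t (Num.min c t) - h * psi c * kap c t| <=
    h * (La * S + m) * (Num.min (c + h) t - Num.min c t).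
Proof.
move=> h1 h2 pm lip La0 /andP[t0 tS] c0 h0.
pose W := kprim u du t; rewrite -/W.
have S0 := le_trans t0 tS.
have m0 : 0 <= m by case/andP: (pm 0) => a b; exact: le_trans a b.
have dW (x : R) : is_derive x (1 : R) W (psi x * (t - x)).
  have i1 := h1 x; have i2 := h2 x.
  have -> : W = (du \* (fun x => t - x)) \+ u by [].
  by apply: is_derive_eq; rewrite /= /GRing.scale /=; ring.
have [tc|ct] := leP t c.
  rewrite !min_r //; last by apply: le_trans tc _; rewrite lerDl ltW.
  by rewrite !subrr mulr0 /kap max_r ?subr_le0 // mulr0 subr0 normr0.
have -> : kap c t = t - c by rewrite /kap max_l // subr_ge0 ltW.
have /andP[pc0 pcm] := pm c.
have [cht|tch] := leP (c + h) t.
  have chh : c <= c + h by rewrite lerDl ltW.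
  have [xi /andP[x1 x2] e] := MVTle chh dW.
  rewrite e (addrC c) addrK.
  have -> : psi xi * (t - xi) * h - h * psi c * (t - c) =
    h * ((psi xi - psi c) * (t - xi) - psi c * (xi - c)) by ring.
  rewrite normrM (gtr0_norm h0) -mulrA; apply: ler_wpM2l; first exact: ltW.
  have k1 : `|psi xi - psi c| <= La * h.
    apply: le_trans (lip _ _) _; apply: ler_wpM2l => //.
    by rewrite ger0_norm; lra.
  apply: le_trans (ler_normB _ _) _; rewrite !normrM mulrDl.
  apply: lerD.
    rewrite -mulrA (mulrC S) mulrA; apply: ler_pM => //.
    by rewrite ger0_norm; lra.
  by apply: ler_pM => //; rewrite ger0_norm //; lra.
have [xi /andP[x1 x2] e] := MVTle (ltW ct) dW; rewrite e.
have /andP[px0 pxm] := pm xi.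
have k0 : 0 <= t - c by lra.
have -> : psi xi * (t - xi) * (t - c) - h * psi c * (t - c) = (t - c) * (psi xi * (t - xi) - h * psi c) by ring.
rewrite normrM (ger0_norm k0) mulrC; apply: ler_wpM2r => //.
have A1 : 0 <= psi xi * (t - xi) by apply: mulr_ge0 => //; lra.
have A2 : psi xi * (t - xi) <= m * h by apply: ler_pM => //; lra.
have A3 : 0 <= h * psi c by apply: mulr_ge0 => //; exact: ltW.
have A4 : h * psi c <= h * m by apply: ler_wpM2l => //; exact: ltW.
have A5 : 0 <= h * (La * S) by rewrite !mulr_ge0 // ltW.
by rewrite ler_norml; apply/andP; split; lra.
Qed.

(** A Riemann sum for the integral form of the Taylor remainder, the integral of psi c (t - c) over
    [0, t]. The proof telescopes over cells cut off at t, so that nodes beyond t contribute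
    nothing. *)
Lemma kink_sum (u du psi : R -> R) (m La S t h : R) (K : nat) :
  (forall s : R, is_derive s (1 : R) u (du s)) ->
  (forall s : R, is_derive s (1 : R) du (psi s)) -> (forall s, 0 <= psi s <= m) ->
  (forall s s', `|psi s - psi s'| <= La * `|s - s'|) -> 0 <= La ->
  0 <= t <= S -> 0 < h -> t <= K%:R * h ->
  `|\sum_(i < K) h * psi (i%:R * h) * kap (i%:R * h) t - (u t - u 0 - du 0 * t)| <=
    h * (La * S + m) * S.
Proof.
move=> h1 h2 pm lip La0 /andP[t0 tS] h0 tK.
pose W := kprim u du t.
have m0 : 0 <= m by case/andP: (pm 0) => a b; exact: le_trans a b.
have main j : `|W (Num.min (j%:R * h) t) - W 0 - \sum_(i < j) h * psi (i%:R * h) * kap (i%:R * h) t| <=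
    h * (La * S + m) * Num.min (j%:R * h) t.
  elim: j => [|j IH].
    by rewrite mul0r min_l // big_ord0 !subrr normr0 mulr0.
  have jh0 : 0 <= j%:R * h by rewrite mulr_ge0 ?ler0n // ltW.
  have := @kink_cell u du psi m La S t h (j%:R * h) h1 h2 pm lip La0 _ jh0 h0.
  rewrite t0 tS => /(_ isT) /= cell.
  have -> : j.+1%:R * h = j%:R * h + h by rewrite -addn1 natrD mulrDl mul1r.
  rewrite big_ord_recr /=.
  set X := \sum_(i < j) _ in IH *; set Y := h * _ * kap _ _ in cell *.
  rewrite -/W in cell.
  have -> : W (Num.min (j%:R * h + h) t) - W 0 - (X + Y) =
    (W (Num.min (j%:R * h) t) - W 0 - X) + (W (Num.min (j%:R * h + h) t) - W (Num.min (j%:R * h) t) - Y) by ring.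
  apply: le_trans (ler_normD _ _) _; apply: le_trans (lerD IH cell) _.
  by rewrite -mulrDr (addrC (Num.min (j%:R * h) t)) subrK.
have := main K; rewrite (min_r tK) => k.
have -> : u t - u 0 - du 0 * t = W t - W 0 by rewrite /W /kprim subrr mulr0 add0r subr0; ring.
rewrite distrC; apply: le_trans k _; apply: ler_wpM2l => //.
apply: mulr_ge0; first exact: ltW.
by rewrite addr_ge0 // mulr_ge0 //; exact: le_trans tS.
Qed.

(** Mesh 1/(N+1) with (N+1)^2 nodes in [kapprox]: the grid refines and extends to the right at the
    same time, so one index controls both limits. *)
Definition kgrid (L : R) (N i : nat) : R := - L + i%:R * N.+1%:R^-1.
Definition kapprox (L : R) (psi : R -> R) (N : nat) (s : R) : R :=
  \sum_(i < (N.+1 * N.+1)%N) (N.+1%:R^-1 * psi (kgrid L N i)) * kap (kgrid L N i) s.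
(** This is u minus its tangent at -L, continued by 0 to the left of -L, where no kink of the grid
    has started. *)
Definition klim (L : R) (u du : R -> R) (s : R) : R :=
  let s' := Num.max s (- L) in u s' - u (- L) - du (- L) * (s' + L).

Lemma kapprox_cvg (L : R) (u du psi : R -> R) (m La : R) :
  (forall s : R, is_derive s (1 : R) u (du s)) ->
  (forall s : R, is_derive s (1 : R) du (psi s)) -> (forall s, 0 <= psi s <= m) ->
  (forall s s', `|psi s - psi s'| <= La * `|s - s'|) -> 0 <= La ->
  forall S e : R, 0 < e -> exists N0, forall N, (N0 <= N)%N -> forall s, `|s| <= S ->
    `|kapprox L psi N s - klim L u du s| < e.
Proof.
move=> h1 h2 pm lip La0 S e e0.
have m0 : 0 <= m by case/andP: (pm 0) => a b; exact: le_trans a b.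
pose T := `|S| + `|L| + 1.
have T0 : 0 < T by rewrite ltr_wpDl // addr_ge0.
have D0 : 0 <= (La * T + m) * T by apply: mulr_ge0; [apply: addr_ge0 => //; apply: mulr_ge0 => //|]; exact: ltW.
(* The first entry makes the error h (La T + m) T smaller than e, the second makes the grid reach
   T. *)
pose N0 := maxn (Num.truncn ((La * T + m) * T / e)).+1 (Num.truncn T).+1.
exists N0 => N; rewrite geq_max => /andP[n1 n2] s sS.
have gt1 (x : R) : ((Num.truncn x).+1 <= N)%N -> x < N.+1%:R.
  move=> hx; apply: lt_le_trans (truncnS_gt x) _; rewrite ler_nat; exact: leq_trans hx (leqnSn N).
have N1 := gt1 _ n1; have N2 := gt1 _ n2.
set h := N.+1%:R^-1 : R.
have h0 : 0 < h by rewrite invr_gt0 ltr0n.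
pose t := Num.max s (- L) + L.
have t0 : 0 <= t by rewrite /t -lerBlDr sub0r le_max lexx orbT.
have tT : t <= T.
  rewrite /t /T; have := ler_norm s; have := ler_norm S; have := ler_norm L.
  have : Num.max s (- L) <= `|S| + `|L|.
    rewrite ge_max; apply/andP; split; first by have := ler_norm s; have := normr_ge0 L; have := ler_norm S; lra.
    have := ler_norm (- L); rewrite normrN; have := normr_ge0 S; lra.
  have [sL|sL] := leP s (- L); rewrite ?(max_r sL) ?(max_l (ltW sL)); have := normr_ge0 S; have := normr_ge0 L; lra.
have kE i : kap (kgrid L N i) s = kap (i%:R * h) t.
  have ih0 : 0 <= i%:R * h by rewrite mulr_ge0 ?ler0n // ltW.
  rewrite /kap /t /kgrid -/h; have [sL|sL] := leP s (- L).
    by rewrite !max_r //; lra.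
  by congr (Num.max _ 0); lra.
have sh (f df : R -> R) : (forall s : R, is_derive s (1 : R) f (df s)) ->
    forall s : R, is_derive s (1 : R) (fun x => f (x - L)) (df (s - L)).
  move=> hf x; have i1 := hf (x - L).
  have i2 : is_derive x (1 : R) (fun y : R => y - L) 1.
    by apply: is_derive_eq; rewrite subr0.
  have := @is_derive1_comp R f (fun y => y - L) x _ _ i1 i2; rewrite mulr1; exact.
have lip' x y : `|psi (x - L) - psi (y - L)| <= La * `|x - y|.
  by have -> : x - y = (x - L) - (y - L) by ring; exact: lip.
have t0T : 0 <= t <= T by rewrite t0.
have tK : t <= (N.+1 * N.+1)%:R * h.
  have -> : (N.+1 * N.+1)%:R * h = N.+1%:R by rewrite natrM -mulrA mulfV ?mulr1 // pnatr_eq0.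
  by apply: le_trans tT _; exact: ltW.
have K := @kink_sum (fun x => u (x - L)) (fun x => du (x - L)) (fun x => psi (x - L)) m La T t h (N.+1 * N.+1)
  (sh _ _ h1) (sh _ _ h2) (fun s => pm _) lip' La0 t0T h0 tK.
have -> : kapprox L psi N s = \sum_(i < N.+1 * N.+1) h * psi (i%:R * h - L) * kap (i%:R * h) t.
  by apply: eq_bigr => i _; rewrite kE /kgrid addrC.
have -> : klim L u du s = u (t - L) - u (0 - L) - du (0 - L) * t.
  by rewrite /klim add0r /t addrK.
apply: le_lt_trans K _.
by move: N1; rewrite ltr_pdivrMr // -mulrA [h * _]mulrC ltr_pdivrMr ?ltr0n // (mulrC e).
Qed.

End OneDim.

(** * Ridge functions *)

Section ConvexFunctions.
Variables (R : realType) (n : nat).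
Implicit Types (f g : 'rV[R]_n -> R) (a x y : 'rV[R]_n).

Lemma dotRD a x y : dotR a (x + y) = dotR a x + dotR a y.
Proof. by rewrite /dotR -big_split; apply: eq_bigr => i _; rewrite !mxE mulrDr. Qed.
Lemma dotRZ a (t : R) x : dotR a (t *: x) = t * dotR a x.
Proof. by rewrite /dotR big_distrr; apply: eq_bigr => i _; rewrite /= !mxE; ring. Qed.
Lemma dotRDl a b x : dotR (a + b) x = dotR a x + dotR b x.
Proof. by rewrite /dotR -big_split; apply: eq_bigr => i _; rewrite !mxE mulrDl. Qed.
Lemma dotRZl (t : R) a x : dotR (t *: a) x = t * dotR a x.
Proof. by rewrite /dotR big_distrr; apply: eq_bigr => i _; rewrite /= !mxE; ring. Qed.

Definition asum a : R := \sum_(i < n) `|a 0 i|.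
Lemma asum_ge0 a : 0 <= asum a. Proof. by apply: sumr_ge0. Qed.
Lemma dotR_le a x : `|dotR a x| <= asum a * `|x|.
Proof.
rewrite /dotR /asum big_distrl; apply: le_trans (ler_norm_sum _ _ _) _.
by apply: ler_sum => i _; rewrite normrM; apply: ler_wpM2l => //; exact: mx_coord_le.
Qed.

Lemma dotR_cont a : continuous (dotR a).
Proof.
apply: rcont_sum => i _; apply: rcontM; first exact: rcont_cst.
exact: coord_continuous.
Qed.

Lemma convexD f g : convexR f -> convexR g -> convexR (fun x => f x + g x).
Proof. by move=> cf cg x y t ht; have := cf x y t ht; have := cg x y t ht; lra. Qed.
Lemma convex_ridge a (u : R -> R) : cvx1 u -> convexR (fun x => u (dotR a x)).
Proof. by move=> cu x y t ht; rewrite dotRD !dotRZ; exact: cu. Qed.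
Lemma convex_add_ridge a (u : R -> R) f : convexR f -> cvx1 u ->
  convexR (fun x => f x + u (dotR a x)).
Proof. by move=> cf cu; apply: convexD => //; exact: convex_ridge. Qed.
Lemma cvx1_affine (p q : R) : cvx1 (fun s => p * s + q).
Proof. by move=> s t l _; lra. Qed.

End ConvexFunctions.

(** * The axioms in usable form, and the splitting off of a kink *)

Section RankOne.
Variables (R : realType) (n k : nat).
Local Notation C := R[i].
Variable Psi : ('rV[R]_n -> R) -> ('rV[R]_n -> C) -> C.
Hypothesis MA : MAVal k Psi.
Implicit Types (f g : 'rV[R]_n -> R) (phi : 'rV[R]_n -> C) (a x y : 'rV[R]_n).

Lemma Psi_radon f : convexR f -> cradon (Psi f).
Proof. by move=> cf; case: MA => h _; apply: radon_cradon; exact: h. Qed.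

Lemma Psi_cont (F : nat -> 'rV[R]_n -> R) f phi : (forall j, convexR (F j)) -> convexR f ->
  (forall S e : R, 0 < e -> exists N, forall j, (N <= j)%N ->
     forall x, `|x| <= S -> `|F j x - f x| < e) ->
  Cc phi -> clim (fun j => Psi (F j) phi) (Psi f phi).
Proof.
move=> cF cf h cphi; case: MA => _ [_ [hc _]]; apply: cvgC_clim; apply: hc => //.
move=> K cK e e0; have [B _ hB] := compact_sub_cball cK.
have [N hN] := h B e e0; exists N => // j /hN hj x /hB; exact: hj.
Qed.

Lemma Psi_aff f y (c : R) phi : convexR f -> Cc phi ->
  Psi (fun x => f x + dotR y x + c) phi = Psi f phi.
Proof. by move=> cf cphi; case: MA => _ [_ [_ [h _]]]; exact: h. Qed.

Lemma Psi_loc f g (U : set 'rV[R]_n) phi : convexR f -> convexR g -> open U ->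
  (forall x, U x -> f x = g x) -> Cc phi -> supp phi `<=` U -> Psi f phi = Psi g phi.
Proof. by move=> cf cg oU e cphi s; case: MA => _ [_ [_ [_ [h _]]]]; exact: h s. Qed.

(** The margin d absorbs the closure in [supp]: the support lies in a closed half-space strictly
    inside the open one where f and g agree. *)
Lemma Psi_loc_gt f g a (c d : R) phi : convexR f -> convexR g -> 0 < d ->
  (forall x, c < dotR a x -> f x = g x) -> Cc phi ->
  (forall x, phi x != 0 -> c + d <= dotR a x) -> Psi f phi = Psi g phi.
Proof.
move=> cf cg d0 e cphi h; apply: (@Psi_loc _ _ [set x | c < dotR a x]) => //.
  have -> : [set x | c < dotR a x] = dotR a @^-1` [set y | c < y] by [].
  apply: open_comp; last exact: open_gt.
  by move=> x _; exact: dotR_cont.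
apply: (@subset_trans _ [set x | c + d <= dotR a x]).
  apply: supp_sub => //.
  have -> : [set x | c + d <= dotR a x] = dotR a @^-1` [set y | c + d <= y] by [].
  apply: closed_comp; last exact: closed_ge.
  by move=> x _; exact: dotR_cont.
by move=> x /= hx; lra.
Qed.

Lemma Psi_loc_ball f g (B : R) phi : convexR f -> convexR g ->
  (forall x, `|x| < B + 1 -> f x = g x) -> Cc phi ->
  (forall x, B < `|x| -> phi x = 0) -> Psi f phi = Psi g phi.
Proof.
move=> cf cg e cphi h; apply: (@Psi_loc _ _ [set x | `|x| < B + 1]) => //.
  have -> : [set x : 'rV[R]_n | `|x| < B + 1] = Num.norm @^-1` [set y | y < B + 1] by [].
  apply: open_comp; last exact: open_lt.
  by move=> x _; exact: norm_continuous.
apply: (@subset_trans _ (cball B)).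
  apply: supp_sub; first exact: (compact_closed (@norm_hausdorff _ _) (@compact_cball _ n B)).
  by move=> x; apply: contra_neqP => /negP; rewrite /cball /= -ltNge; exact: h.
by move=> x; rewrite /cball /= => hx; lra.
Qed.

Lemma Psi_tr f y phi : convexR f -> Cc phi ->
  Psi (fun x => f (x - y)) phi = Psi f (fun x => phi (x + y)).
Proof. by move=> cf cphi; case: MA => _ [_ [_ [_ [_ [h _]]]]]; exact: h. Qed.

Lemma Psi_hom f (t : R) phi : convexR f -> 0 < t -> Cc phi ->
  Psi (fun x => t * f x) phi = cR (t ^+ k) * Psi f phi.
Proof. by move=> cf t0 cphi; case: MA => _ [_ [_ [_ [_ [_ h]]]]]; exact: h. Qed.

Lemma Psi_ridge_cont (U : nat -> R -> R) (u : R -> R) f a phi : convexR f ->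
  (forall j, cvx1 (U j)) -> cvx1 u ->
  (forall S e : R, 0 < e -> exists N, forall j, (N <= j)%N ->
     forall s, `|s| <= S -> `|U j s - u s| < e) ->
  Cc phi -> clim (fun j => Psi (fun x => f x + U j (dotR a x)) phi) (Psi (fun x => f x + u (dotR a x)) phi).
Proof.
move=> cf cU cu h cphi; apply: Psi_cont => //.
- by move=> j; exact: convex_add_ridge.
- exact: convex_add_ridge.
move=> S e e0; have [N hN] := h (asum a * `|S|) e e0; exists N => j /hN hj x xS.
rewrite opprD addrACA subrr add0r; apply: hj; apply: le_trans (dotR_le _ _) _.
by apply: ler_wpM2l; [exact: asum_ge0|apply: le_trans xS (ler_norm _)].
Qed.

Section Fixed.
Variables (f : 'rV[R]_n -> R) (a : 'rV[R]_n).
Hypothesis cf : convexR f.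

(* the valuation property for max(v, l + w kap_c) = v + w kap_c and min(v, l + w kap_c) = l,
   where l is an affine minorant of v which agrees with v right of c *)
Lemma kink_add (v : R -> R) (p q c w : R) phi : cvx1 v -> 0 <= w ->
  (forall s, p * s + q <= v s) -> (forall s, c <= s -> v s = p * s + q) -> Cc phi ->
  Psi (fun x => f x + (v (dotR a x) + w * kap c (dotR a x))) phi + Psi f phi =
  Psi (fun x => f x + v (dotR a x)) phi + Psi (fun x => f x + w * kap c (dotR a x)) phi.
Proof.
move=> cv w0 h1 h2 cphi; case: MA => _ [hv _].
have cw : cvx1 (fun s => w * kap c s).
  by move=> s t l hl; have := ler_wpM2l w0 (@kap_conv R c s t l hl); lra.
have cF := convex_add_ridge a cf cv.
have cl := convex_add_ridge a cf (cvx1_affine p q).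
have clw : cvx1 (fun s => 1 * (p * s + q) + w * kap c s).
  by apply: cvx1_lin => //; exact: cvx1_affine.
have cG := convex_add_ridge a cf clw.
have key s : Num.max (v s) (1 * (p * s + q) + w * kap c s) = v s + w * kap c s /\
             Num.min (v s) (1 * (p * s + q) + w * kap c s) = p * s + q.
  rewrite mul1r /kap; have [cs|sc] := leP c s.
    have sc0 : 0 <= s - c by rewrite subr_ge0.
    have k0 := mulr_ge0 w0 sc0.
    rewrite (h2 s cs) (max_l sc0).
    by split; [apply: max_r|apply: min_l]; rewrite lerDl.
  rewrite (@max_r _ _ (s - c)) ?subr_le0 ?ltW // mulr0 !addr0.
  by rewrite max_l ?min_r.
have minE x : Num.min (f x + v (dotR a x)) (f x + (1 * (p * dotR a x + q) + w * kap c (dotR a x))) =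
    f x + (p * dotR a x + q).
  by rewrite -addr_minr (key _).2.
have maxE x : Num.max (f x + v (dotR a x)) (f x + (1 * (p * dotR a x + q) + w * kap c (dotR a x))) =
    f x + (v (dotR a x) + w * kap c (dotR a x)).
  by rewrite -addr_maxr (key _).1.
have affE g : convexR g -> Psi (fun x => g x + dotR (p *: a) x + q) phi = Psi g phi.
  by move=> cg; exact: Psi_aff.
have := hv _ _ cF cG; rewrite (funext minE) (funext maxE) => /(_ cl phi cphi).
have -> : Psi (fun x => f x + (p * dotR a x + q)) phi = Psi f phi.
  by rewrite -[RHS]affE //; congr Psi; apply: funext => x; rewrite dotRZl; ring.
have -> : Psi (fun x => f x + (1 * (p * dotR a x + q) + w * kap c (dotR a x))) phi =
    Psi (fun x => f x + w * kap c (dotR a x)) phi.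
  rewrite -[RHS]affE; last exact: (convex_add_ridge a cf cw).
  by congr Psi; apply: funext => x; rewrite dotRZl; ring.
by [].
Qed.

End Fixed.
End RankOne.

(** * The increment caused by a single kink *)

Section Kinks.
Variables (R : realType) (n k : nat).
Local Notation C := R[i].
Variable Psi : ('rV[R]_n -> R) -> ('rV[R]_n -> C) -> C.
Hypothesis MA : MAVal k Psi.
Implicit Types (phi : 'rV[R]_n -> C).
Variables (f : 'rV[R]_n -> R) (a : 'rV[R]_n).
Hypothesis cf : convexR f.

(** In phi this will turn out to be a measure carried by the hyperplane <a, x> = c, and in w >= 0 a
    linear function. *)
Definition bet (c w : R) phi : C :=
  Psi (fun x => f x + w * kap c (dotR a x)) phi - Psi f phi.

Lemma cont_ridge (r : R -> R) : continuous r -> continuous (fun x => r (dotR a x)).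
Proof.
by move=> cr x; apply: (@continuous_comp _ _ _ (dotR a) r); [exact: dotR_cont|exact: cr].
Qed.

Lemma cvx1_kapZ (c w : R) : 0 <= w -> cvx1 (fun s => w * kap c s).
Proof. by move=> w0 s t l hl; have := ler_wpM2l w0 (@kap_conv R c s t l hl); lra. Qed.

Lemma kap_ge (c s : R) : s - c <= kap c s. Proof. by rewrite /kap le_max lexx. Qed.
Lemma kap_right (c s : R) : c <= s -> kap c s = s - c.
Proof. by move=> h; rewrite /kap max_l // subr_ge0. Qed.
Lemma kap_abs (c s : R) : `|kap c s| <= `|s| + `|c|.
Proof.
rewrite /kap; have [h|h] := leP (s - c) 0; last exact: ler_normB.
by rewrite normr0 addr_ge0.
Qed.

Lemma bet_add (c w w' : R) phi : 0 <= w -> 0 <= w' -> Cc phi ->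
  bet c (w + w') phi = bet c w phi + bet c w' phi.
Proof.
move=> w0 w0' cphi.
have := @kink_add R n k Psi MA f a cf (fun s => w * kap c s) w (- (w * c)) c w' phi (cvx1_kapZ c w0) w0'.
move=> /(_ _ _ cphi).
have -> : (fun x => f x + (w * kap c (dotR a x) + w' * kap c (dotR a x))) =
          (fun x => f x + (w + w') * kap c (dotR a x)).
  by apply: funext => x; rewrite mulrDl.
rewrite /bet => h; rewrite -[X in X - _](addrK (Psi f phi)) h; first by ring.
- by move=> s; have := ler_wpM2l w0 (kap_ge c s); lra.
- by move=> s /kap_right ->; ring.
Qed.

(** The nodes are sorted so that, right of the last one, the earlier kinks sum to an affine
    function; it lies below their sum everywhere, and [kink_add] peels off the last kink. *)
Lemma Psi_kinks (m : nat) (c w : nat -> R) phi : (forall i, 0 <= w i) ->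
  (forall i j, (i <= j)%N -> c i <= c j) -> Cc phi ->
  Psi (fun x => f x + \sum_(i < m) w i * kap (c i) (dotR a x)) phi =
  Psi f phi + \sum_(i < m) bet (c i) (w i) phi.
Proof.
move=> w0 mc cphi; elim: m => [|m IH].
  rewrite big_ord0 addr0; congr Psi; apply: funext => x; by rewrite big_ord0 addr0.
rewrite big_ord_recr /= addrA -IH.
have := @kink_add R n k Psi MA f a cf (fun s => \sum_(i < m) w i * kap (c i) s)
  (\sum_(i < m) w i) (- \sum_(i < m) w i * c i) (c m) (w m) phi.
move=> /(_ (cvx1_sum _ _ w0) (w0 m) _ _ cphi) h.
rewrite /bet addrA -h; last 2 first.
- move=> s; rewrite big_distrl -sumrB; apply: ler_sum => i _ /=.
  by have := ler_wpM2l (w0 i) (kap_ge (c i) s); lra.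
- move=> s ms; rewrite big_distrl -sumrB; apply: eq_bigr => i _ /=.
  by rewrite kap_right ?mulrBr //; apply: le_trans ms; apply: mc; exact: ltnW.
by rewrite addrK; congr Psi; apply: funext => x; rewrite big_ord_recr.
Qed.

Lemma bet_cont (c w : R) (v : nat -> R) phi : 0 <= w -> (forall j, 0 <= v j) ->
  (forall e : R, 0 < e -> exists N, forall j, (N <= j)%N -> `|v j - w| < e) -> Cc phi ->
  clim (fun j => bet c (v j) phi) (bet c w phi).
Proof.
move=> w0 v0 h cphi.
suff H : clim (fun j => Psi (fun x => f x + v j * kap c (dotR a x)) phi)
    (Psi (fun x => f x + w * kap c (dotR a x)) phi).
  exact: (climB H (@clim_cst R (Psi f phi))).
apply: (@Psi_ridge_cont R n k Psi MA (fun j s => v j * kap c s) (fun s => w * kap c s) f a phi cf) => //.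
- by move=> j; exact: cvx1_kapZ.
- exact: cvx1_kapZ.
move=> S e e0; have D0 : 0 < `|S| + `|c| + 1 by rewrite ltr_wpDl // addr_ge0.
have [N hN] := h (e / (`|S| + `|c| + 1)) (divr_gt0 e0 D0).
exists N => j /hN; rewrite ltr_pdivlMr // => hj s sS; rewrite -mulrBl normrM.
apply: le_lt_trans hj; apply: ler_wpM2l => //; apply: le_trans (kap_abs _ _) _.
by have := ler_norm S; lra.
Qed.

(** Cauchy's functional equation on a half-line: additivity settles rational multiples and
    continuity the rest. The rationals floor((j+1) w) / (j+1) approach w from below with error less
    than 1/(j+1). *)
Lemma bet_lin (c w : R) phi : 0 <= w -> Cc phi -> bet c w phi = cR w * bet c 1 phi.
Proof.
move=> w0 cphi.
have nat_mul (v : R) (m : nat) : 0 <= v -> bet c (m%:R * v) phi = cR m%:R * bet c v phi.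
  move=> v0; elim: m => [|m IH].
    rewrite !mul0r; have := bet_add c (lexx 0) (lexx 0) cphi.
    by rewrite addr0 => /(congr1 (fun z => z - bet c 0 phi)); rewrite subrr addrK.
  rewrite -addn1 natrD mulrDl mul1r bet_add //; last by rewrite mulr_ge0 ?ler0n.
  by rewrite IH cRD cR1 mulrDl mul1r.
pose v (j : nat) : R := (Num.truncn (j.+1%:R * w))%:R / j.+1%:R.
have j0 (j : nat) : 0 < j.+1%:R :> R by rewrite ltr0n.
have v0 j : 0 <= v j by rewrite divr_ge0 ?ler0n.
have vw (e : R) : 0 < e -> exists N, forall j, (N <= j)%N -> `|v j - w| < e.
  move=> e0; exists (Num.truncn e^-1).+1 => j hj.
  have jw : 0 <= j.+1%:R * w by rewrite mulr_ge0 ?ler0n.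
  have /andP[t1 t2] := truncn_itv jw.
  have e1 : e^-1 < j.+1%:R.
    apply: lt_le_trans (truncnS_gt _) _; rewrite ler_nat; exact: leq_trans hj (leqnSn j).
  have h1 : v j <= w by rewrite /v ler_pdivrMr // (mulrC w).
  have h2 : w - j.+1%:R^-1 < v j.
    rewrite /v ltr_pdivlMr // mulrBl mulVf ?gt_eqF // (mulrC w).
    by move: t2; rewrite -[X in _ < X -> _]natr1; move: (j.+1%:R * w) => X; lra.
  have h3 : j.+1%:R^-1 < e by rewrite -[e]invrK ltf_pV2 // posrE ?invr_gt0.
  rewrite ltr_norml; move: h1 h2 h3; move: (v j) (j.+1%:R^-1) => V q h1 h2 h3.
  by apply/andP; split; lra.
apply: (clim_unique (bet_cont c w0 v0 vw cphi)).
have vE j : bet c (v j) phi = cR (v j) * bet c 1 phi.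
  have q0 : 0 <= j.+1%:R^-1 :> R by rewrite invr_ge0 ler0n.
  rewrite /v nat_mul //.
  have -> : bet c 1 phi = cR j.+1%:R * bet c j.+1%:R^-1 phi.
    by rewrite -nat_mul // mulfV // gt_eqF.
  by rewrite mulrA -cRM mulfVK // gt_eqF.
apply: (@clim_ext _ (fun j => bet c 1 phi * cR (v j))); first by move=> j; rewrite vE mulrC.
rewrite mulrC; apply: climM => e e0; have [N hN] := vw e e0; exists N => j /hN.
by rewrite -cRN -cRD nC_cR.
Qed.

Lemma cradon_bet (c : R) : cradon (bet c 1).
Proof.
have k1 : convexR (fun x => f x + 1 * kap c (dotR a x)).
  exact: (convex_add_ridge a cf (cvx1_kapZ c ler01)).
have r1 := Psi_radon MA k1; have r2 := Psi_radon MA cf.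
split => [z phi psi cp cq|B]; first by rewrite /bet r1.1 // r2.1 //; ring.
have [c1 c10 h1] := r1.2 B; have [c2 c20 h2] := r2.2 B.
exists (c1 + c2); first by rewrite addr_gt0.
move=> phi M cp pB pM; apply: le_trans (nC_D _ _) _; rewrite nC_N mulrDl.
by apply: lerD; [exact: h1|exact: h2].
Qed.

Lemma lip_cont (psi : R -> R) (La : R) : 0 <= La ->
  (forall s t, `|psi s - psi t| <= La * `|s - t|) -> continuous psi.
Proof.
move=> La0 h; apply/continuous_epsP => s e e0; exists (e / (La + 1)).
  by rewrite divr_gt0 // ltr_wpDl.
move=> t; rewrite ltr_pdivlMr ?ltr_wpDl // => st; apply: le_lt_trans (h _ _) _.
apply: le_lt_trans st; rewrite mulrC; apply: ler_wpM2l => //; lra.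
Qed.

(** On either side of the hyperplane the kink is invisible: to the left it is 0, to the right it is
    the affine function <a, x> - c. The left side is a half-space for the direction - a. *)
Lemma bet_side (c : R) (r : R -> R) (d : R) phi : 0 < d -> continuous r -> Cc phi ->
  (forall s, r s != 0 -> c + d <= s) \/ (forall s, r s != 0 -> s <= c - d) ->
  bet c 1 (fun x => cR (r (dotR a x)) * phi x) = 0.
Proof.
move=> d0 cr cphi side.
have k1 : convexR (fun x => f x + 1 * kap c (dotR a x)).
  exact: (convex_add_ridge a cf (cvx1_kapZ c ler01)).
have cp : Cc (fun x => cR (r (dotR a x)) * phi x).
  apply: CcM => //; apply: ccont_cR; exact: cont_ridge.
have rn0 x : cR (r (dotR a x)) * phi x != 0 -> r (dotR a x) != 0.
  by apply: contra_neq => ->; rewrite cR0 mul0r.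
apply/eqP; rewrite subr_eq0; apply/eqP; case: side => side.
  rewrite -[RHS](Psi_aff MA a (- c)) //.
  apply: (Psi_loc_gt MA (a := a) (c := c) (d := d)) => //.
  - have := convex_add_ridge a cf (cvx1_affine 1 (- c)); congr convexR.
    by apply: funext => x; rewrite mul1r addrA.
  - by move=> x /ltW h; rewrite kap_right // mul1r addrA.
  - by move=> x /rn0 /side.
apply: (Psi_loc_gt MA (a := - a) (c := - c) (d := d)) => //.
- move=> x; have -> : dotR (- a) x = - dotR a x by rewrite -scaleN1r dotRZl mulN1r.
  move=> h; rewrite /kap max_r ?mulr0 ?addr0 //; lra.
- move=> x /rn0 /side; have -> : dotR (- a) x = - dotR a x by rewrite -scaleN1r dotRZl mulN1r.
  lra.
Qed.

(** Away from <a, x> = c the increment vanishes, so only psi c matters. Pulling the argument of psi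
    towards c by d gives [rp] and [rn], supported at distance d from c and annihilated by
    [bet_side]; the rest of psi - psi c is at most La d in size. *)
Lemma bet_loc (c : R) (psi : R -> R) (La : R) phi : 0 <= La ->
  (forall s t, `|psi s - psi t| <= La * `|s - t|) -> Cc phi ->
  bet c 1 (fun x => cR (psi (dotR a x)) * phi x) = cR (psi c) * bet c 1 phi.
Proof.
move=> La0 lip cphi; have cpsi := lip_cont La0 lip.
have rb := cradon_bet c.
have CM (r : R -> R) : continuous r -> Cc (fun x => cR (r (dotR a x)) * phi x).
  move=> cr; apply: CcM => //; apply: ccont_cR; exact: cont_ridge.
have czero (m : R -> R) : (forall s t, `|m s - m t| <= 1 * `|s - t|) -> continuous (fun s => psi (m s) - psi c).
  move=> hm; apply: rcontD; last exact: rcont_cst.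
  by apply: rcont_comp cpsi; exact: (lip_cont ler01).
apply/eqP; rewrite -subr_eq0 -(cradonZ rb) // -(cradonB rb); [|exact: CM|exact: CcZ].
apply/eqP; apply: nC_eq0.
have /CcP[_ _ [B B0 pB]] := cphi.
have [M M0 hM] := Cc_bounded cphi.
have [cc cc0 hcc] := rb.2 B.
apply/ler_addgt0Pr => e e0; rewrite add0r.
(* La + 1 keeps D positive even for constant psi; the surplus is the second summand when e = D d is
   split below. *)
pose D := cc * ((La + 1) * M).
have D0 : 0 < D by rewrite /D !mulr_gt0 // ltr_wpDl.
pose d := e / D.
have d0 : 0 < d by rewrite divr_gt0.
pose mp s := c + Num.max (s - c - d) 0.
pose mn s := c + Num.min (s - c + d) 0.
have lipp s t : `|mp s - mp t| <= 1 * `|s - t|.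
  rewrite mul1r /mp opprD addrACA subrr add0r ler_norml.
  have [h|h] := leP (s - c - d) 0; have [h'|h'] := leP (t - c - d) 0;
    have := ler_norm (s - t); have := ler_norm (- (s - t)); rewrite normrN => *;
    apply/andP; split; lra.
have lipn s t : `|mn s - mn t| <= 1 * `|s - t|.
  rewrite mul1r /mn opprD addrACA subrr add0r ler_norml.
  have [h|h] := leP (s - c + d) 0; have [h'|h'] := leP (t - c + d) 0;
    have := ler_norm (s - t); have := ler_norm (- (s - t)); rewrite normrN => *;
    apply/andP; split; lra.
pose rp s := psi (mp s) - psi c.
pose rn s := psi (mn s) - psi c.
have crp : continuous rp by exact: czero.
have crn : continuous rn by exact: czero.
have bp : bet c 1 (fun x => cR (rp (dotR a x)) * phi x) = 0.
  apply: (bet_side d0 crp cphi); left => s; apply: contra_neqT; rewrite -ltNge => h.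
  by rewrite /rp /mp max_r ?addr0 ?subrr //; lra.
have bn : bet c 1 (fun x => cR (rn (dotR a x)) * phi x) = 0.
  apply: (bet_side d0 crn cphi); right => s; apply: contra_neqT; rewrite -ltNge => h.
  by rewrite /rn /mn min_r ?addr0 ?subrr //; lra.
have cq : continuous (fun s => psi s - psi c - rp s - rn s).
  have cN (r : R -> R) : continuous r -> continuous (fun s => - r s).
    by move=> cr s; apply: cvgN; exact: cr.
  apply: rcontD; [apply: rcontD; [apply: rcontD|]|]; [exact: cpsi|exact: rcont_cst|exact: cN|exact: cN].
have -> : (fun x => cR (psi (dotR a x)) * phi x - cR (psi c) * phi x) =
  (fun x => cR (psi (dotR a x) - psi c - rp (dotR a x) - rn (dotR a x)) * phi x +
     (cR (rp (dotR a x)) * phi x + cR (rn (dotR a x)) * phi x)).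
  by apply: funext => x; rewrite !(cRD, cRN); ring.
rewrite (cradonD rb); [|exact: (CM _ cq)|by apply: CcD; exact: CM].
rewrite (cradonD rb (CM _ crp) (CM _ crn)) bp bn !addr0.
have -> : e = cc * (La * d * M) + cc * (d * M).
  have -> : cc * (La * d * M) + cc * (d * M) = D * d by rewrite /D; ring.
  by rewrite /d mulrCA mulfV ?mulr1 // gt_eqF.
apply: ler_wpDr; first by apply: mulr_ge0; [exact: ltW|apply: mulr_ge0; exact: ltW].
apply: hcc; [exact: (CM _ cq)|by move=> x /pB ->; rewrite mulr0|].
move=> x; apply: le_trans (nC_M _ _) _; rewrite nC_cR; apply: ler_pM => //; first exact: nC_ge0.
move: (dotR a x) => s.
have [h1|h1] := leP (s - c - d) 0; have [h2|h2] := leP (s - c + d) 0; try lra.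
- have -> : psi s - psi c - rp s - rn s = psi s - psi (s + d).
    rewrite /rp /rn /mp /mn max_r // min_l // addr0.
    have -> : c + (s - c + d) = s + d by ring.
    by ring.
  by apply: le_trans (lip _ _) _; rewrite opprD addrA subrr add0r normrN gtr0_norm.
- have -> : psi s - psi c - rp s - rn s = psi s - psi c.
    by rewrite /rp /rn /mp /mn max_r // min_r ?ltW // addr0; ring.
  apply: le_trans (lip _ _) _; apply: ler_wpM2l => //.
  by rewrite ler_norml; apply/andP; split; lra.
- have -> : psi s - psi c - rp s - rn s = psi s - psi (s - d).
    rewrite /rp /rn /mp /mn max_l ?ltW // min_r ?ltW // addr0.
    have -> : c + (s - c - d) = s - d by ring.
    by ring.
  by apply: le_trans (lip _ _) _; rewrite opprB addrCA subrr addr0 gtr0_norm.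
Qed.

End Kinks.

(** * The effect of adding a ridge function *)

Section RankOneFormula.
Variables (R : realType) (n k : nat).
Local Notation C := R[i].
Variable Psi : ('rV[R]_n -> R) -> ('rV[R]_n -> C) -> C.
Hypothesis MA : MAVal k Psi.
Implicit Types (phi : 'rV[R]_n -> C).

Definition qd n (a x : 'rV[R]_n) : R := dotR a x * dotR a x / 2.

(** Here psi is the second derivative of u: its sign gives convexity, its bound and Lipschitz
    constant control the Riemann sums. *)
Record profile (u du psi : R -> R) (m La : R) : Prop := Profile {
  prof_u : forall s : R, is_derive s (1 : R) u (du s);
  prof_du : forall s : R, is_derive s (1 : R) du (psi s);
  prof_bd : forall s, 0 <= psi s <= m;
  prof_La : 0 <= La;
  prof_lip : forall s t, `|psi s - psi t| <= La * `|s - t| }.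

Lemma profile_cvx1 u du psi m La : profile u du psi m La -> cvx1 u.
Proof.
case=> h1 h2 h3 _ _; apply: (cvx1_d2 h1 h2) => s; by case/andP: (h3 s).
Qed.

Lemma profile_quad (t : R) : 0 <= t -> profile (fun s => t * (s * s / 2)) (fun s => t * s) (fun=> t) t 0.
Proof.
move=> t0; split => //.
- by move=> s; apply: is_derive_eq; rewrite /= /GRing.scale /=; field.
- by move=> s; apply: is_derive_eq; rewrite /= /GRing.scale /=; ring.
- by move=> s; rewrite t0 lexx.
- by move=> s s'; rewrite subrr normr0 mul0r.
Qed.

Variables (f : 'rV[R]_n -> R) (a : 'rV[R]_n).
Hypothesis cf : convexR f.

(** The test function only sees <a, x> >= -L + 1, where u and [klim] differ by an affine function;
    local determination and affine invariance exchange one for the other. *)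
Lemma kapprox_lim u du psi m La (L : R) phi : profile u du psi m La -> Cc phi ->
  (forall x, phi x != 0 -> - L + 1 <= dotR a x) ->
  clim (fun N => Psi (fun x => f x + kapprox L psi N (dotR a x)) phi)
    (Psi (fun x => f x + u (dotR a x)) phi).
Proof.
move=> pr cphi hL; have [h1 h2 h3 h4 h5] := pr.
have psi0 s : 0 <= psi s by case/andP: (h3 s).
have cvg := kapprox_cvg L h1 h2 h3 h5 h4.
have cN N : cvx1 (kapprox L psi N).
  apply: (@cvx1_sum R _ (fun i => N.+1%:R^-1 * psi (kgrid L N i)) (kgrid L N)) => i; by rewrite mulr_ge0 ?invr_ge0 ?ler0n.
have ck : cvx1 (klim L u du).
  apply: (cvx1_lim cN) => s e e0; have [N hN] := cvg `|s| e e0.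
  by exists N => j /hN /(_ s (lexx _)) /ltW.
have cu := profile_cvx1 pr.
have -> : Psi (fun x => f x + u (dotR a x)) phi = Psi (fun x => f x + klim L u du (dotR a x)) phi.
  rewrite -(Psi_aff MA (- du (- L) *: a) (- u (- L) - du (- L) * L) (convex_add_ridge a cf cu) cphi).
  have caff := cvx1_affine (- du (- L)) (- u (- L) - du (- L) * L).
  apply: (Psi_loc_gt MA (a := a) (c := - L) (d := 1)) => //.
  - have := convex_add_ridge a (convex_add_ridge a cf cu) caff; congr convexR.
    by apply: funext => x; rewrite dotRZl addrA.
  - exact: convex_add_ridge.
  - by move=> x hx; rewrite /klim (max_l (ltW hx)) dotRZl; ring.
exact: (@Psi_ridge_cont R n k Psi MA _ _ f a phi cf cN ck cvg cphi).
Qed.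

Lemma kapprox_Psi psi (L : R) N phi : (forall s, 0 <= psi s) -> Cc phi ->
  Psi (fun x => f x + kapprox L psi N (dotR a x)) phi =
  Psi f phi + \sum_(i < (N.+1 * N.+1)%N) cR (N.+1%:R^-1) *
    (cR (psi (kgrid L N i)) * bet Psi f a (kgrid L N i) 1 phi).
Proof.
move=> p0 cphi.
have w0 (i : nat) : 0 <= N.+1%:R^-1 * psi (kgrid L N i) by rewrite mulr_ge0 ?invr_ge0 ?ler0n.
rewrite (@Psi_kinks R n k Psi MA f a cf _ (kgrid L N) (fun i => N.+1%:R^-1 * psi (kgrid L N i))) //.
  by congr (_ + _); apply: eq_bigr => i _; rewrite (bet_lin MA) // cRM mulrA.
move=> i j ij; rewrite lerD2l; apply: ler_wpM2r; first by rewrite invr_ge0 ler0n.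
by rewrite ler_nat.
Qed.

(** Both increments are limits of sums over the same nodes c_i. For u the kink at c_i has weight psi
    c_i; for the quadratic profile it has weight 1, but the test function carries psi(<a, x>). By
    [bet_loc] the sums agree term by term. *)
Theorem rank_one u du psi m La phi : profile u du psi m La -> Cc phi ->
  let phi' := fun x => cR (psi (dotR a x)) * phi x in
  Psi (fun x => f x + u (dotR a x)) phi =
  Psi f phi + (Psi (fun x => f x + qd a x) phi' - Psi f phi').
Proof.
move=> pr cphi phi'; have [h1 h2 h3 h4 h5] := pr.
have psi0 s : 0 <= psi s by case/andP: (h3 s).
have cphi' : Cc phi'.
  by apply: CcM => //; apply: ccont_cR; apply: cont_ridge; exact: lip_cont h5.
have /CcP[_ _ [B B0 pB]] := cphi.
pose L := asum a * B + 1.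
have hL x : phi x != 0 -> - L + 1 <= dotR a x.
  move=> hx; have xB : `|x| <= B by rewrite leNgt; apply: contra_neqN hx; exact: pB.
  have := dotR_le a x; rewrite ler_norml => /andP[k1 _].
  have := ler_wpM2l (asum_ge0 a) xB; rewrite /L; lra.
have hL' x : phi' x != 0 -> - L + 1 <= dotR a x.
  move=> h; apply: hL; apply: contra_neq h => h; by rewrite /phi' h mulr0.
have l1 := kapprox_lim pr cphi hL.
have l2 := kapprox_lim (profile_quad ler01) cphi' hL'.
apply: (clim_unique l1).
have -> : (fun x => f x + qd a x) = (fun x => f x + 1 * (dotR a x * dotR a x / 2)).
  by apply: funext => x; rewrite mul1r.
apply: (clim_ext _ (climD (@clim_cst R (Psi f phi)) (climB l2 (@clim_cst R (Psi f phi'))))) => N.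
rewrite /= !kapprox_Psi //.
rewrite (addrC (Psi f phi')) addrK; congr (_ + _); apply: eq_bigr => i _; congr (_ * _).
by rewrite cR1 mul1r (@bet_loc R n k Psi MA f a cf _ _ _ _ h4 h5 cphi).
Qed.

Lemma rank_one_aff (t : R) phi : 0 <= t -> Cc phi ->
  Psi (fun x => f x + t * qd a x) phi =
  Psi f phi + cR t * (Psi (fun x => f x + qd a x) phi - Psi f phi).
Proof.
move=> t0 cphi; rewrite (rank_one (profile_quad t0) cphi); congr (_ + _).
have c1 : convexR (fun x => f x + qd a x).
  have := convex_add_ridge a cf (profile_cvx1 (profile_quad ler01)); congr convexR.
  by apply: funext => x; rewrite mul1r.
by rewrite (cradonZ (Psi_radon MA cf)) // (cradonZ (Psi_radon MA c1)) // mulrBr.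
Qed.

End RankOneFormula.

(** * Polynomial functions on the real line *)

Section PolyFun.
Variable R : realType.
Local Notation C := R[i].

Definition polyfun (g : R -> C) := exists p : {poly C}, forall s : R, g s = p.[cR s].

Lemma polyfun_cst c : polyfun (fun=> c).
Proof. by exists c%:P => s; rewrite hornerC. Qed.
Lemma polyfun_id : polyfun (fun s => cR s).
Proof. by exists 'X => s; rewrite hornerX. Qed.
Lemma polyfunD g h : polyfun g -> polyfun h -> polyfun (fun s => g s + h s).
Proof. by move=> [p hp] [q hq]; exists (p + q) => s; rewrite hornerD hp hq. Qed.
Lemma polyfunM g h : polyfun g -> polyfun h -> polyfun (fun s => g s * h s).
Proof. by move=> [p hp] [q hq]; exists (p * q) => s; rewrite hornerM hp hq. Qed.
Lemma polyfunB g h : polyfun g -> polyfun h -> polyfun (fun s => g s - h s).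
Proof. by move=> [p hp] [q hq]; exists (p - q) => s; rewrite hornerD hornerN hp hq. Qed.
Lemma polyfun_sum I (r : seq I) (g : I -> R -> C) : (forall i, polyfun (g i)) ->
  polyfun (fun s => \sum_(i <- r) g i s).
Proof.
move=> h; elim: r => [|i r [p hp]].
  by exists 0 => s; rewrite big_nil horner0.
have [q hq] := h i; exists (q + p) => s; by rewrite big_cons hornerD hp hq.
Qed.
Lemma polyfun_prod I (r : seq I) (g : I -> R -> C) : (forall i, polyfun (g i)) ->
  polyfun (fun s => \prod_(i <- r) g i s).
Proof.
move=> h; elim: r => [|i r [p hp]].
  by exists 1 => s; rewrite big_nil hornerC.
have [q hq] := h i; exists (q * p) => s; by rewrite big_cons hornerM hp hq.
Qed.
Lemma polyfun_lin (x y : R) : polyfun (fun s => cR (x + s * y)).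
Proof.
have h := polyfunD (polyfun_cst (cR x)) (polyfunM polyfun_id (polyfun_cst (cR y))).
by case: h => p hp; exists p => s; rewrite -hp cRD cRM.
Qed.

Lemma cR_inj : injective (@cR R).
Proof. by move=> x y /(congr1 (@reC R)). Qed.

Lemma poly_zero_ray (p : {poly C}) (T : R) : (forall s : R, T <= s -> p.[cR s] = 0) -> p = 0.
Proof.
move=> h; pose rs := [seq cR (T + i%:R) | i <- iota 0 (size p)].
apply: (@roots_geq_poly_eq0 _ p rs); last by rewrite size_map size_iota.
  by apply/allP => z /mapP[i _ ->]; apply/rootP; apply: h; rewrite lerDl ler0n.
rewrite map_inj_uniq ?iota_uniq // => i j /cR_inj /addrI /eqP.
by rewrite eqr_nat => /eqP.
Qed.

Lemma polyfun_zero g (T : R) : polyfun g -> (forall s, T <= s -> g s = 0) -> forall s, g s = 0.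
Proof.
move=> [p hp] h s; rewrite hp (@poly_zero_ray p T) ?horner0 // => t /h.
by rewrite hp.
Qed.
End PolyFun.

(** * Quadratic forms *)

Section Quadratic.
Variables (R : realType) (n : nat).
Implicit Types (A B : 'M[R]_n) (a x y : 'rV[R]_n).

(** A need not be symmetric; with the factor 1/2 the Hessian is the symmetric part of A. *)
Definition qM A x : R := (\sum_(p : 'I_n * 'I_n) A p.1 p.2 * (x 0 p.1 * x 0 p.2)) / 2.
Definition rk a : 'M[R]_n := \matrix_(i, j) (a 0 i * a 0 j).
Definition psd A := forall x, 0 <= qM A x.

Lemma qM_lin A (t : R) B x : qM (A + t *: B) x = qM A x + t * qM B x.
Proof.
rewrite /qM mulrA -mulrDl big_distrr -big_split /=; congr (_ / 2).
by apply: eq_bigr => p _; rewrite !mxE; ring.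
Qed.

Lemma qM_rk a x : qM (rk a) x = qd a x.
Proof.
rewrite /qM /qd; congr (_ / 2); rewrite /dotR big_distrlr pair_big /=.
by apply: eq_bigr => p _; rewrite !mxE; ring.
Qed.

Lemma qM_add_rk A (t : R) a x : qM (A + t *: rk a) x = qM A x + t * qd a x.
Proof. by rewrite qM_lin qM_rk. Qed.

Lemma qd_ge0 a x : 0 <= qd a x.
Proof. by rewrite /qd divr_ge0 // -expr2 sqr_ge0. Qed.

Lemma psd_add_rk A (t : R) a : psd A -> 0 <= t -> psd (A + t *: rk a).
Proof. by move=> pA t0 x; rewrite qM_add_rk; apply: addr_ge0 => //; apply: mulr_ge0 => //; exact: qd_ge0. Qed.

Lemma convex_qM A : psd A -> convexR (qM A).
Proof.
move=> pA x y t /andP[t0 t1]; rewrite -subr_ge0.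
have -> : t * qM A x + (1 - t) * qM A y - qM A (t *: x + (1 - t) *: y) = t * (1 - t) * qM A (x - y).
  rewrite /qM !mulrA -mulrDl -mulNr -mulrDl; congr (_ / 2).
  rewrite !big_distrr -big_split -sumrN -big_split /=.
  by apply: eq_bigr => p _; rewrite !mxE; ring.
by apply: mulr_ge0 => //; rewrite mulr_ge0 // subr_ge0.
Qed.

Lemma qM_shift A y : exists w c, forall x, qM A (x - y) = qM A x + dotR w x + c.
Proof.
exists (\row_i (- (\sum_j (A i j + A j i) * y 0 j) / 2)), (qM A y) => x.
have -> : dotR (\row_i (- (\sum_j (A i j + A j i) * y 0 j) / 2)) x =
  (\sum_(p : 'I_n * 'I_n) A p.1 p.2 * (- x 0 p.1 * y 0 p.2 - y 0 p.1 * x 0 p.2)) / 2.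
  rewrite /dotR.
  have -> : \sum_(p : 'I_n * 'I_n) A p.1 p.2 * (- x 0 p.1 * y 0 p.2 - y 0 p.1 * x 0 p.2) =
    \sum_(p : 'I_n * 'I_n) - (A p.1 p.2 * (x 0 p.1 * y 0 p.2)) +
    \sum_(p : 'I_n * 'I_n) - (A p.1 p.2 * (y 0 p.1 * x 0 p.2)).
    by rewrite -big_split; apply: eq_bigr => p _ /=; ring.
  rewrite -(pair_bigA _ (fun i j => - (A i j * (x 0 i * y 0 j)))) /=.
  rewrite -(pair_bigA _ (fun i j => - (A i j * (y 0 i * x 0 j)))) /= [X in _ + X]exchange_big.
  rewrite -big_split big_distrl /=; apply: eq_bigr => i _; rewrite !mxE -big_split /=.
  rewrite mulrAC; congr (_ / 2); rewrite mulNr big_distrl -sumrN; apply: eq_bigr => j _ /=; ring.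
rewrite /qM -!mulrDl; congr (_ / 2); rewrite -!big_split /=.
by apply: eq_bigr => p _; rewrite !mxE; ring.
Qed.

Definition mxl1 A : R := \sum_(p : 'I_n * 'I_n) `|A p.1 p.2|.

(** Crude diagonal dominance: every product x_i x_j is at most the squared Euclidean norm N in size,
    so the double sum is at least - mxl1 A * N. *)
Lemma psd_diag A (t : 'I_n -> R) : (forall i, mxl1 A <= t i) -> psd (A + diag_mx (\row_i t i)).
Proof.
move=> h x.
have dE : \sum_(p : 'I_n * 'I_n) (diag_mx (\row_i t i)) p.1 p.2 * (x 0 p.1 * x 0 p.2) =
    \sum_(i < n) t i * (x 0 i * x 0 i).
  rewrite -(pair_bigA _ (fun i j => (diag_mx (\row_i t i)) i j * (x 0 i * x 0 j))) /=.
  apply: eq_bigr => i _; rewrite (bigD1 i) //= big1 ?addr0 => [|j ji].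
    by rewrite !mxE eqxx.
  by rewrite !mxE eq_sym (negPf ji) mulr0n mul0r.
pose N := \sum_(i < n) x 0 i * x 0 i.
have xi i : x 0 i * x 0 i <= N.
  by rewrite /N (bigD1 i) //= lerDl sumr_ge0 // => j _; rewrite -expr2 sqr_ge0.
have xij i j : `|x 0 i * x 0 j| <= N.
  have := xi i; have := xi j; have := sqr_ge0 (x 0 i - x 0 j); have := sqr_ge0 (x 0 i + x 0 j).
  rewrite !expr2 ler_norml => *; apply/andP; split; lra.
have N0 : 0 <= N by rewrite sumr_ge0 // => j _; rewrite -expr2 sqr_ge0.
have k1 : - (mxl1 A * N) <= \sum_(p : 'I_n * 'I_n) A p.1 p.2 * (x 0 p.1 * x 0 p.2).
  rewrite /mxl1 big_distrl -sumrN; apply: ler_sum => p _ /=.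
  have := ler_wpM2l (normr_ge0 (A p.1 p.2)) (xij p.1 p.2); rewrite -normrM ler_norml => /andP[]; lra.
have k2 : mxl1 A * N <= \sum_(i < n) t i * (x 0 i * x 0 i).
  rewrite /N big_distrr; apply: ler_sum => i _ /=; apply: ler_wpM2r => //.
  by rewrite -expr2 sqr_ge0.
have -> : qM (A + diag_mx (\row_i t i)) x =
   (\sum_(p : 'I_n * 'I_n) A p.1 p.2 * (x 0 p.1 * x 0 p.2) + \sum_(i < n) t i * (x 0 i * x 0 i)) / 2.
  rewrite -dE -big_split /qM; congr (_ / 2); apply: eq_bigr => p _ /=.
  by rewrite mxE; ring.
rewrite divr_ge0 //; lra.
Qed.

Fixpoint sumq (aa : seq 'rV[R]_n) (ts : seq R) (x : 'rV[R]_n) : R :=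
  match aa, ts with a :: aa', t :: ts' => t * qd a x + sumq aa' ts' x | _, _ => 0 end.
Fixpoint sumrk (aa : seq 'rV[R]_n) (ts : seq R) : 'M[R]_n :=
  match aa, ts with a :: aa', t :: ts' => t *: rk a + sumrk aa' ts' | _, _ => 0 end.

Lemma qM0 x : qM 0 x = 0.
Proof. by rewrite /qM big1 ?mul0r // => p _; rewrite mxE mul0r. Qed.

Lemma qM_sumrk A aa ts x : qM (A + sumrk aa ts) x = qM A x + sumq aa ts x.
Proof.
elim: aa ts A => [|a aa IH] [|t ts] A /=; rewrite ?addr0 //.
by rewrite addrA IH qM_add_rk addrA.
Qed.

Lemma psd_sumrk A aa (ts : seq R) : psd A -> all (fun t : R => 0 <= t) ts -> psd (A + sumrk aa ts).
Proof.
elim: aa ts A => [|a aa IH] [|t ts] A pA /=; rewrite ?addr0 // => /andP[t0 h].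
by rewrite addrA; apply: IH => //; exact: psd_add_rk.
Qed.

Lemma psd0 : psd 0. Proof. by move=> x; rewrite qM0. Qed.

End Quadratic.

(** * Descent from large quadratic terms, and the form attached to [Psi] *)

Section Descent.
Variables (R : realType) (n k : nat).
Local Notation C := R[i].
Variable Psi : ('rV[R]_n -> R) -> ('rV[R]_n -> C) -> C.
Hypothesis MA : MAVal k Psi.
Implicit Types (f : 'rV[R]_n -> R) (phi : 'rV[R]_n -> C) (a x : 'rV[R]_n) (A : 'M[R]_n).

Lemma convex_add_qd f (t : R) a : convexR f -> 0 <= t -> convexR (fun x => f x + t * qd a x).
Proof.
move=> cf t0; exact: (convex_add_ridge a cf (profile_cvx1 (profile_quad t0))).
Qed.

(** By [rank_one_aff] the dependence on t is affine for t >= 0, and two polynomials agreeing on a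
    ray coincide, in particular at 0. *)
Lemma descend1 f a phi (T : R) (g : R -> C) : convexR f -> Cc phi -> polyfun g ->
  (forall t, T <= t -> Psi (fun x => f x + t * qd a x) phi = g t) -> Psi f phi = g 0.
Proof.
move=> cf cphi pg h; apply/eqP; rewrite -subr_eq0; apply/eqP.
pose D := Psi (fun x => f x + qd a x) phi - Psi f phi.
pose g' s := (Psi f phi + cR s * D) - g s.
have pg' : polyfun g'.
  apply: polyfunB => //; apply: polyfunD; first exact: polyfun_cst.
  by apply: polyfunM; [exact: polyfun_id|exact: polyfun_cst].
have := @polyfun_zero R g' (Num.max T 0) pg' _ 0; rewrite /g' cR0 mul0r addr0; apply.
move=> s; rewrite ge_max => /andP[sT s0]; by rewrite -h // (rank_one_aff MA) // subrr.
Qed.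

(** Coefficients are lowered to 0 one at a time, the others being either at least T or already 0, so
    polynomial dependence in each slot separately suffices. *)
Lemma descend f (aa : seq 'rV[R]_n) phi (T : R) (g : seq R -> C) : convexR f -> Cc phi -> 0 <= T ->
  (forall ts1 ts2, polyfun (fun s => g (ts1 ++ s :: ts2))) ->
  (forall ts : seq R, size ts = size aa -> all (fun t : R => T <= t) ts ->
     Psi (fun x => f x + sumq aa ts x) phi = g ts) -> Psi f phi = g (nseq (size aa) 0).
Proof.
move=> cf cphi T0; elim: aa f g cf => [|a aa IH] f g cf pg h /=.
  by rewrite -h //=; congr Psi; apply: funext => x; rewrite addr0.
apply: (@descend1 f a phi T (fun t => g (t :: nseq (size aa) 0))) => //; first exact: (pg [::]).
move=> t tT; apply: (IH _ (fun ts => g (t :: ts))).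
- by apply: convex_add_qd => //; exact: le_trans tT.
- by move=> ts1 ts2; exact: (pg (t :: ts1)).
move=> ts sz hts; rewrite -h /= ?sz ?tT //.
by congr Psi; apply: funext => x; rewrite addrA.
Qed.

Definition PA A : C := Psi (qM A) (@phi0 R n).

Lemma PA_eq A B : (forall x, qM A x = qM B x) -> PA A = PA B.
Proof. by move=> /funext h; rewrite /PA h. Qed.

(** A translate of a quadratic form differs from it by an affine function, so the measure is
    translation invariant and [Haar] applies; the factor is read off on [phi0]. *)
Lemma Psi_qM A phi : psd A -> Cc phi -> Psi (qM A) phi = PA A * Iint phi.
Proof.
move=> pA cphi; have cA := convex_qM pA.
apply: (Haar (Psi_radon MA cA)) => // psi y cpsi.
rewrite -(Psi_tr MA) //; have [w [c h]] := qM_shift A y.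
by rewrite (funext h); apply: (Psi_aff MA).
Qed.

Lemma PA_rank1 A a (t : R) : psd A -> 0 <= t ->
  PA (A + t *: rk a) = PA A + cR t * (PA (A + rk a) - PA A).
Proof.
move=> pA t0; rewrite /PA (funext (qM_add_rk A t a)).
rewrite (rank_one_aff MA) //; [|exact: convex_qM|exact: phi0_Cc].
have -> // : qM (A + rk a) = fun x => qM A x + qd a x.
by apply: funext => x; rewrite -[rk a]scale1r qM_add_rk mul1r.
Qed.

Lemma PA_hom A (t : R) : psd A -> 0 < t -> PA (t *: A) = cR (t ^+ k) * PA A.
Proof.
move=> pA t0; rewrite /PA -(Psi_hom MA) //; [|exact: convex_qM|exact: phi0_Cc].
congr Psi; apply: funext => x.
by have := qM_lin 0 t A x; rewrite add0r qM0 add0r.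
Qed.

(** A polynomial as a list of monomials, each a coefficient with a word of variable indices, a
    format that supports shifting variables and filtering by degree. *)
Definition evL (L : seq (C * seq nat)) (t : nat -> R) : C :=
  \sum_(cw <- L) cw.1 * \prod_(i <- cw.2) cR (t i).

Lemma evL_cat L1 L2 t : evL (L1 ++ L2) t = evL L1 t + evL L2 t.
Proof. by rewrite /evL big_cat. Qed.

(** Multi-affinity in the coefficients. The new variable takes index 0, hence the shift by [succn];
    the three lists are the three terms of [PA_rank1]. *)
Lemma PA_words aa A : psd A -> exists L, forall ts : seq R, size ts = size aa ->
  all (fun t : R => 0 <= t) ts -> PA (A + sumrk aa ts) = evL L (nth 0 ts).
Proof.
elim: aa A => [|a aa IH] A pA.
  exists [:: (PA A, [::])] => -[|//] _ _ /=.
  by rewrite addr0 /evL big_seq1 big_nil mulr1.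
have [L1 h1] := IH A pA.
have pA1 : psd (A + rk a) by rewrite -[rk a]scale1r; exact: psd_add_rk.
have [L2 h2] := IH _ pA1.
exists ([seq (cw.1, map succn cw.2) | cw <- L1] ++
  ([seq (cw.1, 0%N :: map succn cw.2) | cw <- L2] ++ [seq (- cw.1, 0%N :: map succn cw.2) | cw <- L1])).
move=> [//|t ts] /= [sz] /andP[t0 hts].
have sh (ts' : seq R) w : \prod_(i <- map succn w) cR (nth 0 (t :: ts') i) = \prod_(i <- w) cR (nth 0 ts' i).
  by rewrite big_map.
have e1 : evL [seq (cw.1, map succn cw.2) | cw <- L1] (nth 0 (t :: ts)) = evL L1 (nth 0 ts).
  by rewrite /evL big_map; apply: eq_bigr => cw _; rewrite sh.
have e2 L : evL [seq (cw.1, 0%N :: map succn cw.2) | cw <- L] (nth 0 (t :: ts)) = cR t * evL L (nth 0 ts).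
  rewrite /evL big_map big_distrr; apply: eq_bigr => cw _ /=; rewrite big_cons sh /=; ring.
have e3 L : evL [seq (- cw.1, 0%N :: map succn cw.2) | cw <- L] (nth 0 (t :: ts)) = - (cR t * evL L (nth 0 ts)).
  rewrite /evL big_map big_distrr -sumrN; apply: eq_bigr => cw _ /=; rewrite big_cons sh /=; ring.
rewrite !evL_cat e1 e2 e3 -h1 // -h2 //.
rewrite [t *: _ + _]addrC addrA PA_rank1 //; last exact: psd_sumrk.
by rewrite (addrAC A (rk a)) mulrBr.
Qed.

Local Notation S := ('I_n * 'I_n * bool)%type.
(** The directions e_i + e_j and e_i - e_j: polarizing x_i x_j writes every form as a combination of
    the [qd (fv s)] with coefficients [fc A s]. Unlike in a diagonalization, the directions do not
    depend on A and the coefficients are linear in A. *)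
Definition fv (s : S) : 'rV[R]_n := delta_mx 0 s.1.1 + (-1) ^+ s.2 *: delta_mx 0 s.1.2.
Definition fc (A : 'M[R]_n) (s : S) : R := (-1) ^+ s.2 * A s.1.1 s.1.2 / 4.
Definition frame : seq 'rV[R]_n := map fv (enum {: S}).
Definition fts A : seq R := map (fc A) (enum {: S}).

Lemma dot_delta (i : 'I_n) x : dotR (delta_mx 0 i) x = x 0 i.
Proof.
rewrite /dotR (bigD1 i) //= big1 ?addr0 => [|j ji]; first by rewrite mxE !eqxx mul1r.
by rewrite mxE (negPf ji) andbF mul0r.
Qed.

Lemma sumq_map (T : eqType) (s : seq T) (v : T -> 'rV[R]_n) (c : T -> R) x :
  sumq (map v s) (map c s) x = \sum_(i <- s) c i * qd (v i) x.
Proof. by elim: s => [|i s IH] /=; rewrite ?big_nil // big_cons IH. Qed.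

Lemma sumq_frame A x : sumq frame (fts A) x = qM A x.
Proof.
rewrite sumq_map big_enum /= -(pair_bigA _ (fun p b => fc A (p, b) * qd (fv (p, b)) x)) /=.
rewrite /qM big_distrl; apply: eq_bigr => p _ /=.
by rewrite big_bool /fc /qd /fv /= !dotRDl !dotRZl !dot_delta expr0 expr1; field.
Qed.

Lemma sumrk_frame A x : qM (0 + sumrk frame (fts A)) x = qM A x.
Proof. by rewrite qM_sumrk qM0 add0r sumq_frame. Qed.

Lemma fts_add A ts : size ts = size frame ->
  sumq frame [seq nth 0 (fts A) i + nth 0 ts i | i <- iota 0 (size frame)] =1
  fun x => qM A x + sumq frame ts x.
Proof.
move=> sz x; rewrite -(sumq_frame A).
have : size (fts A) = size frame by rewrite !size_map.
move: (fts A) ts sz => us ts; elim: frame us ts => [|a aa IH] [|u us] [|t ts] //=; first by rewrite addr0.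
move=> [sz] [sz']; have h := IH us ts sz sz'.
have -> : [seq nth 0 (u :: us) i + nth 0 (t :: ts) i | i <- iota 1 (size aa)] =
  [seq nth 0 us i + nth 0 ts i | i <- iota 0 (size aa)].
  by rewrite (iotaDl 1 0) -map_comp.
by rewrite h; ring.
Qed.

(** [PA_words] treats coefficients >= 0, but [fts A] may have negative entries even for psd A.
    Adding coefficients of size at least T, the sum of the absolute values of these entries, repairs
    the sign; [descend] removes them again. *)
Lemma PA_poly : exists L : seq (C * seq nat), forall A, psd A -> PA A = evL L (nth 0 (fts A)).
Proof.
have [L hL] := PA_words frame (@psd0 R n).
exists L => A pA.
pose T := \sum_(i < size frame) `|nth 0 (fts A) i|.
pose g ts := evL L (fun i => nth 0 (fts A) i + nth 0 ts i).
have := @descend (qM A) frame (@phi0 R n) T g (convex_qM pA) (phi0_Cc R n) _.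
rewrite -/(PA A) => -> //.
- by rewrite /g /evL; apply: eq_bigr => cw _; congr (_ * _); apply: eq_bigr => i _;
    rewrite nth_nseq; case: ifP => _; rewrite addr0.
- by apply: sumr_ge0.
- move=> ts1 ts2; apply: polyfun_sum => cw; apply: polyfunM; first exact: polyfun_cst.
  apply: polyfun_prod => i.
  have [i1|i1] := ltnP i (size ts1).
    case: (polyfun_cst (cR (nth 0 (fts A) i + nth 0 ts1 i))) => p hp; exists p => s.
    by rewrite -hp nth_cat i1.
  have [e|ne] := eqVneq i (size ts1).
    case: (polyfun_lin (nth 0 (fts A) i) 1) => p hp; exists p => s.
    by rewrite -hp nth_cat ltnNge i1 /= e subnn mulr1.
  case: (polyfun_cst (cR (nth 0 (fts A) i + nth 0 ts2 (i - size ts1).-1))) => p hp; exists p => s.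
  rewrite -hp nth_cat ltnNge i1 /=.
  have : (0 < i - size ts1)%N by rewrite subn_gt0 ltn_neqAle eq_sym ne.
  by case: (i - size ts1)%N.
move=> ts sz hts.
pose us := [seq nth 0 (fts A) i + nth 0 ts i | i <- iota 0 (size frame)].
have szu : size us = size frame by rewrite size_map size_iota.
have us0 : all (fun t : R => 0 <= t) us.
  rewrite /us all_map; apply/allP => i; rewrite mem_iota add0n /= => ilt.
  have h1 : T <= nth 0 ts i by move/(all_nthP 0): hts; apply; rewrite sz.
  have h2 : `|nth 0 (fts A) i| <= T.
    by rewrite /T (bigD1 (Ordinal ilt)) //= lerDl sumr_ge0.
  have := ler_norm (- nth 0 (fts A) i); rewrite normrN; lra.
have -> : g ts = evL L (nth 0 us).
  apply: eq_bigr => cw _; congr (_ * _); apply: eq_bigr => i _; congr cR.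
  have [ilt|ige] := ltnP i (size frame).
    by rewrite (nth_map 0%N) ?size_iota // nth_iota.
  rewrite [RHS]nth_default ?szu // !nth_default ?sz ?addr0 //.
  by move: ige; rewrite /frame /fts !size_map.
rewrite -hL // /PA.
have -> // : qM (0 + sumrk frame us) = fun x => qM A x + sumq frame ts x.
by apply: funext => x; rewrite qM_sumrk qM0 add0r fts_add.
Qed.

(** Both sides of the homogeneity relation for s A are polynomials in s that agree for s >= 1;
    comparing coefficients of s^k leaves only the words of length k. *)
Lemma PA_poly_k : exists L : seq (C * seq nat), all (fun cw => size cw.2 == k) L /\
  forall A, psd A -> PA A = evL L (nth 0 (fts A)).
Proof.
have [L hL] := PA_poly; exists [seq cw <- L | size cw.2 == k]; split; first exact: filter_all.
move=> A pA.
have ftsZ (t : R) i : nth 0 (fts (t *: A)) i = t * nth 0 (fts A) i.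
  rewrite /fts; elim: (enum _) i => [|s ss IH] [|i] /=; rewrite ?mulr0 //.
  by rewrite /fc mxE; ring.
pose m (w : seq nat) := \prod_(i <- w) cR (nth 0 (fts A) i).
pose p : {poly C} := \sum_(cw <- L) (cw.1 * m cw.2) *: 'X^(size cw.2) - PA A *: 'X^k.
have p0 : p = 0.
  apply: (@poly_zero_ray R p 1) => s s1; have s0 : 0 < s by apply: lt_le_trans s1.
  have cRX j : cR (s ^+ j) = cR s ^+ j by elim: j => [//|j IH]; rewrite !exprS cRM IH.
  rewrite hornerD hornerN hornerZ hornerXn horner_sum mulrC -cRX -PA_hom //.
  rewrite hL; last first.
    by move=> x; have := qM_lin 0 s A x; rewrite add0r qM0 add0r => ->; rewrite mulr_ge0 // ltW.
  rewrite /evL -sumrB big1 // => cw _; rewrite hornerZ hornerXn -mulrA -mulrBr.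
  have -> : \prod_(i <- cw.2) cR (nth 0 (fts (s *: A)) i) = m cw.2 * cR s ^+ size cw.2.
    rewrite /m; elim: cw.2 => [|i w IH]; first by rewrite !big_nil mul1r.
    by rewrite !big_cons IH /= ftsZ cRM exprS; ring.
  by rewrite subrr mulr0.
have := congr1 (fun q : {poly C} => q`_k) p0; rewrite coef0 coefB coef_sum coefZ coefXn eqxx mulr1.
move=> /eqP; rewrite subr_eq0 => /eqP <-.
rewrite /evL big_filter [RHS]big_mkcond; apply: eq_bigr => cw _.
by rewrite coefZ coefXn eq_sym; case: eqP => _; rewrite ?mulr1 ?mulr0.
Qed.

Definition PH (c : {ffun 'I_k -> 'I_n * 'I_n} -> C) A : C :=
  \sum_(b : {ffun 'I_k -> 'I_n * 'I_n}) c b * \prod_(j < k) cR (A (b j).1 (b j).2).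

Lemma PA_PH : exists c, forall A, psd A -> PA A = PH c A.
Proof.
have [L [kL hL]] := PA_poly_k.
(* The matrix of the linear map from the entries of A to [fts A]; indices past the end give 0,
   matching the default of [nth]. *)
pose tau (i : nat) (p : 'I_n * 'I_n) : R :=
  if onth (enum {: S}) i is Some s then (if s.1 == p then (-1) ^+ s.2 / 4 else 0) else 0.
have tauE A i : nth 0 (fts A) i = \sum_p tau i p * A p.1 p.2.
  rewrite /tau /fts; elim: (enum _) i => [|s ss IH] [|i] /=; rewrite ?IH //.
  - by rewrite big1 // => p _; rewrite mul0r.
  - by rewrite big1 // => p _; rewrite mul0r.
  rewrite (bigD1 s.1) //= eqxx big1 ?addr0 => [|p ps]; last by rewrite eq_sym (negPf ps) mul0r.
  by rewrite /fc; ring.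
exists (fun b => \sum_(cw <- L) cw.1 * \prod_(j < k) cR (tau (nth 0%N cw.2 j) (b j))) => A pA.
rewrite hL // /evL /PH.
under [RHS]eq_bigr do rewrite big_distrl /=.
rewrite exchange_big /= [LHS]big_seq_cond [RHS]big_seq_cond; apply: eq_bigr => cw /andP[cwL _].
have /eqP sz := allP kL _ cwL.
have -> : \prod_(i <- cw.2) cR (nth 0 (fts A) i) =
  \prod_(j < k) \sum_p cR (tau (nth 0%N cw.2 j) p) * cR (A p.1 p.2).
  rewrite (big_nth 0%N) big_mkord sz; apply: eq_bigr => j _.
  rewrite tauE; elim/big_ind2: _ => [//|x1 x2 y1 y2 <- <-|p _]; [by rewrite cRD|by rewrite cRM].
rewrite bigA_distr_bigA big_distrr /=; apply: eq_bigr => b _.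
by rewrite big_split mulrA.
Qed.

End Descent.

(** * The integral formula for quadratic plus trigonometric functions *)

Section Good.
Variables (R : realType) (n k : nat).
Local Notation C := R[i].
Variable Psi : ('rV[R]_n -> R) -> ('rV[R]_n -> C) -> C.
Hypothesis MA : MAVal k Psi.
Variable c : {ffun 'I_k -> 'I_n * 'I_n} -> C.
Hypothesis hc : forall A : 'M[R]_n, psd A -> PA Psi A = PH c A.
Implicit Types (f : 'rV[R]_n -> R) (phi : 'rV[R]_n -> C) (a x : 'rV[R]_n) (A B : 'M[R]_n)
  (H : 'rV[R]_n -> 'M[R]_n).

Lemma PH_polyfun A B : polyfun (fun s => PH c (A + s *: B)).
Proof.
apply: polyfun_sum => b; apply: polyfunM; first exact: polyfun_cst.
apply: polyfun_prod => j.
by case: (polyfun_lin (A (b j).1 (b j).2) (B (b j).1 (b j).2)) => p hp; exists p => s; rewrite -hp !mxE.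
Qed.

(** Inherited from [PA] on psd matrices by two polynomial continuations: in s along A + s * 1, psd
    for large s, and then in t from t >= 0 to all t. *)
Lemma PH_rank1 A a (t : R) : PH c (A + t *: rk a) = PH c A + cR t * (PH c (A + rk a) - PH c A).
Proof.
have p0 (s t' : R) : 0 <= t' -> mxl1 A <= s ->
    PH c (A + s *: 1%:M + t' *: rk a) = PH c (A + s *: 1%:M) +
      cR t' * (PH c (A + s *: 1%:M + rk a) - PH c (A + s *: 1%:M)).
  move=> t0 hs; have pA : psd (A + s *: 1%:M).
    have := @psd_diag R n A (fun=> s) (fun _ => hs); congr psd; congr (_ + _).
    by apply/matrixP => i j; rewrite !mxE; case: eqP; rewrite ?mulr1n ?mulr0n ?mulr1 ?mulr0.
  have pA1 : psd (A + s *: 1%:M + rk a) by rewrite -[rk a]scale1r; exact: psd_add_rk.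
  by rewrite -(hc pA) -(hc pA1) -(hc (psd_add_rk a pA t0)) (PA_rank1 MA).
have p1 (t' : R) : 0 <= t' -> PH c (A + t' *: rk a) = PH c A + cR t' * (PH c (A + rk a) - PH c A).
  move=> t0; apply/eqP; rewrite -subr_eq0; apply/eqP.
  have pf B : polyfun (fun s => PH c (A + s *: 1%:M + B)).
    by case: (PH_polyfun (A + B) 1%:M) => p hp; exists p => s; rewrite -hp addrAC.
  have pf0 := PH_polyfun A 1%:M.
  have := @polyfun_zero R (fun s => PH c (A + s *: 1%:M + t' *: rk a) - (PH c (A + s *: 1%:M) +
      cR t' * (PH c (A + s *: 1%:M + rk a) - PH c (A + s *: 1%:M)))) (mxl1 A).
  move=> /(_ _ _ 0); rewrite scale0r addr0; apply; last by move=> s hs; rewrite p0 // subrr.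
  apply: polyfunB; first exact: pf.
  apply: polyfunD => //; apply: polyfunM; first exact: polyfun_cst.
  by apply: polyfunB => //; exact: pf.
apply/eqP; rewrite -subr_eq0; apply/eqP.
apply: (@polyfun_zero R (fun t => PH c (A + t *: rk a) - (PH c A + cR t * (PH c (A + rk a) - PH c A))) 0).
  apply: polyfunB; first exact: PH_polyfun.
  apply: polyfunD; first exact: polyfun_cst.
  by apply: polyfunM; [exact: polyfun_id|exact: polyfun_cst].
by move=> s s0; rewrite p1 // subrr.
Qed.

Definition mcont H := forall i j, continuous (fun x => H x i j).

Lemma mcont_cst A : mcont (fun=> A).
Proof. by move=> i j; exact: rcont_cst. Qed.
Lemma mcontD H H' : mcont H -> mcont H' -> mcont (fun x => H x + H' x).
Proof.
move=> h h' i j; have -> : (fun x => (H x + H' x) i j) = (fun x => H x i j + H' x i j).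
  by apply: funext => x; rewrite mxE.
exact: rcontD.
Qed.
Lemma mcontZ (g : 'rV[R]_n -> R) H : continuous g -> mcont H -> mcont (fun x => g x *: H x).
Proof.
move=> h h' i j; have -> : (fun x => (g x *: H x) i j) = (fun x => g x * H x i j).
  by apply: funext => x; rewrite mxE.
exact: rcontM.
Qed.

Lemma PH_ccont H : mcont H -> ccont (fun x => PH c (H x)).
Proof.
move=> h; apply: ccont_sum => b _; apply: ccontM; first exact: ccont_cst.
by apply: ccont_prod => j _; apply: ccont_cR; exact: h.
Qed.

Definition IP phi H : C := Iint (fun x => PH c (H x) * phi x).

Lemma IP_Cc phi H : Cc phi -> mcont H -> Cc (fun x => PH c (H x) * phi x).
Proof. by move=> cphi h; apply: CcM => //; exact: PH_ccont. Qed.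

Lemma IP_rank1 phi H a (t : R) : Cc phi -> mcont H ->
  IP phi (fun x => H x + t *: rk a) = IP phi H + cR t * (IP phi (fun x => H x + rk a) - IP phi H).
Proof.
move=> cphi h; have rI := @Iint_cradon R n.
have h1 : mcont (fun x => H x + rk a) by apply: mcontD => //; exact: mcont_cst.
have C0 := IP_Cc cphi h; have C1 := IP_Cc cphi h1.
rewrite /IP -(cradonB rI) // -(cradonZ rI); last exact: CcB.
rewrite -(cradonD rI) //; last by apply: CcZ; exact: CcB.
by congr Iint; apply: funext => x; rewrite PH_rank1; ring.
Qed.

Lemma IP_polyfun phi H a : Cc phi -> mcont H -> polyfun (fun s => IP phi (fun x => H x + s *: rk a)).
Proof.
move=> cphi h.
have := polyfunD (polyfun_cst (IP phi H))
  (polyfunM (polyfun_id R) (polyfun_cst (IP phi (fun x => H x + rk a) - IP phi H))).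
by move=> [p hp]; exists p => s; rewrite -hp IP_rank1.
Qed.

Lemma sumrk_slot aa (ts1 ts2 : seq R) : exists B a, forall s : R, sumrk aa (ts1 ++ s :: ts2) = B + s *: rk a.
Proof.
elim: aa ts1 => [|a aa IH] [|t ts1] /=.
- by exists 0, 0 => s; have -> : rk 0 = 0 :> 'M[R]_n; [apply/matrixP => i j; rewrite !mxE mul0r|rewrite scaler0 addr0].
- by exists 0, 0 => s; have -> : rk 0 = 0 :> 'M[R]_n; [apply/matrixP => i j; rewrite !mxE mul0r|rewrite scaler0 addr0].
- by exists (sumrk aa ts2), a => s; rewrite addrC.
have [B [a' h]] := IH ts1; exists (t *: rk a + B), a' => s; by rewrite h addrA.
Qed.

Lemma sumrk_nseq0 aa m : sumrk aa (nseq m 0) = 0 :> 'M[R]_n.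
Proof. by elim: aa m => [|a aa IH] [|m] //=; rewrite scale0r IH addr0. Qed.

(** By [PH_rank1] the candidate integral is itself affine along rank-one directions, hence an
    admissible g in [descend]. *)
Lemma descend_IP f H aa phi (T : R) : convexR f -> mcont H -> Cc phi -> 0 <= T ->
  (forall ts : seq R, size ts = size aa -> all (fun t : R => T <= t) ts ->
     Psi (fun x => f x + sumq aa ts x) phi = IP phi (fun x => H x + sumrk aa ts)) ->
  Psi f phi = IP phi H.
Proof.
move=> cf mH cphi T0 h.
rewrite (@descend R n k Psi MA f aa phi T (fun ts => IP phi (fun x => H x + sumrk aa ts))) //.
  by rewrite sumrk_nseq0; congr IP; apply: funext => x; rewrite addr0.
move=> ts1 ts2; have [B [a e]] := sumrk_slot aa ts1 ts2.
have mH' : mcont (fun x => H x + B) by apply: mcontD => //; exact: mcont_cst.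
case: (IP_polyfun a cphi mH') => p hp; exists p => s; rewrite -hp e.
by congr IP; apply: funext => x; rewrite addrA.
Qed.

Definition good f H := forall phi, Cc phi -> Psi f phi = IP phi H.

Lemma good_qM A : psd A -> good (qM A) (fun=> A).
Proof.
move=> pA phi cphi; rewrite (Psi_qM MA) // hc // /IP (cradonZ (@Iint_cradon R n)) //.
Qed.

(** [rank_one] reduces the claim to f and f + qd a tested against psi * phi, and [PH_rank1] matches
    this pointwise under the integral. *)
Lemma good_rank1 f H a u du psi m La : convexR f -> mcont H -> good f H ->
  good (fun x => f x + qd a x) (fun x => H x + rk a) -> profile u du psi m La ->
  good (fun x => f x + u (dotR a x)) (fun x => H x + psi (dotR a x) *: rk a).
Proof.
move=> cf mH g0 g1 pr phi cphi; rewrite (@rank_one R n k Psi MA f a cf _ _ _ _ _ _ pr cphi) /=.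
have [h1 h2 h3 h4 h5] := pr.
have cpsi : continuous (fun x => psi (dotR a x)) by apply: cont_ridge; exact: lip_cont h5.
set phi' := fun x => cR (psi (dotR a x)) * phi x.
have cphi' : Cc phi' by apply: CcM => //; exact: ccont_cR.
have mH1 : mcont (fun x => H x + rk a) by apply: mcontD => //; exact: mcont_cst.
have rI := @Iint_cradon R n.
rewrite (g0 _ cphi) (g0 _ cphi') (g1 _ cphi') /IP.
rewrite -(cradonB rI); [|exact: IP_Cc|exact: IP_Cc].
rewrite -(cradonD rI); [|exact: IP_Cc|by apply: CcB; exact: IP_Cc].
by congr Iint; apply: funext => x; rewrite /phi' PH_rank1; ring.
Qed.

Definition tcos (p : R * 'rV[R]_n * R) x : R := p.1.1 * cos (dotR p.1.2 x + p.2).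
Definition trig (l : seq (R * 'rV[R]_n * R)) x : R := \sum_(p <- l) tcos p x.
Definition trigH (l : seq (R * 'rV[R]_n * R)) x : 'M[R]_n := \sum_(p <- l) (- tcos p x) *: rk p.1.2.
Definition tdir (l : seq (R * 'rV[R]_n * R)) := [seq p.1.2 | p <- l].
Definition tamp (l : seq (R * 'rV[R]_n * R)) := [seq `|p.1.1| | p <- l].

Lemma cos_lip (s t : R) : `|cos s - cos t| <= `|s - t|.
Proof.
wlog st : s t / t <= s.
  move=> h; have [|/ltW ts] := leP t s; first exact: h.
  by rewrite distrC (distrC s); exact: h.
have [z _ ->] := @MVTle R cos (fun y : R => - sin y) t s st (fun y : R => @is_derive_cos R y).
rewrite normrM normrN -[leRHS]mul1r; apply: ler_wpM2r => //.
by rewrite ler_norml; rewrite sin_geN1 sin_le1.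
Qed.

(** The amplitude |al| is the least coefficient for which the quadratic outweighs the second
    derivative of the cosine. *)
Lemma profile_cos (al b : R) :
  profile (fun s => al * cos (s + b) + `|al| * (s * s / 2)) (fun s => - (al * sin (s + b)) + `|al| * s)
    (fun s => `|al| - al * cos (s + b)) (2 * `|al|) `|al|.
Proof.
have ab (s : R) : `|al * cos (s + b)| <= `|al|.
  rewrite normrM -[leRHS]mulr1; apply: ler_wpM2l => //.
  by rewrite ler_norml cos_geN1 cos_le1.
have ds (s : R) : is_derive s (1 : R) (fun x : R => x + b) 1.
  by apply: is_derive_eq; rewrite addr0.
have dc (s : R) : is_derive s (1 : R) (fun x : R => cos (x + b)) (- sin (s + b)).
  by have := @is_derive1_comp R cos (fun y => y + b) s _ _ (is_derive_cos _) (ds s); rewrite mulr1; exact.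
have dsn (s : R) : is_derive s (1 : R) (fun x : R => sin (x + b)) (cos (s + b)).
  by have := @is_derive1_comp R sin (fun y => y + b) s _ _ (is_derive_sin _) (ds s); rewrite mulr1; exact.
split => //.
- by move=> s; have i1 := dc s; apply: is_derive_eq; rewrite /= /GRing.scale /=; field.
- by move=> s; have i1 := dsn s; apply: is_derive_eq; rewrite /= /GRing.scale /=; ring.
- by move=> s; have := ab s; rewrite ler_norml => /andP[? ?]; apply/andP; split; lra.
- move=> s t; have -> : `|al| - al * cos (s + b) - (`|al| - al * cos (t + b)) =
    al * (cos (t + b) - cos (s + b)) by ring.
  rewrite normrM; apply: ler_wpM2l => //.
  have -> : s - t = (s + b) - (t + b) by ring.
  by rewrite distrC; exact: cos_lip.
Qed.

Lemma tcos_cont p : continuous (tcos p).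
Proof.
apply: rcontM; first exact: rcont_cst.
apply: (cont_ridge (r := fun s => cos (s + p.2))) => s.
apply: (@continuous_comp _ _ _ (fun s => s + p.2) cos); last exact: continuous_cos.
by apply: cvgD; [exact: cvg_id|exact: cvg_cst].
Qed.

Lemma trigH_mcont l : mcont (trigH l).
Proof.
rewrite /trigH; elim: l => [|p l IH].
  have -> : (fun x => \sum_(p <- [::]) (- tcos p x) *: rk p.1.2) = fun=> 0.
    by apply: funext => x; rewrite big_nil.
  exact: mcont_cst.
have -> : (fun x => \sum_(q <- p :: l) (- tcos q x) *: rk q.1.2) =
   fun x => (- tcos p x) *: rk p.1.2 + \sum_(q <- l) (- tcos q x) *: rk q.1.2.
  by apply: funext => x; rewrite big_cons.
apply: mcontD => //; apply: mcontZ; last exact: mcont_cst.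
have -> : (fun x => - tcos p x) = (fun x => -1 * tcos p x).
  by apply: funext => x; rewrite mulN1r.
by apply: rcontM; [exact: rcont_cst|exact: tcos_cont].
Qed.

(** Quantified over all psd A, because the inductive step also uses the hypothesis at A plus the new
    rank-one matrix. *)
Lemma trig_good_amp l A : psd A ->
  convexR (fun x => qM A x + (trig l x + sumq (tdir l) (tamp l) x)) /\
  good (fun x => qM A x + (trig l x + sumq (tdir l) (tamp l) x))
    (fun x => A + (trigH l x + sumrk (tdir l) (tamp l))).
Proof.
elim: l A => [|p l IH] A pA.
  have -> : (fun x => qM A x + (trig [::] x + sumq (tdir [::]) (tamp [::]) x)) = qM A.
    by apply: funext => x; rewrite /trig big_nil !addr0.
  have -> : (fun x => A + (trigH [::] x + sumrk (tdir [::]) (tamp [::]))) = fun=> A.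
    by apply: funext => x; rewrite /trigH big_nil !addr0.
  by split; [exact: convex_qM|exact: good_qM].
have [cf g0] := IH A pA.
have pA1 : psd (A + 1 *: rk p.1.2) by exact: psd_add_rk.
have [_ g1] := IH _ pA1.
have pr := profile_cos p.1.1 p.2.
have e1 : (fun x => qM A x + (trig (p :: l) x + sumq (tdir (p :: l)) (tamp (p :: l)) x)) =
  fun x => (qM A x + (trig l x + sumq (tdir l) (tamp l) x)) +
    (p.1.1 * cos (dotR p.1.2 x + p.2) + `|p.1.1| * (dotR p.1.2 x * dotR p.1.2 x / 2)).
  apply: funext => x; rewrite /trig big_cons /= /tcos /qd; ring.
have e2 : (fun x => A + (trigH (p :: l) x + sumrk (tdir (p :: l)) (tamp (p :: l)))) =
  fun x => (A + (trigH l x + sumrk (tdir l) (tamp l))) +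
    (`|p.1.1| - p.1.1 * cos (dotR p.1.2 x + p.2)) *: rk p.1.2.
  apply: funext => x; rewrite /trigH big_cons /= /tcos; apply/matrixP => i j; rewrite !mxE; ring.
rewrite e1 e2; split.
  exact: (convex_add_ridge p.1.2 cf (profile_cvx1 pr)).
apply: (good_rank1 (a := p.1.2) cf _ g0 _ pr).
  by apply: mcontD; [exact: mcont_cst|apply: mcontD; [exact: trigH_mcont|exact: mcont_cst]].
move=> phi cphi; have := g1 phi cphi.
have -> : (fun x => A + (trigH l x + sumrk (tdir l) (tamp l)) + rk p.1.2) =
          (fun x => A + 1 *: rk p.1.2 + (trigH l x + sumrk (tdir l) (tamp l))).
  by apply: funext => x; rewrite scale1r addrAC.
move=> <-; congr Psi; apply: funext => x; rewrite qM_add_rk mul1r; ring.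
Qed.

Definition seqsub (s t : seq R) := [seq p.1 - p.2 | p <- zip s t].

Lemma sumq_sub aa ts us x : size ts = size aa -> size us = size aa ->
  sumq aa (seqsub ts us) x = sumq aa ts x - sumq aa us x.
Proof.
elim: aa ts us => [|a aa IH] [|t ts] [|u us] //=; first by rewrite subr0.
by move=> [h1] [h2]; rewrite IH //; ring.
Qed.
Lemma sumrk_sub aa ts us : size ts = size aa -> size us = size aa ->
  sumrk aa (seqsub ts us) = sumrk aa ts - sumrk aa us :> 'M[R]_n.
Proof.
elim: aa ts us => [|a aa IH] [|t ts] [|u us] //=; first by rewrite subr0.
by move=> [h1] [h2]; rewrite IH // scalerBl opprD addrACA.
Qed.

(** Once the sum itself is convex, the convexifying quadratics can be removed: adding coefficients
    ts above all amplitudes amounts to enlarging A by ts minus the amplitudes, and [descend_IP]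
    returns to ts = 0. *)
Lemma trig_good l A : psd A -> convexR (fun x => qM A x + trig l x) ->
  good (fun x => qM A x + trig l x) (fun x => A + trigH l x).
Proof.
move=> pA cf phi cphi.
pose T := \sum_(p <- l) `|p.1.1|.
have T0 : 0 <= T by apply: sumr_ge0.
apply: (@descend_IP _ _ (tdir l) phi T) => //.
  by apply: mcontD; [exact: mcont_cst|exact: trigH_mcont].
move=> ts sz hts.
have sz2 : size (tamp l) = size (tdir l) by rewrite !size_map.
have h0 : all (fun t : R => 0 <= t) (seqsub ts (tamp l)).
  have aT : all (fun t : R => t <= T) (tamp l).
    rewrite /tamp all_map /T; elim: (l) => [//|p l' IH] /=; rewrite big_cons lerDl sumr_ge0 //=.
    by apply: sub_all IH => q /= h; apply: le_trans h _; rewrite lerDr.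
  move: sz sz2 hts aT; elim: (tdir l) ts (tamp l) => [|a aa IH] [|t ts] [|u us] //=.
  move=> [h1] [h2] /andP[k1 k2] /andP[k3 k4].
  by rewrite subr_ge0 (le_trans k3 k1); exact: IH.
have pA' := psd_sumrk (tdir l) pA h0.
have [_ g] := trig_good_amp l pA'; have := g phi cphi.
have -> : (fun x => qM (A + sumrk (tdir l) (seqsub ts (tamp l))) x + (trig l x + sumq (tdir l) (tamp l) x)) =
  (fun x => qM A x + trig l x + sumq (tdir l) ts x).
  by apply: funext => x; rewrite qM_sumrk sumq_sub //; ring.
move=> ->; congr IP; apply: funext => x.
by rewrite sumrk_sub //; apply/matrixP => i j; rewrite !mxE; ring.
Qed.

End Good.

(** * Box averages and their Hessians *)

Section Averages.
Variables (R : realType) (n : nat).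
Implicit Types (f g : 'rV[R]_n -> R) (x y v : 'rV[R]_n) (l : 'I_n) (ls : seq 'I_n).

Lemma line_cont x v : continuous (fun t : R => x + t *: v).
Proof.
apply/continuous_epsP => t e e0; exists (e / (`|v| + 1)); first by rewrite divr_gt0 // ltr_wpDl.
move=> s; rewrite ltr_pdivlMr ?ltr_wpDl // => h.
rewrite opprD addrACA subrr add0r -scalerBl normrZ; apply: le_lt_trans h.
by apply: ler_wpM2l => //; rewrite lerDl.
Qed.

Lemma slice_cont f x v : continuous f -> continuous (fun t : R => f (x + t *: v)).
Proof.
by move=> cf t; apply: (@continuous_comp _ _ _ (fun t : R => x + t *: v) f); [exact: line_cont|exact: cf].
Qed.

Variable eps : R.
Hypothesis eps0 : 0 < eps.

Definition ev l : 'rV[R]_n := eps *: delta_mx 0 l.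
Definition Al l f x : R := lint 0 1 (fun t => f (x + t *: ev l)).

Lemma norm_ev l : `|ev l| <= eps.
Proof.
apply: mx_norm_le => [|i j]; first exact: ltW.
rewrite !mxE; case: (_ && _); rewrite ?mulr0 ?normr0 ?mulr1 ?gtr0_norm //; exact: ltW.
Qed.

Lemma Al_lin l (a : R) f g x : continuous f -> continuous g ->
  Al l (fun y => a * f y + g y) x = a * Al l f x + Al l g x.
Proof. by move=> cf cg; rewrite /Al lint_lin //; [exact: (@slice_cont _ _ _ cf)|exact: (@slice_cont _ _ _ cg)]. Qed.

Lemma Al_cst l (a : R) x : Al l (fun=> a) x = a.
Proof. by rewrite /Al lint_cst // subr0 mul1r. Qed.

Lemma Al_close l f g (S e : R) : continuous f -> continuous g ->
  (forall y, `|y| <= S + eps -> `|f y - g y| <= e) ->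
  forall x, `|x| <= S -> `|Al l f x - Al l g x| <= e.
Proof.
move=> cf cg h x xS.
have -> : Al l f x - Al l g x = Al l (fun y => -1 * g y + f y) x by rewrite Al_lin // mulN1r addrC.
have -> : e = (1 - 0) * e by rewrite subr0 mul1r.
apply: lint_abs => //; first by apply: rcont_lin; [exact: (@slice_cont _ _ _ cg)|exact: (@slice_cont _ _ _ cf)].
move=> t /andP[t0 t1]; rewrite mulN1r addrC; apply: h.
apply: le_trans (ler_normD _ _) _; apply: lerD => //; rewrite normrZ ger0_norm //.
by rewrite -[leRHS]mul1r; apply: ler_pM => //; exact: norm_ev.
Qed.

Lemma Al_cont l f : continuous f -> continuous (Al l f).
Proof.
move=> cf; apply/continuous_epsP => x e e0.
have e2 : 0 < e / 2 by rewrite divr_gt0.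
have [d d0 hd] := compact_unif_cont cf (@compact_cball R n (`|x| + eps)) e2.
exists d => // y xy; apply: (@le_lt_trans _ _ (e / 2)); last lra.
have -> : Al l f x - Al l f y = lint 0 1 (fun t => -1 * f (y + t *: ev l) + f (x + t *: ev l)).
  by rewrite lint_lin; [rewrite mulN1r addrC|exact: (@slice_cont _ _ _ cf)|exact: (@slice_cont _ _ _ cf)].
have -> : e / 2 = (1 - 0) * (e / 2) by rewrite subr0 mul1r.
apply: lint_abs => //; first by apply: rcont_lin; exact: (@slice_cont _ _ _ cf).
move=> t /andP[t0 t1]; rewrite mulN1r addrC; apply: ltW; apply: hd.
  apply: le_trans (ler_normD _ _) _; apply: lerD => //; rewrite normrZ ger0_norm //.
  by rewrite -[leRHS]mul1r; apply: ler_pM => //; exact: norm_ev.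
by rewrite opprD addrACA subrr addr0.
Qed.

Lemma Al_convex l f : continuous f -> convexR f -> convexR (Al l f).
Proof.
move=> cf cx x y t ht.
have sx := @slice_cont _ x (ev l) cf; have sy := @slice_cont _ y (ev l) cf.
have lZ (a : R) (h : R -> R) : continuous h -> lint 0 1 (fun s => a * h s) = a * lint 0 1 h.
  move=> ch; have := @lint_lin R 0 1 a h (fun=> 0) ch (@rcont_cst _ _ _).
  rewrite lint_cst // mulr0 addr0 => <-.
  by congr lint; apply: funext => s; rewrite addr0.
have sy' : continuous (fun s : R => (1 - t) * f (y + s *: ev l)).
  by apply: rcontM => //; exact: rcont_cst.
rewrite /Al -[X in _ <= _ + X]lZ // -lint_lin //.
apply: lint_le; [exact: (@slice_cont _ _ _ cf)|exact: rcont_lin|].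
move=> s _; have := cx (x + s *: ev l) (y + s *: ev l) t ht.
have -> // : t *: (x + s *: ev l) + (1 - t) *: (y + s *: ev l) = t *: x + (1 - t) *: y + s *: ev l.
by apply/rowP => i; rewrite !mxE; ring.
Qed.

Lemma Al_shift l f x y : Al l f (x + y) = Al l (fun z => f (z + y)) x.
Proof. by rewrite /Al; congr lint; apply: funext => t; rewrite addrAC. Qed.

Definition Avg ls f := foldr Al f ls.

Lemma Avg_cont ls f : continuous f -> continuous (Avg ls f).
Proof. by elim: ls => [//|l ls IH] cf; apply: Al_cont; exact: IH. Qed.

Lemma Avg_convex ls f : continuous f -> convexR f -> convexR (Avg ls f).
Proof.
by elim: ls => [//|l ls IH] cf cx; apply: Al_convex; [exact: Avg_cont|exact: IH].
Qed.

Lemma Avg_close ls f g (S e : R) : continuous f -> continuous g ->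
  (forall y, `|y| <= S + (size ls)%:R * eps -> `|f y - g y| <= e) ->
  forall x, `|x| <= S -> `|Avg ls f x - Avg ls g x| <= e.
Proof.
move=> cf cg; elim: ls S => [|l ls IH] S h /=; first by move=> x xS; apply: h; rewrite mul0r addr0.
apply: Al_close; [exact: Avg_cont|exact: Avg_cont|]; apply: IH => y yS; apply: h.
by apply: le_trans yS _; rewrite /= -addn1 natrD mulrDl mul1r; lra.
Qed.

Lemma Avg_cst ls (a : R) : Avg ls (fun=> a) = (fun=> a).
Proof. by elim: ls => [//|l ls /= ->]; apply: funext => x; rewrite Al_cst. Qed.

Lemma Avg_lin ls (a : R) f g : continuous f -> continuous g ->
  Avg ls (fun y => a * f y + g y) = fun x => a * Avg ls f x + Avg ls g x.
Proof.
move=> cf cg; elim: ls => [//|l ls /= ->]; apply: funext => x.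
by rewrite Al_lin //; exact: Avg_cont.
Qed.

Lemma Avg_shift ls f y : (fun x => Avg ls f (x + y)) = Avg ls (fun z => f (z + y)).
Proof.
elim: ls => [//|l ls IH] /=; apply: funext => x; rewrite Al_shift; congr (Al l _ x); exact: IH.
Qed.

Definition Diff l f x : R := (f (x + ev l) - f x) / eps.
Definition rmc l := [seq i <- enum 'I_n | i != l].
Definition SS f := Avg (enum 'I_n ++ enum 'I_n) f.
(** Stands for the Hessian of [SS f] without using derivatives: differentiating an average in its
    own direction leaves a difference quotient. [SS] averages twice in each direction, so that one
    average in i and one in j can be spent even when i = j. *)
Definition Mx f x : 'M[R]_n := \matrix_(i, j) Diff i (Diff j (Avg (rmc i ++ rmc j) f)) x.

Lemma DiffDiff i j f x : Diff i (Diff j f) x =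
  (f (x + ev i + ev j) - f (x + ev i) - f (x + ev j) + f x) / (eps * eps).
Proof. by rewrite /Diff; field; rewrite gt_eqF. Qed.

Lemma add_cont y : continuous (fun x => x + y).
Proof. by apply/continuous_epsP => x e e0; exists e => // z; rewrite opprD addrACA subrr addr0. Qed.

Lemma shift_cont f y : continuous f -> continuous (fun x => f (x + y)).
Proof.
by move=> cf x; apply: (@continuous_comp _ _ _ (fun x => x + y) f); [exact: add_cont|exact: cf].
Qed.

Lemma Diff_cont l f : continuous f -> continuous (Diff l f).
Proof.
move=> cf; have -> : Diff l f = fun x => eps^-1 * f (x + ev l) + (- eps^-1) * f x.
  by apply: funext => x; rewrite /Diff; ring.
apply: rcont_lin; first exact: shift_cont.
by apply: rcontM => //; exact: rcont_cst.
Qed.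

Lemma Mx_mcont f : continuous f -> mcont (Mx f).
Proof.
move=> cf i j; have -> : (fun x => Mx f x i j) = Diff i (Diff j (Avg (rmc i ++ rmc j) f)).
  by apply: funext => x; rewrite mxE.
by do 2 apply: Diff_cont; exact: Avg_cont.
Qed.

Lemma size_rmc i : (size (rmc i) <= n)%N.
Proof. by rewrite size_filter (leq_trans (count_size _ _)) // size_enum_ord. Qed.

(** The key gain of averaging: uniform closeness of functions passes to Hessians, at the cost of the
    four values in a second difference over eps^2. The radius grows by eps for each of at most n + n
    averages and 2 steps. *)
Lemma Mx_close f g (S e : R) : continuous f -> continuous g ->
  (forall y, `|y| <= S + (n + n).+2%:R * eps -> `|f y - g y| <= e) ->
  forall x, `|x| <= S -> forall i j, `|Mx f x i j - Mx g x i j| <= 4 * e / (eps * eps).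
Proof.
move=> cf cg h x xS i j; rewrite !mxE !DiffDiff.
have av z : `|z| <= S + 2 * eps -> `|Avg (rmc i ++ rmc j) f z - Avg (rmc i ++ rmc j) g z| <= e.
  apply: Avg_close => // y yS; apply: h; apply: le_trans yS _.
  have -> : (n + n).+2%:R = (n + n)%:R + 2 :> R by rewrite -addn2 natrD.
  rewrite -addrA lerD2l (mulrDl (n + n)%:R 2) (addrC (2 * eps)) lerD2r.
  apply: ler_wpM2r; first exact: ltW.
  by rewrite ler_nat size_cat leq_add ?size_rmc.
have n1 := norm_ev i; have n2 := norm_ev j.
have e0 := eps0.
have t0 : `|x| <= S + 2 * eps by lra.
have t1 : `|x + ev i| <= S + 2 * eps by have := ler_normD x (ev i); lra.
have t2 : `|x + ev j| <= S + 2 * eps by have := ler_normD x (ev j); lra.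
have t3 : `|x + ev i + ev j| <= S + 2 * eps.
  by have := ler_normD x (ev i); have := ler_normD (x + ev i) (ev j); lra.
have e2 : 0 < eps * eps by rewrite mulr_gt0.
rewrite -mulrBl normrM (gtr0_norm (_ : 0 < (eps * eps)^-1)) ?invr_gt0 //.
apply: ler_wpM2r; first by rewrite invr_ge0 ltW.
have := av _ t0; have := av _ t1; have := av _ t2; have := av _ t3.
set F := Avg _ f; set G := Avg _ g; rewrite !ler_norml.
by move=> /andP[? ?] /andP[? ?] /andP[? ?] /andP[? ?]; apply/andP; split; lra.
Qed.

Lemma SS_convex f : continuous f -> convexR f -> convexR (SS f). Proof. exact: Avg_convex. Qed.
Lemma SS_close f g (S e : R) : continuous f -> continuous g ->
  (forall y, `|y| <= S + (n + n).+2%:R * eps -> `|f y - g y| <= e) ->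
  forall x, `|x| <= S -> `|SS f x - SS g x| <= e.
Proof.
move=> cf cg h; apply: Avg_close => // y yS; apply: h; apply: le_trans yS _.
rewrite lerD2l; apply: ler_wpM2r; first exact: ltW.
by rewrite ler_nat size_cat !size_enum_ord -addn2 leq_addr.
Qed.

End Averages.

(** * Averages of cosines, and convexity of trigonometric perturbations *)

Section CosineAverages.
Variables (R : realType) (n : nat) (eps : R).
Hypothesis eps0 : 0 < eps.
Local Notation mode := (R * 'rV[R]_n * R)%type.
Implicit Types (p : mode) (x y v a : 'rV[R]_n) (l : 'I_n).

(** Averaging a cosine over one step shifts its phase by [hf], half the phase advance, and
    multiplies its amplitude by the sinc factor [sg]. *)
Definition hf a l : R := eps * a 0 l / 2.
Definition sg a l : R := if a 0 l == 0 then 1 else sin (hf a l) / hf a l.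

Lemma dotR_ev a l : dotR a (ev eps l) = eps * a 0 l.
Proof.
rewrite /ev dotRZ; congr (_ * _); rewrite /dotR (bigD1 l) //= big1 ?addr0 => [|j ji].
  by rewrite mxE !eqxx mulr1.
by rewrite mxE (negPf ji) andbF mulr0.
Qed.

Lemma Al_tcos p l : Al eps l (tcos p) = tcos (p.1.1 * sg p.1.2 l, p.1.2, p.2 + hf p.1.2 l).
Proof.
apply: funext => x; rewrite /Al /tcos /=; set a := p.1.2; set th := dotR a x + p.2.
have e t : dotR a (x + t *: ev eps l) + p.2 = th + t * (eps * a 0 l).
  by rewrite dotRD dotRZ dotR_ev /th; ring.
under eq_fun do rewrite e.
have -> : dotR a x + (p.2 + hf a l) = th + hf a l by rewrite /th; ring.
rewrite /sg /hf; case: eqVneq => [->|a0].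
  rewrite !mulr0 mul0r addr0; under eq_fun do rewrite mulr0 addr0.
  by rewrite lint_cst // subr0 mul1r mulr1.
set w := eps * a 0 l; have w0 : w != 0 by rewrite mulf_neq0 // gt_eqF.
have dl (t : R) : is_derive t (1 : R) (fun s : R => th + s * w) w.
  by apply: is_derive_eq; rewrite /= /GRing.scale /=; ring.
have dF (t : R) : is_derive t (1 : R) (fun s : R => (p.1.1 / w) * sin (th + s * w)) (p.1.1 * cos (th + t * w)).
  have i1 := @is_derive1_comp R sin (fun s => th + s * w) t _ _ (is_derive_sin _) (dl t).
  by apply: is_derive_eq; rewrite /= /GRing.scale /=; field.
have cc : continuous (fun t : R => p.1.1 * cos (th + t * w)).
  apply: rcontM; first exact: rcont_cst.
  move=> t; apply: (@continuous_comp R R R (fun s : R => th + s * w) cos); last exact: continuous_cos.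
  by apply: (derive_cont dl).
rewrite (lint_FTC ltr01 cc dF) mul0r addr0 mul1r.
have -> : sin (th + w) = sin (th + w / 2 + w / 2) by congr sin; lra.
have {2}-> : th = th + w / 2 - w / 2 by lra.
rewrite sinD sinB; field; exact: w0.
Qed.

Lemma tcos_eq p q : p.1.1 = q.1.1 -> p.1.2 = q.1.2 -> p.2 = q.2 -> tcos p = tcos q :> ('rV[R]_n -> R).
Proof. by case: p q => [[? ?] ?] [[? ?] ?] /= -> -> ->. Qed.

Lemma Avg_tcos ls p : Avg eps ls (tcos p) =
  tcos (p.1.1 * \prod_(l <- ls) sg p.1.2 l, p.1.2, p.2 + \sum_(l <- ls) hf p.1.2 l).
Proof.
elim: ls => [|l ls IH] /=.
  by apply: tcos_eq; rewrite /= ?big_nil ?mulr1 ?addr0.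
by rewrite IH Al_tcos /=; apply: tcos_eq; rewrite //= big_cons; ring.
Qed.

Lemma Diff_tcos p l : Diff eps l (tcos p) =
  tcos (p.1.1 * (p.1.2 0 l * sg p.1.2 l), p.1.2, p.2 + hf p.1.2 l + pi / 2).
Proof.
apply: funext => x; rewrite /Diff /tcos /=; set a := p.1.2.
rewrite dotRD dotR_ev; set h := hf a l.
have -> : dotR a x + eps * a 0 l + p.2 = dotR a x + p.2 + h + h by rewrite /h /hf; lra.
have -> : dotR a x + (p.2 + h + pi / 2) = dotR a x + p.2 + h + pi / 2 by ring.
have {2}-> : dotR a x + p.2 = dotR a x + p.2 + h - h by ring.
set th := dotR a x + p.2 + h; rewrite cosDpihalf cosD cosB.
rewrite /sg; case: eqVneq => [e|a0].
  have -> : h = 0 by rewrite /h /hf e mulr0 mul0r.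
  by rewrite e sin0 cos0; ring.
have h0 : h != 0.
  by rewrite /h /hf; apply: mulf_neq0; [apply: mulf_neq0 => //; rewrite gt_eqF|rewrite invr_eq0 pnatr_eq0].
rewrite -/h; have -> : a 0 l = 2 * h / eps by rewrite /h /hf; field; rewrite gt_eqF.
by field; rewrite h0 gt_eqF.
Qed.

Definition SSp p : mode := (p.1.1 * \prod_(l <- enum 'I_n ++ enum 'I_n) sg p.1.2 l, p.1.2,
   p.2 + \sum_(l <- enum 'I_n ++ enum 'I_n) hf p.1.2 l).

Lemma SS_tcos p : SS eps (tcos p) = tcos (SSp p).
Proof. exact: Avg_tcos. Qed.

Lemma rmc_sum l (F : 'I_n -> R) : \sum_(i <- rmc l) F i + F l = \sum_(i <- enum 'I_n) F i.
Proof. by rewrite big_filter big_enum_cond big_enum /= [RHS](bigD1 l) //= addrC. Qed.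
Lemma rmc_prod l (F : 'I_n -> R) : \prod_(i <- rmc l) F i * F l = \prod_(i <- enum 'I_n) F i.
Proof. by rewrite big_filter big_enum_cond big_enum /= [RHS](bigD1 l) //= mulrC. Qed.

(** Each difference quotient supplies the missing sinc factor, the frequency and a quarter turn; two
    quarter turns produce the sign of the second derivative of cos. *)
Lemma Mx_tcos p x : Mx eps (tcos p) x = (- tcos (SSp p) x) *: rk p.1.2.
Proof.
apply/matrixP => i j; rewrite !mxE Avg_tcos !Diff_tcos /= /SSp !big_cat /=.
set a := p.1.2; rewrite /tcos /=.
have -> : \sum_(l <- enum 'I_n) hf a l + \sum_(l <- enum 'I_n) hf a l =
  (\sum_(l <- rmc i) hf a l + hf a i) + (\sum_(l <- rmc j) hf a l + hf a j) by rewrite !rmc_sum.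
have -> : \prod_(l <- enum 'I_n) sg a l * \prod_(l <- enum 'I_n) sg a l =
  (\prod_(l <- rmc i) sg a l * sg a i) * (\prod_(l <- rmc j) sg a l * sg a j) by rewrite !rmc_prod.
set X := \sum_(l <- rmc i) hf a l; set Y := \sum_(l <- rmc j) hf a l.
set U := \prod_(l <- rmc i) sg a l; set V := \prod_(l <- rmc j) sg a l.
have -> : dotR a x + (p.2 + (X + Y) + hf a j + pi / 2 + hf a i + pi / 2) =
  dotR a x + (p.2 + (X + hf a i + (Y + hf a j))) + pi by lra.
by rewrite cosDpi; ring.
Qed.

Lemma SS_trig (l : seq mode) : SS eps (trig l) = trig (map SSp l).
Proof.
elim: l => [|p l IH].
  have e0 : trig [::] = (fun=> 0) :> ('rV[R]_n -> R) by apply: funext => x; rewrite /trig big_nil.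
  by rewrite /= e0 /SS Avg_cst.
have e m q : trig (q :: m) = fun x : 'rV[R]_n => 1 * tcos q x + trig m x.
  by apply: funext => x; rewrite /trig big_cons mul1r.
rewrite /= !e /SS Avg_lin -/(SS _ _) -/(SS _ _) ?IH ?SS_tcos //; first exact: tcos_cont.
by apply: rcont_sum => q _; exact: tcos_cont.
Qed.

Lemma trig_cont (l : seq mode) : continuous (trig l).
Proof. by apply: rcont_sum => q _; exact: tcos_cont. Qed.

Lemma Mx_trig (l : seq mode) x : Mx eps (trig l) x = trigH (map SSp l) x.
Proof.
elim: l => [|p l IH].
  have e0 : trig [::] = (fun=> 0) :> ('rV[R]_n -> R) by apply: funext => y; rewrite /trig big_nil.
  rewrite /trigH big_nil; apply/matrixP => i j; rewrite !mxE e0 Avg_cst DiffDiff //; field.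
  by rewrite gt_eqF.
rewrite /trigH /= big_cons -/(trigH _ _) -IH -Mx_tcos; apply/matrixP => i j; rewrite !mxE.
have -> : trig (p :: l) = fun x : 'rV[R]_n => 1 * tcos p x + trig l x.
  by apply: funext => y; rewrite /trig big_cons mul1r.
rewrite Avg_lin; [|by []|exact: tcos_cont|exact: trig_cont].
by rewrite !DiffDiff //; field; rewrite gt_eqF.
Qed.

Lemma convex_line f : (forall y v : 'rV[R]_n, cvx1 (fun s => f (y + s *: v))) -> convexR f.
Proof.
move=> h x y t ht; have := h y (x - y) 1 0 t ht.
have -> : y + 1 *: (x - y) = x by rewrite scale1r addrC subrK.
have -> : y + 0 *: (x - y) = y by rewrite scale0r addr0.
have -> // : y + (t * 1 + (1 - t) * 0) *: (x - y) = t *: x + (1 - t) *: y.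
by apply/rowP => i; rewrite !mxE; ring.
Qed.

Lemma qM_line (A : 'M[R]_n) y v (s : R) :
  qM A (y + s *: v) = qM A y + s * (qM A (y + v) - qM A y - qM A v) + s * s * qM A v.
Proof.
rewrite /qM -!mulrBl !mulrA -!mulrDl; congr (_ / 2).
rewrite -!sumrB !big_distrr -!big_split /=.
by apply: eq_bigr => p _; rewrite !mxE; ring.
Qed.

Lemma qM_trigH (A : 'M[R]_n) (l : seq mode) x v :
  qM (A + trigH l x) v = qM A v + \sum_(p <- l) (- tcos p x) * qd p.1.2 v.
Proof.
rewrite /trigH; elim: l A => [|p l IH] A; first by rewrite !big_nil !addr0.
by rewrite !big_cons addrA IH qM_add_rk addrA.
Qed.

(** Along a line the second derivative is 2 qM (A + trigH) v, the 2 offsetting the 1/2 in [qM]. *)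
Lemma convex_trig (A : 'M[R]_n) (l : seq mode) : (forall x, psd (A + trigH l x)) ->
  convexR (fun x => qM A x + trig l x).
Proof.
move=> h; apply: convex_line => y v.
pose du (s : R) := (qM A (y + v) - qM A y - qM A v) + 2 * s * qM A v +
  \sum_(p <- l) - (p.1.1 * dotR p.1.2 v * sin (dotR p.1.2 y + p.2 + s * dotR p.1.2 v)).
pose psi (s : R) := 2 * qM (A + trigH l (y + s *: v)) v.
have tE p (s : R) : tcos p (y + s *: v) = p.1.1 * cos (dotR p.1.2 y + p.2 + s * dotR p.1.2 v).
  by rewrite /tcos dotRD dotRZ; congr (_ * cos _); ring.
have dl (th w t : R) : is_derive t (1 : R) (fun s : R => th + s * w) w.
  by apply: is_derive_eq; rewrite /= /GRing.scale /=; ring.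
have dc (th w t : R) : is_derive t (1 : R) (fun s : R => cos (th + s * w)) (- sin (th + t * w) * w).
  exact: (@is_derive1_comp R cos (fun s => th + s * w) t _ _ (is_derive_cos _) (dl th w t)).
have ds (th w t : R) : is_derive t (1 : R) (fun s : R => sin (th + s * w)) (cos (th + t * w) * w).
  exact: (@is_derive1_comp R sin (fun s => th + s * w) t _ _ (is_derive_sin _) (dl th w t)).
have dsum (F dF : mode -> R -> R) (t : R) : (forall p, is_derive t (1 : R) (F p) (dF p t)) ->
    forall m : seq mode, is_derive t (1 : R) (fun s => \sum_(p <- m) F p s) (\sum_(p <- m) dF p t).
  move=> hF; elim => [|p l' IH].
    have -> : (fun s : R => \sum_(p <- [::]) F p s) = fun=> 0 by apply: funext => s; rewrite big_nil.
    by rewrite big_nil; exact: is_derive_cst.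
  have -> : (fun s : R => \sum_(q <- p :: l') F q s) = F p \+ (fun s => \sum_(q <- l') F q s).
    by apply: funext => s; rewrite big_cons.
  by rewrite big_cons; exact: is_deriveD.
have D1 (s : R) : is_derive s (1 : R) (fun s => qM A (y + s *: v) + trig l (y + s *: v)) (du s).
  have -> : (fun s => qM A (y + s *: v) + trig l (y + s *: v)) =
    (fun s => qM A y + s * (qM A (y + v) - qM A y - qM A v) + s * s * qM A v) \+
    (fun s => \sum_(p <- l) p.1.1 * cos (dotR p.1.2 y + p.2 + s * dotR p.1.2 v)).
    by apply: funext => r /=; rewrite qM_line; congr (_ + _); apply: eq_bigr => p _; exact: tE.
  apply: is_deriveD; last first.
    apply: (dsum _ (fun p r => - (p.1.1 * dotR p.1.2 v * sin (dotR p.1.2 y + p.2 + r * dotR p.1.2 v)))) => p.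
    have i1 := dc (dotR p.1.2 y + p.2) (dotR p.1.2 v) s.
    by apply: is_derive_eq; rewrite /= /GRing.scale /=; ring.
  by apply: is_derive_eq; rewrite /= /GRing.scale /=; ring.
have D2 (s : R) : is_derive s (1 : R) du (psi s).
  rewrite /psi qM_trigH mulrDr big_distrr /=.
  apply: is_deriveD; first by apply: is_derive_eq; rewrite /= /GRing.scale /=; ring.
  have -> : \sum_(p <- l) 2 * (- tcos p (y + s *: v) * qd p.1.2 v) =
    \sum_(p <- l) - (p.1.1 * dotR p.1.2 v * (cos (dotR p.1.2 y + p.2 + s * dotR p.1.2 v) * dotR p.1.2 v)).
    by apply: eq_bigr => p _; rewrite tE /qd; field.
  by apply: (dsum _ (fun p r => - (p.1.1 * dotR p.1.2 v * (cos (dotR p.1.2 y + p.2 + r * dotR p.1.2 v) * dotR p.1.2 v)))).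
by apply: (cvx1_d2 D1 D2) => s; rewrite /psi mulr_ge0 //; exact: h.
Qed.

End CosineAverages.

(** * Binomial expectations *)

Section BernsteinOperator.
Variable R : realType.

(* expectation of g under the binomial distribution with N trials of parameter s *)
Fixpoint Bern (N : nat) (s : R) (g : nat -> R) : R :=
  if N is N'.+1 then s * Bern N' s (fun m => g m.+1) + (1 - s) * Bern N' s g else g 0%N.

Lemma Bern_lin N s (a : R) g h : Bern N s (fun m => a * g m + h m) = a * Bern N s g + Bern N s h.
Proof. by elim: N g h => [//|N IH] g h /=; rewrite !IH; ring. Qed.
Lemma Bern_cst N s (a : R) : Bern N s (fun=> a) = a.
Proof. by elim: N => [//|N IH] /=; rewrite !IH; ring. Qed.
Lemma Bern_le N s g h : 0 <= s <= 1 -> (forall m, (m <= N)%N -> g m <= h m) -> Bern N s g <= Bern N s h.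
Proof.
move=> /andP[s0 s1]; elim: N g h => [|N IH] g h k /=; first exact: k.
apply: lerD; apply: ler_wpM2l => //; rewrite ?subr_ge0 //; apply: IH => m mN; apply: k => //.
exact: leqW.
Qed.
Lemma Bern_abs N s g (M : R) : 0 <= s <= 1 -> (forall m, (m <= N)%N -> `|g m| <= M) -> `|Bern N s g| <= M.
Proof.
move=> hs k; rewrite ler_norml -(Bern_cst N s (- M)) -[X in _ && (_ <= X)](Bern_cst N s M).
by apply/andP; split; apply: Bern_le => // m /k; rewrite ler_norml => /andP[].
Qed.
(** Squared bias plus variance. The centre c is left free for the induction, in which a success
    replaces c by c - 1. *)
Lemma Bern_moment N s (c : R) : Bern N s (fun m => (m%:R - c) * (m%:R - c)) =
  (N%:R * s - c) * (N%:R * s - c) + N%:R * s * (1 - s).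
Proof.
elim: N c => [|N IH] c /=; first by ring.
rewrite IH.
have -> : (fun m : nat => (m.+1%:R - c) * (m.+1%:R - c)) = fun m => (m%:R - (c - 1)) * (m%:R - (c - 1)).
  by apply: funext => m; rewrite -natr1; ring.
by rewrite IH -natr1; ring.
Qed.

End BernsteinOperator.

Arguments Bern : simpl never.

(** * Bernstein operators with trigonometric values *)

Section TrigApprox.
Variables (R : realType) (n : nat).
Local Notation mode := (R * 'rV[R]_n * R)%type.
Implicit Types (x y z : 'rV[R]_n).

Definition istrig (g : 'rV[R]_n -> R) := exists l : seq mode, forall x, g x = trig l x.

Lemma istrig_cst (a : R) : istrig (fun=> a).
Proof.
exists [:: (a, 0, 0)] => x; rewrite /trig big_seq1 /tcos /=.
have -> : dotR 0 x = 0 by have := dotRZl 0 0 x; rewrite scale0r mul0r.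
by rewrite addr0 cos0 mulr1.
Qed.
Lemma istrigD g h : istrig g -> istrig h -> istrig (fun x => g x + h x).
Proof. by move=> [l hl] [m hm]; exists (l ++ m) => x; rewrite /trig big_cat hl hm. Qed.
Lemma istrigM g h : istrig g -> istrig h -> istrig (fun x => g x * h x).
Proof.
move=> [l hl] [m hm].
pose pr (p q : mode) : seq mode := [:: (p.1.1 * q.1.1 / 2, p.1.2 + q.1.2, p.2 + q.2);
  (p.1.1 * q.1.1 / 2, p.1.2 - q.1.2, p.2 - q.2)].
exists (flatten [seq flatten [seq pr p q | q <- m] | p <- l]) => x.
rewrite hl hm /trig big_flatten big_map big_distrl; apply: eq_bigr => p _ /=.
rewrite big_flatten big_map big_distrr; apply: eq_bigr => q _ /=.
rewrite big_cons big_seq1 /tcos /= !dotRDl.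
have -> : dotR (- q.1.2) x = - dotR q.1.2 x by rewrite -scaleN1r dotRZl mulN1r.
have -> : dotR p.1.2 x + dotR q.1.2 x + (p.2 + q.2) = (dotR p.1.2 x + p.2) + (dotR q.1.2 x + q.2) by ring.
have -> : dotR p.1.2 x - dotR q.1.2 x + (p.2 - q.2) = (dotR p.1.2 x + p.2) - (dotR q.1.2 x + q.2) by ring.
by move: (dotR p.1.2 x + p.2) (dotR q.1.2 x + q.2) => A B; rewrite cosD cosB; field.
Qed.
Lemma istrig_sin (i : 'I_n) (L : R) : istrig (fun x => sin (x 0 i / L)).
Proof.
exists [:: (1, L^-1 *: delta_mx 0 i, - (pi / 2))] => x; rewrite /trig big_seq1 /tcos /= mul1r.
have -> : dotR (L^-1 *: delta_mx 0 i) x = x 0 i / L.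
  rewrite dotRZl mulrC; congr (_ / _); rewrite /dotR (bigD1 i) //= big1 ?addr0 => [|j ji].
    by rewrite mxE !eqxx mul1r.
  by rewrite mxE (negPf ji) andbF mul0r.
by rewrite cosB cos_pihalf sin_pihalf mulr0 mulr1 add0r.
Qed.

Variables (H : 'rV[R]_n -> R) (L : R) (N : nat).
Hypothesis L0 : 0 < L.

(** A success probability that is trigonometric in x; [grid] rescales the number of successes to
    [-L, L], with mean L sin(x_i / L). *)
Definition wt (x : 'rV[R]_n) (i : 'I_n) : R := (1 + sin (x 0 i / L)) / 2.
Definition grid (m : nat) : R := L * (2 * m%:R / N.+1%:R - 1).
Definition setc y (i : 'I_n) (t : R) : 'rV[R]_n := \row_j (if j == i then t else y 0 j).

(** The expectation of H when the coordinates in ls are replaced by independent binomial grid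
    points. It respects every bound of |H|, and it is a polynomial in the [wt x i], hence
    trigonometric in x. *)
Fixpoint Jn (ls : seq 'I_n) x y : R :=
  if ls is i :: ls' then Bern N.+1 (wt x i) (fun m => Jn ls' x (setc y i (grid m))) else H y.

Lemma wt_itv x i : 0 <= wt x i <= 1.
Proof.
rewrite /wt; have := sin_geN1 (x 0 i / L); have := sin_le1 (x 0 i / L) => *.
by apply/andP; split; lra.
Qed.

Lemma istrig_Bern (m : nat) (w : 'rV[R]_n -> R) (G : nat -> 'rV[R]_n -> R) : istrig w ->
  (forall j, istrig (G j)) -> istrig (fun x => Bern m (w x) (fun j => G j x)).
Proof.
move=> tw; elim: m G => [|m IH] G tG; first exact: tG.
rewrite /Bern -/Bern.
apply: istrigD; apply: istrigM.
- by [].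
- by apply: (IH (fun j => G j.+1)) => j; exact: tG.
- case: (istrigD (istrig_cst 1) (istrigM (istrig_cst (-1)) tw)) => l hl.
  by exists l => x; rewrite -hl mulN1r.
- exact: IH.
Qed.

Lemma istrig_Jn ls y : istrig (fun x => Jn ls x y).
Proof.
elim: ls y => [|i ls IH] y /=; first exact: istrig_cst.
apply: (@istrig_Bern N.+1 (fun x => wt x i) (fun m x => Jn ls x (setc y i (grid m)))) => [|m]; last exact: IH.
case: (istrigM (istrigD (istrig_cst 1) (istrig_sin i L)) (istrig_cst (2^-1))) => l hl.
by exists l => x; rewrite -hl.
Qed.

Lemma Jn_abs ls x y (M : R) : (forall z, `|H z| <= M) -> `|Jn ls x y| <= M.
Proof.
move=> hM; elim: ls y => [|i ls IH] y //=.
by apply: Bern_abs => [|m _]; [exact: wt_itv|exact: IH].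
Qed.

Definition ell x : 'rV[R]_n := \row_i (L * sin (x 0 i / L)).

(** Chebyshev's argument: a quadratic modulus of H integrates to variances. A randomized coordinate
    costs at most L^2/(N+1), as w (1 - w) <= 1/4 offsets the factor 4; the other coordinates cost
    their squared distance. *)
Lemma Jn_close ls x y (e K : R) : uniq ls -> 0 <= K ->
  (forall z z', `|H z - H z'| <= e + K * \sum_(i < n) (z 0 i - z' 0 i) * (z 0 i - z' 0 i)) ->
  `|Jn ls x y - H (ell x)| <=
    e + K * (\sum_(i < n | i \notin ls) (y 0 i - ell x 0 i) * (y 0 i - ell x 0 i) +
       (size ls)%:R * (L * L / N.+1%:R)).
Proof.
move=> uls K0 hH; elim: ls uls y => [|i ls IH] /= uls y.
  rewrite mul0r addr0; exact: hH.
have /andP[ils uls'] := uls.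
have N0 : 0 < N.+1%:R :> R by rewrite ltr0n.
pose S' := \sum_(j < n | j \notin i :: ls) (y 0 j - ell x 0 j) * (y 0 j - ell x 0 j).
pose G m := Jn ls x (setc y i (grid m)) - H (ell x).
have -> : Bern N.+1 (wt x i) (fun m => Jn ls x (setc y i (grid m))) - H (ell x) = Bern N.+1 (wt x i) G.
  have -> : G = fun m => 1 * Jn ls x (setc y i (grid m)) + - H (ell x).
    by apply: funext => m; rewrite mul1r.
  by rewrite Bern_lin Bern_cst mul1r.
pose V := fun m : nat => K * ((grid m - ell x 0 i) * (grid m - ell x 0 i)) +
   (e + K * (S' + (size ls)%:R * (L * L / N.+1%:R))).
have GV m : `|G m| <= V m.
  apply: le_trans (IH uls' _) _; rewrite /V.
  have -> : \sum_(j < n | j \notin ls) (setc y i (grid m) 0 j - ell x 0 j) * (setc y i (grid m) 0 j - ell x 0 j)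
     = (grid m - ell x 0 i) * (grid m - ell x 0 i) + S'.
    rewrite (bigD1 i) //=; congr (_ + _); first by rewrite !mxE eqxx.
    rewrite /S'; apply: eq_big => j; first by rewrite in_cons negb_or andbC.
    by move=> /andP[_ ji]; rewrite !mxE (negPf ji).
  by rewrite le_eqVlt; apply/orP; left; apply/eqP; ring.
have BV : Bern N.+1 (wt x i) V <= e + K * (S' + (size ls).+1%:R * (L * L / N.+1%:R)).
  rewrite /V Bern_lin Bern_cst.
  have -> : Bern N.+1 (wt x i) (fun m => (grid m - ell x 0 i) * (grid m - ell x 0 i)) =
    (2 * L / N.+1%:R) * (2 * L / N.+1%:R) * (N.+1%:R * wt x i * (1 - wt x i)).
    pose c := N.+1%:R * wt x i.
    have -> : (fun m => (grid m - ell x 0 i) * (grid m - ell x 0 i)) =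
      fun m => (2 * L / N.+1%:R) * (2 * L / N.+1%:R) * ((m%:R - c) * (m%:R - c)) + 0.
      apply: funext => m; rewrite addr0 /grid /c /wt mxE; field.
      by rewrite gt_eqF.
    by rewrite Bern_lin Bern_cst Bern_moment /c; ring.
  have w14 : wt x i * (1 - wt x i) <= 1 / 4.
    by have := sqr_ge0 (wt x i - 1 / 2); rewrite expr2; lra.
  have LN : 0 <= L * L / N.+1%:R by rewrite divr_ge0 ?mulr_ge0 ?ltW.
  have -> : (2 * L / N.+1%:R) * (2 * L / N.+1%:R) * (N.+1%:R * wt x i * (1 - wt x i)) =
     4 * (L * L / N.+1%:R) * (wt x i * (1 - wt x i)).
    by field; rewrite gt_eqF.
  have h4 : 4 * (L * L / N.+1%:R) * (wt x i * (1 - wt x i)) <= L * L / N.+1%:R.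
    have := ler_wpM2l LN w14; move: (wt x i * _) (L * L / _) => W Y; lra.
  have := ler_wpM2l K0 h4; rewrite -(natr1 (size ls)).
  move: (4 * (L * L / N.+1%:R) * (wt x i * (1 - wt x i))) (L * L / N.+1%:R) => X Y; lra.
apply: le_trans BV; rewrite ler_norml; apply/andP; split.
  have -> : - Bern N.+1 (wt x i) V = Bern N.+1 (wt x i) (fun m => -1 * V m + 0).
    by rewrite (Bern_lin _ _ (-1) V (fun=> 0)) Bern_cst mulN1r addr0.
  apply: Bern_le => [|m _]; first exact: wt_itv.
  by have := GV m; rewrite ler_norml => /andP[h _]; rewrite mulN1r addr0.
apply: Bern_le => [|m _]; first exact: wt_itv.
by have := GV m; rewrite ler_norml => /andP[].
Qed.

End TrigApprox.

(** * Trigonometric density, continuity of convex functions, truncation *)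

Section TrigDensity.
Variables (R : realType) (n : nat).
Implicit Types (x y z : 'rV[R]_n).

Lemma sin_near (t : R) : `|sin t - t| <= t * t.
Proof.
have h (a b : R) : a <= b -> `|(sin b - b) - (sin a - a)| <= Num.max `|a| `|b| * (b - a).
  move=> ab.
  have dF (s : R) : is_derive s (1 : R) (fun s : R => sin s - s) (cos s - 1).
    by apply: is_derive_eq; rewrite /= /GRing.scale /=; ring.
  have [c /andP[c1 c2] ->] := MVTle ab dF.
  have ba : 0 <= b - a by rewrite subr_ge0.
  rewrite normrM (ger0_norm ba); apply: ler_wpM2r => //.
  have := @cos_lip R c 0; rewrite cos0 subr0 => /le_trans; apply.
  rewrite le_max; have [c0|c0] := leP 0 c.
    by apply/orP; right; rewrite !ger0_norm //; exact: le_trans c0 c2.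
  by apply/orP; left; rewrite !ltr0_norm ?lerN2 //; exact: le_lt_trans c1 c0.
have [t0|/ltW t0] := leP 0 t.
  by have := h 0 t t0; rewrite sin0 !subr0 normr0 max_r // (ger0_norm t0).
have := h t 0 t0; rewrite sin0 subrr sub0r normrN normr0 max_l // (ler0_norm t0) sub0r.
by rewrite mulrNN.
Qed.

(** The bound M is kept on the whole space, not just on the ball: it later bounds the averaged
    Hessian everywhere, and so the quadratic that makes the approximants convex. *)
Theorem trig_density (H : 'rV[R]_n -> R) (M : R) : (forall z, `|H z| <= M) ->
  (forall e : R, 0 < e -> exists2 d : R, 0 < d & forall z z', `|z - z'| < d -> `|H z - H z'| <= e) ->
  forall S e : R, 0 < e -> exists l : seq (R * 'rV[R]_n * R),
    (forall x, `|trig l x| <= M) /\ (forall x, `|x| <= S -> `|trig l x - H x| <= e).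
Proof.
move=> HM uc S e e0.
have M0 : 0 <= M by apply: le_trans (HM 0).
have e3 : 0 < e / 3 by rewrite divr_gt0.
have [d d0 hd] := uc _ e3.
have d2 : 0 < d * d by rewrite mulr_gt0.
(* For points at distance at least d, K times the squared distance is at least 2 M, which bounds any
   oscillation of H. *)
pose K := 2 * M / (d * d).
have K0 : 0 <= K by rewrite /K divr_ge0 ?mulr_ge0 // ltW.
have hH z z' : `|H z - H z'| <= e / 3 + K * \sum_(i < n) (z 0 i - z' 0 i) * (z 0 i - z' 0 i).
  have s0 : 0 <= \sum_(i < n) (z 0 i - z' 0 i) * (z 0 i - z' 0 i).
    by apply: sumr_ge0 => i _; rewrite -expr2 sqr_ge0.
  have [h|h] := ltP `|z - z'| d.
    by apply: le_trans (hd _ _ h) _; rewrite lerDl mulr_ge0.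
  have [i hi] : exists i : 'I_n, d <= `|z 0 i - z' 0 i|.
    apply: contrapT => hn; move: h; apply/negP; rewrite -ltNge; apply: mx_norm_lt => // i j.
    rewrite (ord1 i) !mxE ltNge; apply/negP => hj; apply: hn; by exists j.
  have k1 : d * d <= \sum_(i < n) (z 0 i - z' 0 i) * (z 0 i - z' 0 i).
    rewrite (bigD1 i) //=; apply: ler_wpDr.
      by apply: sumr_ge0 => j _; rewrite -expr2 sqr_ge0.
    rewrite -[leRHS]ger0_norm -?expr2 ?sqr_ge0 // normrX !expr2.
    by apply: ler_pM => //; exact: ltW.
  have k2 : `|H z - H z'| <= 2 * M.
    by apply: le_trans (ler_normB _ _) _; have := HM z; have := HM z'; lra.
  apply: le_trans k2 _; have := ler_wpM2l K0 k1.
  have -> : K * (d * d) = 2 * M by rewrite /K; field; rewrite gt_eqF.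
  lra.
(* By [sin_near] the error of L sin(x_j / L) against x_j is at most S^2 / L, which is less than
   d. *)
pose L := (S * S + 1) / d.
have SS0 : 0 <= S * S by rewrite -expr2 sqr_ge0.
have L0 : 0 < L by rewrite divr_gt0 // ltr_wpDl.
pose D := K * (n%:R * (L * L)) / (e / 3).
pose N := Num.truncn D.
have DN : D < N.+1%:R by exact: truncnS_gt.
have [l hl] := istrig_Jn H L N (enum 'I_n) 0.
exists l; split => [x|x xS]; first by rewrite -hl; apply: Jn_abs.
rewrite -hl.
have h1 := @Jn_close R n H L N L0 (enum 'I_n) x 0 (e / 3) K (enum_uniq _) K0 hH.
have h2 : `|H (ell L x) - H x| <= e / 3.
  apply: hd; apply: mx_norm_lt => // i j; rewrite (ord1 i) !mxE.
  set t := x 0 j / L.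
  have -> : L * sin t - x 0 j = L * (sin t - t) by rewrite /t; field; rewrite gt_eqF.
  rewrite normrM (gtr0_norm L0).
  apply: le_lt_trans (ler_wpM2l (ltW L0) (sin_near t)) _.
  have xj : `|x 0 j| <= S by apply: le_trans xS; exact: mx_coord_le.
  have xx : x 0 j * x 0 j <= S * S.
    rewrite -[leLHS]ger0_norm -?expr2 ?sqr_ge0 // normrX !expr2.
    by apply: ler_pM.
  have -> : L * (t * t) = (x 0 j * x 0 j) / L by rewrite /t; field; rewrite gt_eqF.
  rewrite ltr_pdivrMr //; apply: le_lt_trans xx _.
  have -> : d * L = S * S + 1 by rewrite /L; field; rewrite gt_eqF.
  lra.
have h3 : K * (n%:R * (L * L / N.+1%:R)) <= e / 3.
  have N0 : 0 < N.+1%:R :> R by rewrite ltr0n.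
  have -> : K * (n%:R * (L * L / N.+1%:R)) = (K * (n%:R * (L * L))) / N.+1%:R by ring.
  rewrite ler_pdivrMr // (mulrC (e / 3)) -ler_pdivrMr //; exact: ltW DN.
move: h1; rewrite big_pred0; last by move=> i; rewrite mem_enum.
rewrite add0r size_enum_ord => h1.
apply: le_trans (ler_distD (H (ell L x)) _ _) _; apply: le_trans (lerD h1 h2) _.
by move: h3; move: (K * _) => X; lra.
Qed.

(** Upper bounds come first: along an axis by comparison with the points at distance 1, then in all
    coordinates by writing x + y as the midpoint of two doubled displacements. Reflection through x
    turns an upper bound at 2x - y into a lower bound at y. *)
Lemma convex_cont (f : 'rV[R]_n -> R) : convexR f -> continuous f.
Proof.
move=> cf.
have mid x y : f (2^-1 *: (x + y)) <= 2^-1 * f x + 2^-1 * f y.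
  have := cf x y 2^-1; have -> : 1 - 2^-1 = 2^-1 :> R by lra.
  rewrite -scalerDr; apply; apply/andP; split; lra.
have ax x (i : 'I_n) (e : R) : 0 < e -> exists2 d : R, 0 < d & forall s : R, `|s| < d ->
    f (x + s *: delta_mx 0 i) <= f x + e.
  move=> e0; pose u : 'rV[R]_n := delta_mx 0 i.
  pose D := `|f (x + u) - f x| + `|f (x - u) - f x| + 1.
  have D0 : 0 < D by rewrite ltr_wpDl // addr_ge0.
  exists (Num.min 1 (e / D)); first by rewrite lt_min ltr01 divr_gt0.
  move=> s; rewrite lt_min ltr_pdivlMr // => /andP[s1 s2].
  have sgn (w : 'rV[R]_n) (r : R) : 0 <= r <= 1 -> f (x + r *: w) <= f x + r * `|f (x + w) - f x|.
    move=> hr; have := cf (x + w) x r hr; case/andP: hr => r0 r1.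
    have -> : r *: (x + w) + (1 - r) *: x = x + r *: w by apply/rowP => j; rewrite !mxE; ring.
    have := ler_wpM2l r0 (ler_norm (f (x + w) - f x)); lra.
  have fin (r q : R) : 0 <= r -> r * D < e -> 0 <= q <= D -> r * q <= e.
    by move=> r0 rD /andP[q0 qD]; apply: le_trans (ltW rD); exact: ler_wpM2l.
  have [s0|s0] := leP 0 s.
    apply: le_trans (sgn u s _) _; first by rewrite s0 -(ger0_norm s0) ltW.
    rewrite lerD2l; apply: fin => //; first by rewrite -(ger0_norm s0).
    by rewrite normr_ge0 /D -addrA lerDl addr_ge0.
  have -> : s *: delta_mx 0 i = (- s) *: (- u) by rewrite scalerN scaleNr opprK.
  apply: le_trans (sgn (- u) (- s) _) _; first by rewrite oppr_ge0 ltW //= -(ltr0_norm s0) ltW.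
  rewrite lerD2l; apply: fin; rewrite ?oppr_ge0 ?(ltW s0) -?(ltr0_norm s0) //.
  by rewrite normr_ge0 /= /D; have := normr_ge0 (f (x + u) - f x); lra.
have up x (ls : seq 'I_n) : uniq ls -> forall e : R, 0 < e -> exists2 d : R, 0 < d & forall y,
    (forall i, i \notin ls -> y 0 i = 0) -> `|y| < d -> f (x + y) <= f x + e.
  elim: ls => [|i ls IH] /= uls e e0.
    exists 1 => // y hy _; have -> : y = 0 by apply/rowP => j; rewrite hy // mxE.
    by rewrite addr0 lerDl ltW.
  case/andP: uls => ils uls.
  have [d d0 hd] := IH uls e e0; have [d' d0' hd'] := ax x i e e0.
  exists (Num.min d d' / 2); first by rewrite divr_gt0 // lt_min d0.
  move=> y hy; rewrite ltr_pdivlMr // lt_min => /andP[y1 y2].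
  pose y' : 'rV[R]_n := \row_j (if j == i then 0 else y 0 j).
  have -> : x + y = 2^-1 *: ((x + 2 *: y') + (x + (2 * y 0 i) *: delta_mx 0 i)).
    by apply/rowP => j; rewrite !mxE; case: (eqVneq j i) => [->|ji]; rewrite ?eqxx /=; field.
  have k1 : f (x + 2 *: y') <= f x + e.
    apply: hd => [j jls|]; last first.
      rewrite normrZ ger0_norm // mulrC; apply: le_lt_trans y1; apply: ler_wpM2r => //.
      apply: mx_norm_le => // a b; rewrite (ord1 a) !mxE; case: eqP => _; first by rewrite normr0.
      exact: mx_coord_le.
    rewrite !mxE; case: eqP => [_|/eqP ji]; rewrite ?mulr0 // hy ?mulr0 //.
    by rewrite in_cons negb_or ji.
  have k2 : f (x + (2 * y 0 i) *: delta_mx 0 i) <= f x + e.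
    apply: hd'; rewrite normrM ger0_norm // mulrC; apply: le_lt_trans y2; apply: ler_wpM2r => //.
    exact: mx_coord_le.
  apply: le_trans (mid _ _) _; lra.
apply/continuous_epsP => x e e0; have e2 : 0 < e / 2 by rewrite divr_gt0.
have [d d0 hd] := up x (enum 'I_n) (enum_uniq _) _ e2.
exists d => // y xy.
have k1 : f y <= f x + e / 2.
  have -> : y = x + (y - x) by rewrite addrC subrK.
  by apply: hd; [move=> i; rewrite mem_enum|rewrite distrC].
have k2 : f (x + (x - y)) <= f x + e / 2 by apply: hd => // i; rewrite mem_enum.
have := mid y (x + (x - y)); have -> : 2^-1 *: (y + (x + (x - y))) = x.
  by apply/rowP => i; rewrite !mxE; field.
by move=> k3; rewrite ltr_norml; apply/andP; split; lra.
Qed.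

Definition clampv (B : R) x : 'rV[R]_n := \row_i clamp B (x 0 i).

Lemma clampv_norm (B : R) x : 0 < B -> `|clampv B x| <= B.
Proof.
move=> B0; apply: mx_norm_le => [|i j]; first exact: ltW.
by rewrite mxE ler_norml; exact: clamp_itv.
Qed.
Lemma clampv_id (B : R) x : `|x| <= B -> clampv B x = x.
Proof.
move=> xB; apply/rowP => i; rewrite mxE clamp_id //; apply: le_trans xB; exact: mx_coord_le.
Qed.
Lemma clampv_lip (B : R) x y : 0 < B -> `|clampv B x - clampv B y| <= `|x - y|.
Proof.
move=> B0; apply: mx_norm_le => // i j; rewrite (ord1 i) !mxE; apply: le_trans (clamp_lip _ _ B0) _.
by have := mx_coord_le (x - y) 0 j; rewrite !mxE.
Qed.

(** Truncation supplies the bound and the uniform continuity that [trig_density] asks for. It may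
    destroy convexity, which a large quadratic restores after averaging. *)
Lemma clampv_comp (f : 'rV[R]_n -> R) (B : R) : 0 < B -> continuous f ->
  exists M : R, [/\ 0 <= M, forall z, `|f (clampv B z)| <= M, continuous (fun z => f (clampv B z)) &
  forall e : R, 0 < e -> exists2 d : R, 0 < d &
    forall z z', `|z - z'| < d -> `|f (clampv B z) - f (clampv B z')| <= e].
Proof.
move=> B0 cf; have [M M0 hM] := ccont_bounded (ccont_cR cf) (@compact_cball R n B).
have uc (e : R) : 0 < e -> exists2 d : R, 0 < d &
    forall z z', `|z - z'| < d -> `|f (clampv B z) - f (clampv B z')| < e.
  move=> e0; have [d d0 hd] := compact_unif_cont cf (@compact_cball R n B) e0.
  exists d => // z z' zz; apply: hd; first exact: clampv_norm.
  by apply: le_lt_trans zz; exact: clampv_lip.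
exists M; split; first exact: ltW.
- by move=> z; have := hM (clampv B z) (clampv_norm z B0); rewrite nC_cR.
- by apply/continuous_epsP => x e /uc[d d0 hd]; exists d => // y; exact: hd.
- by move=> e /uc[d d0 hd]; exists d => // z z' /hd /ltW.
Qed.

End TrigDensity.

(** * The formula for box averages of arbitrary convex functions *)

Section Averaged.
Variables (R : realType) (n k : nat).
Local Notation C := R[i].
Variable Psi : ('rV[R]_n -> R) -> ('rV[R]_n -> C) -> C.
Hypothesis MA : MAVal k Psi.
Variable c : {ffun 'I_k -> 'I_n * 'I_n} -> C.
Hypothesis hc : forall A : 'M[R]_n, psd A -> PA Psi A = PH c A.
Implicit Types (f : 'rV[R]_n -> R) (phi : 'rV[R]_n -> C) (x : 'rV[R]_n) (A : 'M[R]_n)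
  (H : 'rV[R]_n -> 'M[R]_n).

Lemma mcont_continuous H : mcont H -> continuous H.
Proof.
move=> mH; apply/continuous_epsP => x e e0.
have : forall p : 'I_n * 'I_n, exists d : R, 0 < d /\ forall y, `|x - y| < d -> `|H x p.1 p.2 - H y p.1 p.2| < e.
  move=> p; have [d d0 hd] := (continuous_epsP _).1 (mH p.1 p.2) x e e0; by exists d.
move=> /choice[d hd].
exists (\big[Num.min/1]_p d p).
  elim/big_ind: _ => [|a b a0 b0|p _]; [by []|by rewrite lt_min a0|by case: (hd p)].
move=> y xy; apply: mx_norm_lt => // i j; rewrite !mxE.
have [_ h] := hd (i, j); apply: h; apply: lt_le_trans xy _; exact: bigmin_le.
Qed.

Lemma PH_unif (K : set 'M[R]_n) (e : R) : compact K -> 0 < e ->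
  exists2 d : R, 0 < d & forall A B, K A -> `|A - B| < d -> nC (PH c A - PH c B) < e.
Proof.
move=> cK e0; have e2 : 0 < e / 2 by rewrite divr_gt0.
have [c1 c2] : ccont (fun A : 'M[R]_n => PH c A).
  apply: ccont_sum => b _; apply: ccontM; first exact: ccont_cst.
  by apply: ccont_prod => j _; apply: ccont_cR; exact: coord_continuous.
have [d1 d10 h1] := compact_unif_cont c1 cK e2; have [d2 d20 h2] := compact_unif_cont c2 cK e2.
exists (Num.min d1 d2); first by rewrite lt_min d10.
move=> A B KA; rewrite lt_min => /andP[/(h1 _ _ KA) k1 /(h2 _ _ KA) k2].
rewrite /nC reC_D imC_D reC_N imC_N; lra.
Qed.

Lemma IP_lim (Hj : nat -> 'rV[R]_n -> 'M[R]_n) H phi (B : R) : Cc phi ->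
  (forall j, mcont (Hj j)) -> mcont H -> (forall x, B < `|x| -> phi x = 0) ->
  (forall e : R, 0 < e -> exists N, forall j, (N <= j)%N -> forall x, `|x| <= B ->
     forall i i', `|Hj j x i i' - H x i i'| <= e) ->
  clim (fun j => IP c phi (Hj j)) (IP c phi H).
Proof.
move=> cphi mj mH pB h.
apply: (@cradon_clim R n _ (@Iint_cradon R n) _ _ B).
- by move=> j; exact: IP_Cc.
- exact: IP_Cc.
- by move=> j x /pB ->; rewrite mulr0.
- by move=> x /pB ->; rewrite mulr0.
move=> e e0; have [M M0 hM] := Cc_bounded cphi.
have cK := continuous_compact (continuous_subspaceT (mcont_continuous mH)) (@compact_cball R n B).
have [d d0 hd] := PH_unif cK (divr_gt0 e0 M0).
have [N hN] := h (d / 2) (divr_gt0 d0 (ltr0n _ 2)).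
exists N => j /hN hj x xB; rewrite -mulrBl; apply: le_trans (nC_M _ _) _.
have k1 : nC (PH c (Hj j x) - PH c (H x)) < e / M.
  rewrite nC_B; apply: hd; first by exists x.
  rewrite distrC; apply: (@le_lt_trans _ _ (d / 2)); last lra.
  apply: mx_norm_le => [|i i']; first by rewrite divr_ge0 // ltW.
  by rewrite !mxE; exact: hj.
have -> : e = e / M * M by field; rewrite gt_eqF.
by apply: ler_pM; [exact: nC_ge0|exact: nC_ge0|exact: ltW|exact: hM].
Qed.

Lemma IP_ext H H' phi : (forall x, phi x != 0 -> H x = H' x) -> IP c phi H = IP c phi H'.
Proof.
move=> h; congr Iint; apply: funext => x; have [->|/h -> //] := eqVneq (phi x) 0.
by rewrite !mulr0.
Qed.

Lemma convex_lim (F : nat -> 'rV[R]_n -> R) f : (forall j, convexR (F j)) ->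
  (forall x (e : R), 0 < e -> exists N, forall j, (N <= j)%N -> `|F j x - f x| <= e) -> convexR f.
Proof.
move=> cF h x y t ht; apply/ler_addgt0Pr => e e0.
have e4 : 0 < e / 4 by rewrite divr_gt0.
have [N1 h1] := h x _ e4; have [N2 h2] := h y _ e4.
have [N3 h3] := h (t *: x + (1 - t) *: y) _ e4.
pose j := maxn N1 (maxn N2 N3).
have := h1 j (leq_maxl _ _); have := h2 j; have := h3 j.
rewrite /j !leq_max !leqnn !orbT => /(_ isT) k3 /(_ isT) k2 k1.
have := cF j x y t ht; case/andP: ht => l0 l1.
move: k1 k2 k3; rewrite !ler_norml -/j => /andP[a1 a2] /andP[b1 b2] /andP[c1 c2] cv.
have l1' : 0 <= 1 - t by lra.
have m1 := ler_wpM2l l0 a2; have m2 := ler_wpM2l l1' b2.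
lra.
Qed.

Definition axes : seq 'rV[R]_n := [seq delta_mx 0 i | i <- enum 'I_n].

Lemma sumrk_axes (ts : seq R) : size ts = n -> sumrk axes ts = diag_mx (\row_(i < n) nth 0 ts i).
Proof.
move=> sz.
have tsE : ts = [seq nth 0 ts (nat_of_ord i) | i <- enum 'I_n].
  apply: (@eq_from_nth _ 0); first by rewrite size_map size_enum_ord.
  move=> i; rewrite sz => ilt; rewrite (nth_map (Ordinal ilt)) ?size_enum_ord //.
  by rewrite nth_enum_ord.
have mapE (s : seq 'I_n) : sumrk [seq delta_mx 0 i | i <- s] [seq nth 0 ts (nat_of_ord i) | i <- s] =
    \sum_(i <- s) nth 0 ts i *: rk (delta_mx 0 i).
  by elim: s => [|i s IH] /=; rewrite ?big_nil // big_cons IH.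
rewrite {1}tsE mapE big_enum /=; apply/matrixP => i j; rewrite summxE !mxE.
rewrite (bigD1 i) //= big1 ?addr0 => [|l li]; last first.
  by rewrite !mxE /= eq_sym (negPf li) mul0r mulr0.
by rewrite !mxE !eqxx /= mul1r (eq_sym j); case: eqP => _; rewrite ?mulr1 ?mulr0 ?mulr1n ?mulr0n.
Qed.

(** The trigonometric approximants of the truncated f are not convex, but the Hessians of their
    averages have entries at most 4 M / eps^2, so one diagonal D convexifies all of them. Then
    [trig_good] applies, the formula passes to the limit, locality puts f back in place of its
    truncation, and [descend_IP] along the axes removes D. *)
Theorem Psi_SS f phi (eps : R) : 0 < eps -> convexR f -> Cc phi ->
  Psi (SS eps f) phi = IP c phi (Mx eps f).
Proof.
move=> eps0 cvf cphi; have cf := convex_cont cvf.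
have /CcP[_ _ [B B0 pB]] := cphi.
pose q := (n + n).+2%:R * eps.
have q0 : 0 <= q by rewrite mulr_ge0 ?ler0n // ltW.
(* The 1 is the margin of [Psi_loc_ball], and q is the reach of the averages and difference
   steps. *)
pose Rc := B + 1 + q.
have Rc0 : 0 < Rc by rewrite /Rc; lra.
have [M [M0 hM cH uH]] := clampv_comp Rc0 cf.
pose Hc z := f (clampv Rc z).
have HcE z : `|z| <= Rc -> Hc z = f z by move=> zR; rewrite /Hc clampv_id.
have SScvx : convexR (SS eps f) by exact: SS_convex.
(* A bound for [mxl1] of the averaged Hessians: n^2 entries of size at most 4 M / eps^2. *)
pose T := (n * n)%:R * (4 * M / (eps * eps)).
have T0 : 0 <= T by rewrite mulr_ge0 ?ler0n // divr_ge0 ?mulr_ge0 // ltW.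
apply: (@descend_IP R n k Psi MA c hc (SS eps f) (Mx eps f) axes phi T) => //; first exact: Mx_mcont.
move=> ts; rewrite size_map size_enum_ord => sz hts.
rewrite sumrk_axes //; set D := diag_mx _.
have tT i : T <= (fun i : 'I_n => nth 0 ts i) i by move/(all_nthP 0): hts; apply; rewrite sz.
have pD A : mxl1 A <= T -> psd (A + D) by move=> hA; apply: psd_diag => i; exact: le_trans (tT i).
have sq x : sumq axes ts x = qM D x.
  by have := qM_sumrk 0 axes ts x; rewrite qM0 !add0r sumrk_axes.
rewrite (funext (fun x => congr1 (fun r => SS eps f x + r) (sq x))).
have pD0 : psd D.
  by rewrite -[D]add0r; apply: pD; rewrite /mxl1 big1 // => p _; rewrite mxE normr0.
have [l hl] : exists l : nat -> seq (R * 'rV[R]_n * R), forall j,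
    (forall x, `|trig (l j) x| <= M) /\ (forall x, `|x| <= j%:R -> `|trig (l j) x - Hc x| <= j.+1%:R^-1).
  have ex (j : nat) : exists lj : seq (R * 'rV[R]_n * R),
    (forall x, `|trig lj x| <= M) /\ (forall x, `|x| <= j%:R -> `|trig lj x - Hc x| <= j.+1%:R^-1).
    by apply: (trig_density hM uH); rewrite invr_gt0 ltr0n.
  by have [l hl] := choice ex; exists l.
have close (S e : R) : 0 < e -> exists N, forall j, (N <= j)%N ->
    forall y, `|y| <= S -> `|trig (l j) y - Hc y| <= e.
  move=> e0; exists (maxn (Num.truncn S).+1 (Num.truncn e^-1).+1) => j.
  rewrite geq_max => /andP[j1 j2] y yS.
  apply: le_trans ((hl j).2 y _) _.
    apply: le_trans yS _; apply: ltW; apply: lt_le_trans (truncnS_gt S) _; by rewrite ler_nat.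
  rewrite -[e]invrK lef_pV2 ?posrE ?invr_gt0 ?ltr0n //; apply: ltW; apply: lt_le_trans (truncnS_gt _) _.
  by rewrite ler_nat; exact: leq_trans j2 (leqnSn j).
pose E j x := qM D x + trig (map (SSp eps) (l j)) x.
have EE j x : E j x = qM D x + SS eps (trig (l j)) x by rewrite /E SS_trig.
have Mb j x : mxl1 (trigH (map (SSp eps) (l j)) x) <= T.
  rewrite -Mx_trig // /mxl1 /T.
  have -> : (n * n)%:R * (4 * M / (eps * eps)) = \sum_(p : 'I_n * 'I_n) (4 * M / (eps * eps)).
    by rewrite sumr_const card_prod card_ord mulr_natl.
  apply: ler_sum => p _.
  have := @Mx_close R n eps eps0 (trig (l j)) (fun=> 0) `|x| M (@trig_cont R n (l j)) (@rcont_cst R _ 0) _ x (lexx _) p.1 p.2.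
  have -> : Mx eps (fun=> 0) x p.1 p.2 = 0.
    by rewrite mxE Avg_cst // DiffDiff //; field; rewrite gt_eqF.
  rewrite subr0; apply => y _; rewrite subr0; exact: (hl j).1.
have cE j : convexR (E j).
  by apply: convex_trig => x; rewrite addrC; apply: pD.
have gE j : Psi (E j) phi = IP c phi (fun x => D + Mx eps (trig (l j)) x).
  rewrite (trig_good MA hc pD0 (cE j) cphi); congr IP; apply: funext => x.
  by rewrite Mx_trig.
have Econv (S e : R) : 0 < e -> exists N, forall j, (N <= j)%N ->
    forall x, `|x| <= S -> `|E j x - (qM D x + SS eps Hc x)| <= e.
  move=> e0; have [N hN] := close (S + q) e e0; exists N => j /hN hj x xS.
  rewrite EE opprD addrACA subrr add0r; apply: (SS_close eps0 _ cH _ xS) => //.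
  exact: trig_cont.
have cL : convexR (fun x => qM D x + SS eps Hc x).
  by apply: (convex_lim cE) => x e e0; have [N hN] := Econv `|x| e e0; exists N => j /hN; apply.
have lim1 : clim (fun j => Psi (E j) phi) (Psi (fun x => qM D x + SS eps Hc x) phi).
  apply: (Psi_cont MA) => // S e e0; have [N hN] := Econv S (e / 2) (divr_gt0 e0 (ltr0n _ 2)).
  by exists N => j /hN hj x /hj h; apply: le_lt_trans h _; lra.
have lim2 : clim (fun j => Psi (E j) phi) (IP c phi (fun x => D + Mx eps Hc x)).
  rewrite (funext gE); apply: (IP_lim cphi (B := B)) => //.
  - by move=> j; apply: mcontD; [exact: mcont_cst|apply: Mx_mcont => //; exact: trig_cont].
  - by apply: mcontD; [exact: mcont_cst|exact: Mx_mcont].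
  move=> e e0; have ee : 0 < e * (eps * eps) / 4 by rewrite divr_gt0 // !mulr_gt0.
  have [N hN] := close (B + q) _ ee; exists N => j /hN hj x xB i i'.
  rewrite [(D + _) i i']mxE [X in _ - X]mxE opprD addrACA subrr add0r.
  apply: le_trans (Mx_close eps0 (@trig_cont R n (l j)) cH hj xB i i') _.
  by rewrite le_eqVlt; apply/orP; left; apply/eqP; field; rewrite gt_eqF.
have key := clim_unique lim1 lim2.
have sE x : `|x| < B + 1 -> SS eps Hc x = SS eps f x.
  move=> /ltW xB; apply/eqP; rewrite -subr_eq0 -normr_le0.
  apply: (SS_close eps0 cH cf _ xB) => y yB; by rewrite -/(Hc y) HcE // subrr normr0.
have mE x : `|x| <= B -> Mx eps Hc x = Mx eps f x.
  move=> xB; apply/matrixP => i j; apply/eqP; rewrite -subr_eq0 -normr_le0.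
  have -> : 0 = 4 * 0 / (eps * eps) :> R by rewrite mulr0 mul0r.
  apply: (Mx_close eps0 cH cf _ xB) => y yB; rewrite -/(Hc y) HcE ?subrr ?normr0 //.
  by apply: le_trans yB _; rewrite /Rc -/q; lra.
rewrite (@Psi_loc_ball R n k Psi MA _ (fun x => qM D x + SS eps Hc x) B) //.
- rewrite key; apply: IP_ext => x hx; rewrite addrC mE // leNgt; apply: contra_neqN hx; exact: pB.
- by apply: convexD => //; exact: convex_qM.
- by move=> x /sE ->; rewrite addrC.
Qed.

End Averaged.

(** * Derivatives along lines *)

Section LineDerivative.
Variables (R : realType) (V : normedModType R).

Lemma is_derive_line (F : V -> R) (y v : V) (s : R) : derivable F (y + s *: v) v ->
  is_derive s (1 : R) (fun t : R => F (y + t *: v)) (derive F (y + s *: v) v).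
Proof.
move=> dF.
have e : (fun h : R => h^-1 *: (((fun t : R => F (y + t *: v)) \o shift s) (h *: (1 : R)) - F (y + s *: v))) =
         (fun h : R => h^-1 *: ((F \o shift (y + s *: v)) (h *: v) - F (y + s *: v))).
  apply: funext => h /=; congr (_ *: (F _ - _)).
  by rewrite [h *: 1]mulr1 scalerDl addrCA addrA.
by split; rewrite /derivable /derive e.
Qed.

End LineDerivative.

(** * The formula for smooth functions, and the vanishing criterion *)

Section SmoothCase.
Variables (R : realType) (n : nat).
Implicit Types (f g : 'rV[R]_n -> R) (x y : 'rV[R]_n).

Definition D2 f x : 'M[R]_n := \matrix_(i, j) Defs.iterD [:: delta_mx 0 i; delta_mx 0 j] f x.

(** The mean value theorem twice: in direction j for the difference taken in direction i, then in
    direction i for the partial derivative so obtained. *)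
Lemma second_difference f y (i j : 'I_n) (eps : R) : 0 < eps -> smooth f ->
  exists2 z, `|z - y| <= 2 * eps & Diff eps i (Diff eps j f) y = D2 f z i j.
Proof.
move=> eps0 sf; rewrite DiffDiff //; set ei := ev eps i; set ej := ev eps j.
pose ui : 'rV[R]_n := delta_mx 0 i; pose uj : 'rV[R]_n := delta_mx 0 j.
have lin (F : 'rV[R]_n -> R) w v (s : R) : (forall a v, derivable F a v) ->
   is_derive s (1 : R) (fun t : R => F (w + t *: v)) (derive F (w + s *: v) v).
  by move=> h; exact: is_derive_line.
have d0 : forall a v, derivable f a v := (sf [::]).2.
have d1 : forall a v, derivable (fun a => derive f a uj) a v := (sf [:: uj]).2.
have dh (t : R) : is_derive t (1 : R) (fun t : R => f (y + ei + t *: uj) - f (y + t *: uj))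
    (derive f (y + ei + t *: uj) uj - derive f (y + t *: uj) uj).
  by apply: is_deriveB; exact: lin.
have [t /andP[t0 t1] e1] := MVTle (ltW eps0) dh.
have dk (s : R) : is_derive s (1 : R) (fun s : R => derive f (y + t *: uj + s *: ui) uj)
    (derive (fun a => derive f a uj) (y + t *: uj + s *: ui) ui).
  exact: (lin (fun a => derive f a uj)).
have [s /andP[s0 s1] e2] := MVTle (ltW eps0) dk.
exists (y + t *: uj + s *: ui).
  have nd (l : 'I_n) (r : R) : 0 <= r <= eps -> `|r *: (delta_mx 0 l : 'rV[R]_n)| <= eps.
    move=> /andP[r0 r1]; apply: mx_norm_le => [|a b]; first exact: ltW.
    by rewrite !mxE; case: (_ && _); rewrite ?mulr0 ?normr0 ?mulr1 ?ger0_norm // ltW.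
  have -> : y + t *: uj + s *: ui - y = t *: uj + s *: ui.
    by apply/rowP => l; rewrite !mxE; ring.
  have h1 := nd j t _; have h2 := nd i s _.
  apply: le_trans (ler_normD _ _) _.
  have := h1; rewrite t0 t1 => /(_ isT) k1; have := h2; rewrite s0 s1 => /(_ isT) k2.
  by rewrite -/ui -/uj in k1 k2 *; lra.
rewrite mxE /= -/ui -/uj.
have ee : eps *: uj = ej by [].
have ei' : eps *: ui = ei by [].
move: e1; rewrite !subr0 !scale0r !addr0 ee => e1.
have -> : f (y + ei + ej) - f (y + ei) - f (y + ej) + f y = f (y + ei + ej) - f (y + ej) - (f (y + ei) - f y) by ring.
rewrite e1; move: e2; rewrite subr0 scale0r addr0 ei' (addrAC y (t *: uj)) => ->.
by field; rewrite gt_eqF.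
Qed.

Lemma Avg_DD (eps : R) (ls : seq 'I_n) f (i j : 'I_n) x : 0 < eps -> continuous f ->
  Diff eps i (Diff eps j (Avg eps ls f)) x = Avg eps ls (fun z => Diff eps i (Diff eps j f) (z + x)) 0.
Proof.
move=> eps0 cf; rewrite DiffDiff //.
have cs y := @shift_cont R n f y cf.
have sh y : Avg eps ls f y = Avg eps ls (fun z => f (z + y)) 0.
  by have := congr1 (fun g => g 0) (Avg_shift eps ls f y); rewrite /= add0r.
pose q := (eps * eps)^-1.
have -> : (fun z => Diff eps i (Diff eps j f) (z + x)) = (fun z =>
   q * f (z + (x + ev eps i + ev eps j)) + ((- q) * f (z + (x + ev eps i)) +
   ((- q) * f (z + (x + ev eps j)) + (q * f (z + x) + 0)))).
  by apply: funext => z; rewrite DiffDiff // !addrA /q; ring.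
have c0 : continuous (fun _ : 'rV[R]_n => 0 : R) by exact: rcont_cst.
have l1 := @rcont_lin R _ q _ _ (cs x) c0.
have l2 := @rcont_lin R _ (- q) _ _ (cs (x + ev eps j)) l1.
have l3 := @rcont_lin R _ (- q) _ _ (cs (x + ev eps i)) l2.
rewrite !Avg_lin // Avg_cst // !sh /q; ring.
Qed.

(** By [Avg_DD] an entry of [Mx] averages second differences, each a value of [D2 f] nearby. The
    factor q = 2n + 2 bounds the displacement: 2n from the averages and 2 from
    [second_difference]. *)
Lemma Mx_cvg f (B e : R) : smooth f -> 0 < e -> exists2 d : R, 0 < d &
  forall eps, 0 < eps -> eps < d -> forall x, `|x| <= B -> forall i j, `|Mx eps f x i j - D2 f x i j| <= e.
Proof.
move=> sf e0; have cf : continuous f := (sf [::]).1.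
have cD i j : continuous (fun x => D2 f x i j).
  have -> : (fun x => D2 f x i j) = Defs.iterD [:: delta_mx 0 i; delta_mx 0 j] f.
    by apply: funext => x; rewrite mxE.
  exact: (sf _).1.
have : forall p : 'I_n * 'I_n, exists d : R, 0 < d /\
    forall x y, `|x| <= B -> `|x - y| < d -> `|D2 f x p.1 p.2 - D2 f y p.1 p.2| < e.
  move=> p; have [d d0 hd] := compact_unif_cont (cD p.1 p.2) (@compact_cball R n B) e0.
  by exists d.
move=> /choice[d hd].
pose dm := \big[Num.min/1]_p d p.
have dm0 : 0 < dm.
  by rewrite /dm; elim/big_ind: _ => [|a b a0 b0|p _]; [by []|by rewrite lt_min a0|by case: (hd p)].
pose q : R := (n + n).+2%:R.
have q0 : 0 < q by rewrite ltr0n.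
exists (dm / q); first by rewrite divr_gt0.
move=> eps eps0; rewrite ltr_pdivlMr // mulrC => hq x xB i j; rewrite mxE Avg_DD //.
rewrite -[X in _ - X](_ : Avg eps (rmc i ++ rmc j) (fun=> D2 f x i j) 0 = _); last by rewrite Avg_cst.
apply: (Avg_close eps0 (S := 0)); [|exact: rcont_cst| |by rewrite normr0].
  apply: (@shift_cont R n (Diff eps i (Diff eps j f)) x); by do 2 apply: Diff_cont.
move=> z; rewrite add0r => zS.
have [w hw ->] := second_difference (z + x) i j eps0 sf.
rewrite distrC; apply: ltW; have [_ h] := hd (i, j); apply: h => //.
apply: lt_le_trans (_ : dm <= _); last exact: bigmin_le.
apply: le_lt_trans hq; rewrite distrC.
have -> : w - x = (w - (z + x)) + z by apply/rowP => l; rewrite !mxE; ring.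
apply: le_trans (ler_normD _ _) _.
have : (size (rmc i ++ rmc j))%:R * eps <= (n + n)%:R * eps.
  apply: ler_wpM2r; first exact: ltW.
  by rewrite ler_nat size_cat leq_add ?size_rmc.
have -> : q = (n + n)%:R + 2 by rewrite /q -addn2 natrD.
rewrite (mulrDl (n + n)%:R 2); lra.
Qed.

Lemma SS_cvg f (S e : R) : continuous f -> 0 < e -> exists2 d : R, 0 < d &
  forall eps, 0 < eps -> eps < d -> forall x, `|x| <= S -> `|SS eps f x - f x| <= e.
Proof.
move=> cf e0; have [d d0 hd] := compact_unif_cont cf (@compact_cball R n S) e0.
pose q : R := (n + n).+2%:R.
have q0 : 0 < q by rewrite ltr0n.
exists (d / q); first by rewrite divr_gt0.
move=> eps eps0; rewrite ltr_pdivlMr // mulrC => hq x xS.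
have sh : SS eps f x = SS eps (fun z => f (z + x)) 0.
  by have := congr1 (fun g => g 0) (Avg_shift eps (enum 'I_n ++ enum 'I_n) f x); rewrite /= add0r.
have ce : SS eps (fun _ : 'rV[R]_n => f x) 0 = f x by rewrite /SS Avg_cst.
rewrite sh -[X in _ - X]ce.
apply: (@SS_close R n eps eps0 (fun z => f (z + x)) (fun=> f x) 0 e); [exact: shift_cont|exact: rcont_cst| |by rewrite normr0].
move=> z; rewrite add0r => zS; rewrite distrC; apply: ltW; apply: hd => //.
by rewrite opprD addrCA subrr addr0 normrN; exact: le_lt_trans hq.
Qed.

Lemma smooth_cont f : smooth f -> continuous f.
Proof. by move=> sf; exact: (sf [::]).1. Qed.

Lemma D2_mcont f : smooth f -> mcont (D2 f).
Proof.
move=> sf i j.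
have -> : (fun x => D2 f x i j) = Defs.iterD [:: delta_mx 0 i; delta_mx 0 j] f.
  by apply: funext => x; rewrite mxE.
exact: (sf _).1.
Qed.

Variable k : nat.
Local Notation C := R[i].
Variable Psi : ('rV[R]_n -> R) -> ('rV[R]_n -> C) -> C.
Hypothesis MA : MAVal k Psi.
Variable c : {ffun 'I_k -> 'I_n * 'I_n} -> C.
Hypothesis hc : forall A : 'M[R]_n, psd A -> PA Psi A = PH c A.

Lemma inv_small (d : R) : 0 < d -> exists N, forall j, (N <= j)%N -> j.+1%:R^-1 < d.
Proof.
move=> d0; exists (Num.truncn d^-1).+1 => j hj.
rewrite -[d]invrK ltf_pV2 ?posrE ?invr_gt0 ?ltr0n //.
by apply: lt_le_trans (truncnS_gt _) _; rewrite ler_nat; exact: leq_trans hj (leqnSn j).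
Qed.

Lemma Psi_SS_lim f phi : convexR f -> Cc phi ->
  clim (fun j => Psi (SS (j.+1%:R^-1) f) phi) (Psi f phi).
Proof.
move=> cvf cphi; have cf := convex_cont cvf.
have e0 (j : nat) : 0 < j.+1%:R^-1 :> R by rewrite invr_gt0 ltr0n.
apply: (Psi_cont MA) => //; first by move=> j; exact: SS_convex.
move=> S e ee; have [d d0 hd] := SS_cvg S cf (divr_gt0 ee (ltr0n _ 2)).
have [N hN] := inv_small d0; exists N => j /hN hj x /(hd _ (e0 j) hj) h.
by apply: le_lt_trans h _; lra.
Qed.

Theorem Psi_smooth f phi : convexR f -> smooth f -> Cc phi -> Psi f phi = IP c phi (D2 f).
Proof.
move=> cvf sf cphi; apply: (clim_unique (Psi_SS_lim cvf cphi)).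
have e0 (j : nat) : 0 < j.+1%:R^-1 :> R by rewrite invr_gt0 ltr0n.
have /CcP[_ _ [B B0 pB]] := cphi.
rewrite (funext (fun j => Psi_SS MA hc (e0 j) cvf cphi)).
apply: (IP_lim c cphi (B := B)) => //.
- by move=> j; apply: Mx_mcont => //; exact: smooth_cont.
- exact: D2_mcont.
move=> e ee; have [d d0 hd] := Mx_cvg B sf ee.
by have [N hN] := inv_small d0; exists N => j /hN hj x xB i i'; exact: hd.
Qed.

(** [Psi_SS] holds for averages of every convex f, smooth or not, and these averages converge to
    f. *)
Lemma Psi_zero : (forall A, PH c A = 0) -> forall f, convexR f -> forall phi, Cc phi -> Psi f phi = 0.
Proof.
move=> h f cvf phi cphi; apply: (clim_unique (Psi_SS_lim cvf cphi)).
apply: (clim_ext _ (@clim_cst R 0)) => j.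
have e0 : 0 < j.+1%:R^-1 :> R by rewrite invr_gt0 ltr0n.
rewrite (Psi_SS MA hc e0 cvf cphi).
have -> : IP c phi (Mx j.+1%:R^-1 f) = Iint (fun _ : 'rV[R]_n => 0).
  by congr Iint; apply: funext => x; rewrite h mul0r.
by rewrite (cradon0 (@Iint_cradon R n)).
Qed.

End SmoothCase.

(** * Closure properties of smooth functions *)

Section SmoothCalculus.
Variables (R : realType) (V : normedModType R).
Implicit Types (f g : V -> R) (a v : V).

Lemma is_derive_of_line f a v (d : R) :
  is_derive (0 : R) (1 : R) (fun t : R => f (a + t *: v)) d -> is_derive a v f d.
Proof.
move=> [dl dd].
have e : (fun h : R => h^-1 *: (((fun t : R => f (a + t *: v)) \o shift 0) (h *: (1 : R)) - f (a + 0 *: v))) =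
         (fun h : R => h^-1 *: ((f \o shift a) (h *: v) - f a)).
  apply: funext => h /=; rewrite scale0r !addr0 [h *: 1]mulr1; congr (_ *: (f _ - _)).
  by rewrite addrC.
move: dl dd; rewrite /derivable /derive e => dl dd.
by split.
Qed.

Lemma is_derive_line0 f a v : derivable f a v ->
  is_derive (0 : R) (1 : R) (fun t : R => f (a + t *: v)) (derive f a v).
Proof.
by move=> h; have := @is_derive_line R V f a v 0; rewrite scale0r addr0 => /(_ h).
Qed.

(** [smooth] concerns all iterated derivatives, which makes products and compositions awkward to
    treat directly. This generated class is stable under directional derivatives ([sm_step]) and its
    members are continuous and derivable, hence smooth. *)
Inductive sm : (V -> R) -> Prop :=
| sm_base f : smooth f -> sm f
| sm_cst (c : R) : sm (fun=> c)
| sm_lin f : continuous f -> (forall a (t : R) v, f (a + t *: v) = f a + t * f v) -> sm f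
| sm_add f g : sm f -> sm g -> sm (fun x => f x + g x)
| sm_mul f g : sm f -> sm g -> sm (fun x => f x * g x)
| sm_exp f : sm f -> sm (fun x => expR (f x))
| sm_cos f : sm f -> sm (fun x => cos (f x))
| sm_sin f : sm f -> sm (fun x => sin (f x)).

Lemma smooth_derive f v : smooth f -> smooth (fun a => derive f a v).
Proof. by move=> sf vs; have := sf (vs ++ [:: v]); rewrite /Defs.iterD foldr_cat. Qed.

Lemma cont_comp1 (h : R -> R) f : continuous h -> continuous f -> continuous (fun x => h (f x)).
Proof. by move=> ch cf x; apply: (@continuous_comp _ _ _ f h); [exact: cf|exact: ch]. Qed.

Lemma sm_step f : sm f -> [/\ continuous f, forall a v, derivable f a v &
  forall v, sm (fun a => derive f a v)].
Proof.
have mk (g : V -> R) (dg : V -> V -> R) : continuous g ->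
    (forall a v, is_derive (0 : R) (1 : R) (fun t : R => g (a + t *: v)) (dg a v) /\ True) ->
    (forall v, sm (fun a => dg a v)) -> [/\ continuous g, forall a v, derivable g a v &
  forall v, sm (fun a => derive g a v)].
  move=> cg h' k; have h a v := is_derive_of_line (h' a v).1.
  split; [by []|by move=> a v; case: (h a v)|move=> v].
  have -> : (fun a => derive g a v) = (fun a => dg a v); last exact: k.
  by apply: funext => a; case: (h a v).
elim=> {f} [f sf|c|f cf lf|f g _ [cf df sf] _ [cg dg sg]|f g smf [cf df sf] smg [cg dg sg]|f smf [cf df sf]|f smf [cf df sf]|f smf [cf df sf]].
- split; [exact: (sf [::]).1|exact: (sf [::]).2|].
  by move=> v; apply: sm_base; exact: smooth_derive.
- apply: (mk _ (fun _ _ => 0)); [exact: rcont_cst| |by move=> v; exact: sm_cst].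
  by move=> a v; split => //; exact: is_derive_cst.
- apply: (mk _ (fun _ v => f v)); [by []| |by move=> v; exact: sm_cst].
  move=> a v; split => //; rewrite (funext (fun t => lf a t v)).
  by apply: is_derive_eq; rewrite /= /GRing.scale /=; ring.
- apply: (mk _ (fun a v => derive f a v + derive g a v)); [exact: rcontD| |by move=> v; exact: sm_add].
  move=> a v; split => //.
  exact: is_deriveD (is_derive_line0 (df a v)) (is_derive_line0 (dg a v)).
- apply: (mk _ (fun a v => f a * derive g a v + g a * derive f a v)); [exact: rcontM| |].
    move=> a v; split => //.
    have := is_deriveM (is_derive_line0 (df a v)) (is_derive_line0 (dg a v)).
    by rewrite scale0r addr0.
  by move=> v; apply: sm_add; apply: sm_mul.
- apply: (mk _ (fun a v => expR (f a) * derive f a v)).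
  + by apply: cont_comp1 => //; exact: continuous_expR.
  + move=> a v; split => //.
    have := @is_derive1_comp R expR (fun t => f (a + t *: v)) 0 _ _ (is_derive_expR _) (is_derive_line0 (df a v)).
    by rewrite scale0r addr0.
  + by move=> v; apply: sm_mul; [exact: sm_exp|exact: sf].
- apply: (mk _ (fun a v => (-1 * sin (f a)) * derive f a v)).
  + by apply: cont_comp1 => //; exact: continuous_cos.
  + move=> a v; split => //.
    have := @is_derive1_comp R cos (fun t => f (a + t *: v)) 0 _ _ (is_derive_cos _) (is_derive_line0 (df a v)).
    by rewrite scale0r addr0 mulN1r.
  + by move=> v; apply: sm_mul; [apply: sm_mul; [exact: sm_cst|exact: sm_sin]|exact: sf].
- apply: (mk _ (fun a v => cos (f a) * derive f a v)).
  + by apply: cont_comp1 => //; exact: continuous_sin.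
  + move=> a v; split => //.
    have := @is_derive1_comp R sin (fun t => f (a + t *: v)) 0 _ _ (is_derive_sin _) (is_derive_line0 (df a v)).
    by rewrite scale0r addr0.
  + by move=> v; apply: sm_mul; [exact: sm_cos|exact: sf].
Qed.

Lemma sm_smooth f : sm f -> smooth f.
Proof.
move=> sf vs; have h : sm (Defs.iterD vs f).
  by elim: vs => [//|v vs IH] /=; case: (sm_step IH) => _ _ k; exact: k.
by case: (sm_step h).
Qed.

Lemma sm_sum I (r : seq I) (P : pred I) (F : I -> V -> R) : (forall i, P i -> sm (F i)) ->
  sm (fun x => \sum_(i <- r | P i) F i x).
Proof.
move=> h; elim: r => [|i r IH].
  have -> : (fun x => \sum_(i <- [::] | P i) F i x) = fun=> 0 by apply: funext => x; rewrite big_nil.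
  exact: sm_cst.
have -> : (fun x => \sum_(j <- i :: r | P j) F j x) =
  fun x => if P i then F i x + \sum_(j <- r | P j) F j x else \sum_(j <- r | P j) F j x.
  by apply: funext => x; rewrite big_cons.
by have := h i; case: (P i) => // hi; apply: sm_add => //; exact: hi.
Qed.

Lemma sm_prod I (r : seq I) (F : I -> V -> R) : (forall i, sm (F i)) ->
  sm (fun x => \prod_(i <- r) F i x).
Proof.
move=> h; elim: r => [|i r IH].
  have -> : (fun x => \prod_(i <- [::]) F i x) = fun=> 1 by apply: funext => x; rewrite big_nil.
  exact: sm_cst.
have -> : (fun x => \prod_(j <- i :: r) F j x) = fun x => F i x * \prod_(j <- r) F j x.
  by apply: funext => x; rewrite big_cons.
by apply: sm_mul.
Qed.

Lemma iterD_lin (vs : seq V) (t : R) f g : smooth f -> smooth g ->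
  Defs.iterD vs (fun x => t * f x + g x) = fun x => t * Defs.iterD vs f x + Defs.iterD vs g x.
Proof.
move=> sf sg; elim: vs => [//|v vs IH] /=; rewrite IH; apply: funext => a.
have i1 := is_derive_line0 ((sf vs).2 a v); have i2 := is_derive_line0 ((sg vs).2 a v).
have : is_derive a v (fun x => t * Defs.iterD vs f x + Defs.iterD vs g x)
   (t * derive (Defs.iterD vs f) a v + derive (Defs.iterD vs g) a v).
  apply: is_derive_of_line; apply: is_derive_eq; rewrite /= /GRing.scale /=; ring.
by case.
Qed.

Lemma iterD_sum (vs : seq V) I (r : seq I) (P : pred I) (F : I -> V -> R) : (forall i, smooth (F i)) ->
  Defs.iterD vs (fun x => \sum_(i <- r | P i) F i x) = fun x => \sum_(i <- r | P i) Defs.iterD vs (F i) x.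
Proof.
move=> h.
have z : Defs.iterD vs (fun=> 0) = (fun=> 0 : R).
  have s0 : smooth (fun _ : V => 0 : R) by apply: sm_smooth; exact: sm_cst.
  have := @iterD_lin vs (-1) _ _ s0 s0.
  have -> : (fun _ : V => -1 * 0 + 0 : R) = fun=> 0 by apply: funext => x; rewrite mulr0 addr0.
  by move=> ->; apply: funext => x; rewrite mulN1r addrC subrr.
elim: r => [|i r IH].
  have -> : (fun x => \sum_(i <- [::] | P i) F i x) = fun=> 0 by apply: funext => x; rewrite big_nil.
  by rewrite z; apply: funext => x; rewrite big_nil.
have [Pi|Pi] := boolP (P i); last first.
  have -> : (fun x => \sum_(j <- i :: r | P j) F j x) = fun x => \sum_(j <- r | P j) F j x.
    by apply: funext => x; rewrite big_cons (negPf Pi).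
  by rewrite IH; apply: funext => x; rewrite big_cons (negPf Pi).
have -> : (fun x => \sum_(j <- i :: r | P j) F j x) = fun x => 1 * F i x + \sum_(j <- r | P j) F j x.
  by apply: funext => x; rewrite big_cons Pi mul1r.
rewrite iterD_lin //; last by apply: sm_smooth; apply: sm_sum => j _; exact: sm_base.
by rewrite IH; apply: funext => x; rewrite big_cons Pi mul1r.
Qed.

End SmoothCalculus.

(** * Linear changes of variable *)

Section LinearSubstitution.
Variables (R : realType) (V W : normedModType R) (L : V -> W).
Hypothesis Llin : forall (h : R) v a, L (h *: v + a) = h *: L v + L a.
Hypothesis Lcont : continuous L.

Lemma iterD_comp (vs : seq V) (f : W -> R) :
  Defs.iterD vs (fun x => f (L x)) = fun x => Defs.iterD (map L vs) f (L x).
Proof.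
elim: vs => [//|v vs IH] /=; rewrite IH; apply: funext => a.
rewrite /derive; set F := (fun h : R => _); set G := (fun h : R => _).
have -> // : F = G.
by apply: funext => h; rewrite /F /G /= Llin.
Qed.

Lemma smooth_comp_lin (f : W -> R) : smooth f -> smooth (fun x => f (L x)).
Proof.
move=> sf vs; rewrite iterD_comp; have [h1 h2] := sf (map L vs); split.
  by move=> x; apply: (@continuous_comp _ _ _ L (Defs.iterD (map L vs) f)); [exact: Lcont|exact: h1].
move=> a v; have := h2 (L a) (L v); rewrite /derivable.
set F := (fun h : R => _); set G := (fun h : R => _).
have -> // : F = G.
by apply: funext => h; rewrite /F /G /= Llin.
Qed.
End LinearSubstitution.

(** * Inclusion-exclusion for polarization *)

Section AlternatingSum.
Local Open Scope set_scope.
Variables (F : comNzRingType) (k : nat).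

(** For an i outside D, the sets S and i |: S cancel in pairs. *)
Lemma alt_sum_superset (D : {set 'I_k}) :
  \sum_(S : {set 'I_k} | D \subset S) (-1) ^+ (k - #|S|) = (D == [set: 'I_k])%:R :> F.
Proof.
have [->|DT] := eqVneq D [set: 'I_k].
  rewrite (bigD1 [set: 'I_k]) //= big1 ?addr0 => [|S /andP[]]; first by rewrite cardsT card_ord subnn.
  by rewrite finset.subTset => ->.
have [i iD] : exists i, i \notin D.
  apply/existsP; rewrite -negb_forall; apply: contra DT => /forallP h.
  by rewrite -finset.subTset; apply/fintype.subsetP => j _; exact: h.
rewrite (bigID (fun S : {set 'I_k} => i \in S)) /=.
rewrite (reindex_onto (fun S : {set 'I_k} => i |: S) (fun S => S :\ i)) /=; last first.
  by move=> S /andP[_ iS]; rewrite finset.setD1K.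
rewrite -[X in _ + X]opprK -sumrN; apply/eqP; rewrite subr_eq0; apply/eqP.
apply: eq_big => S.
  rewrite finset.setU11 andbT; apply/andP/andP => [[h1 /eqP h2]|[h1 h2]].
    have iS : i \notin S by rewrite -h2 finset.setD11.
    split => //; apply/fintype.subsetP => j jD; have := fintype.subsetP h1 j jD; rewrite finset.in_setU1.
    by case: eqP => // ji; move: iD; rewrite -ji jD.
  by split; [apply: fintype.subset_trans h1 (finset.subsetU1 _ _)|rewrite finset.setU1K].
move=> /andP[_ /eqP h2].
have iS : i \notin S by rewrite -h2 finset.setD11.
have cS : (#|S| < k)%N.
  by have := max_card (mem (i |: S)); rewrite cardsU1 iS card_ord add1n.
by rewrite cardsU1 iS add1n -(subnSK cS) exprS mulN1r opprK.
Qed.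

(** Ryser's formula for the permanent. The product expands over maps g with image in S; the
    alternating sum keeps the surjective ones, which are the permutations. *)
Lemma alt_sum_prod (x : 'I_k -> 'I_k -> F) :
  \sum_(S : {set 'I_k}) (-1) ^+ (k - #|S|) * \prod_(j < k) \sum_(i in S) x j i =
  \sum_(s : 'S_k) \prod_(j < k) x j (s j).
Proof.
have e1 (S : {set 'I_k}) : \prod_(j < k) \sum_(i in S) x j i =
  \sum_(g : {ffun 'I_k -> 'I_k}) (if g @: [set: 'I_k] \subset S then \prod_(j < k) x j (g j) else 0).
  under eq_bigr do rewrite big_mkcond.
  rewrite bigA_distr_bigA; apply: eq_bigr => g _.
  case: ifP => h.
    apply: eq_bigr => j _; rewrite ifT //; apply: (fintype.subsetP h); exact: imset_f.
  have [j jS] : exists j, g j \notin S.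
    apply/existsP; rewrite -negb_forall; apply/negP => /forallP k'; move/negP: h; apply.
    by apply/fintype.subsetP => y /imsetP[j _ ->].
  by rewrite (bigD1 j) //= (negPf jS) mul0r.
under eq_bigr do rewrite e1 big_distrr /=.
rewrite exchange_big /=.
have e2 (g : {ffun 'I_k -> 'I_k}) :
  \sum_(S : {set 'I_k}) (-1) ^+ (k - #|S|) * (if g @: [set: 'I_k] \subset S then \prod_(j < k) x j (g j) else 0) =
  if g @: [set: 'I_k] == [set: 'I_k] then \prod_(j < k) x j (g j) else 0.
  have := alt_sum_superset (g @: [set: 'I_k]); rewrite big_mkcond => h.
  transitivity ((g @: [set: 'I_k] == [set: 'I_k])%:R * \prod_(j < k) x j (g j)).
    rewrite -h big_distrl; apply: eq_bigr => S _ /=.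
    by case: ifP; rewrite ?mulr0 ?mul0r.
  by case: ifP; rewrite ?mul1r ?mul0r.
under eq_bigr do rewrite e2.
rewrite -big_mkcond /= (reindex_onto (fun s : 'S_k => [ffun j => s j])
   (fun g => if [pick s : 'S_k | [forall j, s j == g j]] is Some s then s else 1%g)) /=; last first.
  move=> g /eqP gT; have gi : injective g.
    have : #|g @: [set: 'I_k]| == #|[set: 'I_k]| by rewrite gT.
    by move/imset_injP => h a b ab; apply: h; rewrite ?finset.inE.
  case: pickP => [s /forallP hs|/(_ (perm gi))].
    by apply/ffunP => j; rewrite ffunE; apply/eqP.
  by move/negbT/forallPn => [j]; rewrite permE eqxx.
apply: eq_big => s; last by move=> _; apply: eq_bigr => j _; rewrite ffunE.
apply/andP; split.
  rewrite -finset.subTset; apply/fintype.subsetP => j _; apply/imsetP; exists (s^-1%g j); [by rewrite finset.inE|by rewrite ffunE permKV].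
case: pickP => [s' /forallP hs|/(_ s)]; last first.
  by move/negbT/forallPn => [j]; rewrite ffunE eqxx.
by apply/eqP/permP => j; have /eqP := hs j; rewrite ffunE.
Qed.

End AlternatingSum.

(** * Polarization of the integral formula *)

Section Polarization.
Variables (R : realType) (n k : nat).
Local Notation C := R[i].
Variable c : {ffun 'I_k -> 'I_n * 'I_n} -> C.

(** This is k! times the symmetric multilinear form that polarizes [PH c]; the factor 1/k! stays
    with [polar]. *)
Definition PBil (A : 'I_k -> 'M[R]_n) : C :=
  \sum_(b : {ffun 'I_k -> 'I_n * 'I_n}) \sum_(s : 'S_k)
    c b * \prod_(j < k) cR (A (s j) (b j).1 (b j).2).

Lemma cR_sum I (r : seq I) (P : pred I) (x : I -> R) :
  cR (\sum_(i <- r | P i) x i) = \sum_(i <- r | P i) cR (x i).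
Proof. by elim/big_ind2: _ => [//|x1 x2 y1 y2 <- <-|//]; rewrite cRD. Qed.
Lemma cR_prod I (r : seq I) (P : pred I) (x : I -> R) :
  cR (\prod_(i <- r | P i) x i) = \prod_(i <- r | P i) cR (x i).
Proof. by elim/big_ind2: _ => [//|x1 x2 y1 y2 <- <-|//]; rewrite cRM. Qed.

Lemma alt_PH (A : 'I_k -> 'M[R]_n) :
  \sum_(S : {set 'I_k}) (-1) ^+ (k - #|S|) * PH c (\sum_(i in S) A i) = PBil A.
Proof.
rewrite /PH; under eq_bigr do rewrite big_distrr /=.
rewrite exchange_big; apply: eq_bigr => b _ /=.
rewrite -big_distrr -(alt_sum_prod (fun j i => cR (A i (b j).1 (b j).2))) big_distrr; apply: eq_bigr => S _ /=.
rewrite mulrCA; congr (_ * (_ * _)); apply: eq_bigr => j _.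
by rewrite summxE cR_sum.
Qed.

Variable Psi : ('rV[R]_n -> R) -> ('rV[R]_n -> C) -> C.
Hypothesis MA : MAVal k Psi.
Hypothesis hc : forall A : 'M[R]_n, psd A -> PA Psi A = PH c A.

Lemma convex_sum (I : Type) (r : seq I) (P : pred I) (fs : I -> 'rV[R]_n -> R) :
  (forall i, convexR (fs i)) -> convexR (fun x => \sum_(i <- r | P i) fs i x).
Proof.
move=> h; elim: r => [|i r IH].
  have -> : (fun x => \sum_(i <- [::] | P i) fs i x) = fun=> 0 by apply: funext => x; rewrite big_nil.
  by move=> x y t _; rewrite !mulr0 addr0.
have -> : (fun x => \sum_(j <- i :: r | P j) fs j x) =
  fun x => if P i then fs i x + \sum_(j <- r | P j) fs j x else \sum_(j <- r | P j) fs j x.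
  by apply: funext => x; rewrite big_cons.
by case: (P i) => //; apply: convexD.
Qed.

Lemma PBil_ccont (H : 'I_k -> 'rV[R]_n -> 'M[R]_n) : (forall j, mcont (H j)) ->
  ccont (fun x => PBil (fun j => H j x)).
Proof.
move=> h; apply: ccont_sum => b _; apply: ccont_sum => s _.
apply: ccontM; first exact: ccont_cst.
by apply: ccont_prod => j _; apply: ccont_cR; exact: h.
Qed.

Theorem polar_smooth (fs : 'I_k -> 'rV[R]_n -> R) phi : (forall j, convexR (fs j) /\ smooth (fs j)) ->
  Cc phi -> polar (fun f => Psi f phi) fs =
    (k`!%:R)^-1 * Iint (fun x => PBil (fun j => D2 (fs j) x) * phi x).
Proof.
move=> hfs cphi; rewrite /polar; congr (_ * _).
have cfs j : convexR (fs j) by case: (hfs j).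
have sfs j : smooth (fs j) by case: (hfs j).
have sS (S : {set 'I_k}) : smooth (fun x => \sum_(i in S) fs i x).
  by apply: sm_smooth; apply: sm_sum => i _; exact: sm_base.
have DS (S : {set 'I_k}) x : D2 (fun x => \sum_(i in S) fs i x) x = \sum_(i in S) D2 (fs i) x.
  apply/matrixP => p q; rewrite mxE summxE iterD_sum //.
  by apply: eq_bigr => i _; rewrite mxE.
have rI := @Iint_cradon R n.
have CS (S : {set 'I_k}) : Cc (fun x => (-1) ^+ (k - #|S|) * (PH c (\sum_(i in S) D2 (fs i) x) * phi x)).
  apply: CcZ; have := IP_Cc c cphi (D2_mcont (sS S)); congr Cc.
  by apply: funext => x; rewrite DS.
have -> : (fun x => PBil (fun j => D2 (fs j) x) * phi x) =
  fun x => \sum_(S : {set 'I_k}) (-1) ^+ (k - #|S|) * (PH c (\sum_(i in S) D2 (fs i) x) * phi x).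
  by apply: funext => x; rewrite -alt_PH big_distrl; apply: eq_bigr => S _; rewrite mulrA.
rewrite (cradon_sum rI (index_enum _) CS).2; apply: eq_bigr => S _.
rewrite (cradonZ rI); last first.
  have := IP_Cc c cphi (D2_mcont (sS S)); congr Cc.
  by apply: funext => x; rewrite DS.
congr (_ * _); rewrite (Psi_smooth MA hc) //; last exact: convex_sum.
by rewrite /IP; congr Iint; apply: funext => x; rewrite DS.
Qed.

End Polarization.

(** * An explicit Goodey-Weil distribution *)

Section GoodeyWeil.
Variables (R : realType) (n k : nat).
Local Notation C := R[i].
Variable c : {ffun 'I_k -> 'I_n * 'I_n} -> C.
Implicit Types (G : 'I_k -> 'rV[R]_n -> R) (b : {ffun 'I_k -> 'I_n * 'I_n}) (t s : 'S_k).

Definition dgm (x : 'rV[R]_n) : 'M[R]_(k, n) := \matrix_(j, i) x 0 i.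
Definition tens G (z : 'M[R]_(k, n)) : R := \prod_(j < k) G j (row j z).
Definition updG G (l : 'I_k) (h : 'rV[R]_n -> R) : 'I_k -> 'rV[R]_n -> R :=
  fun j => if j == l then h else G j.

Lemma rowZD (j : 'I_k) (h : R) (v a : 'M[R]_(k, n)) : row j (h *: v + a) = h *: row j v + row j a.
Proof. by apply/rowP => i; rewrite !mxE. Qed.

Lemma row_cont (j : 'I_k) : continuous (fun z : 'M[R]_(k, n) => row j z).
Proof.
apply/continuous_epsP => x e e0; exists e => // y; apply: le_lt_trans.
apply: mx_norm_le => // a i; rewrite !mxE; have := mx_coord_le (x - y) j i; by rewrite !mxE.
Qed.

Lemma tens_smooth G : (forall j, smooth (G j)) -> smooth (tens G).
Proof.
move=> h; apply: sm_smooth; apply: sm_prod => j; apply: sm_base.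
apply: (@smooth_comp_lin R _ _ (fun z : 'M[R]_(k, n) => row j z)) => //.
  by move=> *; exact: rowZD.
exact: row_cont.
Qed.

Lemma derive_tens G (l : 'I_k) (i : 'I_n) z : (forall j, smooth (G j)) ->
  derive (tens G) z (delta_mx l i) = tens (updG G l (fun y => derive (G l) y (delta_mx 0 i))) z.
Proof.
move=> sG.
pose cst := \prod_(j < k | j != l) G j (row j z).
have D : is_derive (0 : R) (1 : R) (fun t : R => tens G (z + t *: delta_mx l i))
    (cst * derive (G l) (row l z) (delta_mx 0 i)).
  have -> : (fun t : R => tens G (z + t *: delta_mx l i)) = (fun t : R => cst * G l (row l z + t *: delta_mx 0 i)).
    apply: funext => t; rewrite /tens (bigD1 l) //= mulrC; congr (_ * G l _).
      apply: eq_bigr => j jl; congr (G j _); apply/rowP => p; rewrite !mxE (negPf jl) /=.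
      by rewrite mulr0 addr0.
    by apply/rowP => p; rewrite !mxE eqxx.
  have i1 := is_derive_line0 ((sG l [::]).2 (row l z) (delta_mx 0 i)).
  by apply: is_derive_eq; rewrite /= /GRing.scale /=; ring.
have [_ ->] := is_derive_of_line D.
rewrite /tens (bigD1 l) //= /updG eqxx mulrC; congr (_ * _).
by apply: eq_bigr => j /negPf ->.
Qed.

Lemma updG_smooth G l h : (forall j, smooth (G j)) -> smooth h -> forall j, smooth (updG G l h j).
Proof. by move=> sG sh j; rewrite /updG; case: eqP => _; [exact: sh|exact: sG]. Qed.

(** Differentiating a tensor product along these directions turns its factor in block t j into the
    Hessian entry b j of that factor. *)
Definition vl t b (js : seq 'I_k) : seq 'M[R]_(k, n) :=
  flatten [seq [:: delta_mx (t j) (b j).1; delta_mx (t j) (b j).2] | j <- js].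

Lemma iterD_tens t b js G : uniq js -> (forall j, smooth (G j)) ->
  Defs.iterD (vl t b js) (tens G) =
  tens (fun l => if (t^-1)%g l \in js then (fun y => D2 (G l) y (b (t^-1%g l)).1 (b (t^-1%g l)).2) else G l).
Proof.
move=> ujs sG; elim: js ujs => [//|j js IH] /= /andP[jjs ujs].
rewrite IH //; set G' := fun l => if _ then _ else _.
have sG' l : smooth (G' l).
  rewrite /G'; case: ifP => // _.
  have -> : (fun y => D2 (G l) y (b (t^-1%g l)).1 (b (t^-1%g l)).2) =
     Defs.iterD [:: delta_mx 0 (b (t^-1%g l)).1; delta_mx 0 (b (t^-1%g l)).2] (G l).
    by apply: funext => y; rewrite mxE.
  by do 2 apply: smooth_derive.
have -> : (fun a => derive (tens G') a (delta_mx (t j) (b j).2)) =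
   tens (updG G' (t j) (fun y => derive (G' (t j)) y (delta_mx 0 (b j).2))).
  by apply: funext => z; exact: derive_tens.
apply: funext => z; rewrite derive_tens; last by apply: updG_smooth => //; exact: smooth_derive.
apply: eq_bigr => l _; rewrite {1 2}/updG in_cons.
have [->|lt] := eqVneq l (t j).
  rewrite permK eqxx /= mxE /updG eqxx /G' permK (negPf jjs) //.
have -> : (t^-1)%g l == j = false.
  by apply/eqP => e; move/eqP: lt; apply; rewrite -e permKV.
by rewrite /updG ?(negPf lt).
Qed.

Lemma dgm_cont : continuous dgm.
Proof.
apply/continuous_epsP => x e e0; exists e => // y; apply: le_lt_trans.
by apply: mx_norm_le => // j i; rewrite !mxE; have := mx_coord_le (x - y) 0 i; rewrite !mxE.
Qed.

Definition cD (vs : seq 'M[R]_(k, n)) (g : 'M[R]_(k, n) -> C) (z : 'M[R]_(k, n)) : C :=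
  cR (Defs.iterD vs (fun y => reC (g y)) z) + cI R * cR (Defs.iterD vs (fun y => imC (g y)) z).

Lemma cD_ccont vs g : smoothC g -> ccont (fun x => cD vs g (dgm x)).
Proof.
move=> [s1 s2].
have k1 (h : 'M[R]_(k, n) -> R) : smooth h -> continuous (fun x => Defs.iterD vs h (dgm x)).
  move=> sh x; apply: (@continuous_comp _ _ _ dgm (Defs.iterD vs h)); first exact: dgm_cont.
  exact: (sh vs).1.
apply: ccontD; first by apply: ccont_cR; exact: k1.
by apply: ccontM; [exact: ccont_cst|apply: ccont_cR; exact: k1].
Qed.

Lemma cD_lin vs (a : C) g h z : smoothC g -> smoothC h ->
  cD vs (fun x => a * g x + h x) z = a * cD vs g z + cD vs h z.
Proof.
move=> [g1 g2] [h1 h2]; rewrite /cD.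
have sl (t : R) (f1 f2 : 'M[R]_(k, n) -> R) : smooth f1 -> smooth f2 -> smooth (fun x => t * f1 x + f2 x).
  move=> k1 k2; apply: sm_smooth; apply: sm_add; last exact: sm_base.
  by apply: sm_mul; [exact: sm_cst|exact: sm_base].
have -> : (fun y => reC (a * g y + h y)) = (fun y => reC a * reC (g y) + (- imC a * imC (g y) + reC (h y))).
  by apply: funext => y; rewrite reC_D reC_M; ring.
have -> : (fun y => imC (a * g y + h y)) = (fun y => reC a * imC (g y) + (imC a * reC (g y) + imC (h y))).
  by apply: funext => y; rewrite imC_D imC_M; ring.
rewrite (iterD_lin vs (reC a) g1 (sl (- imC a) _ _ g2 h1)) (iterD_lin vs (- imC a) g2 h1).
rewrite (iterD_lin vs (reC a) g2 (sl (imC a) _ _ g1 h2)) (iterD_lin vs (imC a) g1 h2).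
move: (Defs.iterD vs _ z) (Defs.iterD vs _ z) (Defs.iterD vs _ z) (Defs.iterD vs _ z) => x1 x2 x3 x4.
apply: C_ext; rewrite !(reC_D, imC_D, reC_M, imC_M) /=; ring.
Qed.

(** Derivatives of order 2k, restricted to the diagonal and integrated against phi. The shape is
    dictated by [polar_smooth]: on tensor products the derivatives reproduce the terms of [PBil]. *)
Definition GWT (phi : 'rV[R]_n -> C) (g : 'M[R]_(k, n) -> C) : C :=
  (k`!%:R)^-1 * \sum_b \sum_(t : 'S_k) c b * Iint (fun x => cD (vl t b (enum 'I_k)) g (dgm x) * phi x).

Variable phi : 'rV[R]_n -> C.
Hypothesis cphi : Cc phi.

Lemma GWT_lin (a : C) g h : smoothC g -> smoothC h ->
  GWT phi (fun x => a * g x + h x) = a * GWT phi g + GWT phi h.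
Proof.
move=> sg sh; have rI := @Iint_cradon R n.
rewrite /GWT mulrCA -mulrDr; congr (_ * _).
rewrite big_distrr -big_split; apply: eq_bigr => b _ /=.
rewrite big_distrr -big_split; apply: eq_bigr => t _ /=.
have C1 := CcM cphi (cD_ccont (vl t b (enum 'I_k)) sg).
have C2 := CcM cphi (cD_ccont (vl t b (enum 'I_k)) sh).
rewrite mulrCA -mulrDr; congr (_ * _); rewrite -rI.1 //.
by congr Iint; apply: funext => x; rewrite cD_lin //; ring.
Qed.

Lemma vl_norm t b js v : v \in vl t b js -> `|v| <= 1.
Proof.
move=> /flattenP[s /mapP[j _ ->]]; rewrite !in_cons in_nil orbF => h.
have dn (l : 'I_k) (i : 'I_n) : `|delta_mx l i : 'M[R]_(k, n)| <= 1.
  by apply: mx_norm_le => // p q; rewrite mxE; case: (_ && _); rewrite ?normr1 ?normr0.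
by case/orP: h => /eqP ->.
Qed.

Lemma GWT_cdistr : cdistr (GWT phi).
Proof.
split; first exact: GWT_lin.
have /CcP[_ _ [B B0 pB]] := cphi.
have [M' M0' hM'] := Cc_bounded cphi.
have rI := @Iint_cradon R n; have [cc cc0 hcc] := rI.2 B.
pose N := (\max_(b : {ffun 'I_k -> 'I_n * 'I_n}) \max_(t : 'S_k) size (vl t b (enum 'I_k)))%N.
exists (dgm @` cball B); split.
  by apply: continuous_compact (@compact_cball R n B); apply: continuous_subspaceT; exact: dgm_cont.
pose W := nC ((k`!%:R)^-1) * \sum_b \sum_(t : 'S_k) nC (c b) * (cc * (2 * M')).
exists N, W => g M sg hM.
have M0 : 0 <= M.
  have [] := hM [::] (leq0n _) _ (dgm 0) _; [by []|by exists 0; rewrite // /cball /= normr0 ltW|].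
  by move=> h _; apply: le_trans h; exact: normr_ge0.
apply: le_trans (norm_le_nC _) _; rewrite cR_le /GWT.
apply: le_trans (nC_M _ _) _; rewrite /W -mulrA; apply: ler_wpM2l; first exact: nC_ge0.
apply: le_trans (nC_sum _ _ _) _; rewrite big_distrl; apply: ler_sum => b _ /=.
apply: le_trans (nC_sum _ _ _) _; rewrite big_distrl; apply: ler_sum => t _ /=.
apply: le_trans (nC_M _ _) _; rewrite -mulrA; apply: ler_wpM2l; first exact: nC_ge0.
rewrite -mulrA; apply: hcc.
- by apply: CcM => //; exact: cD_ccont.
- by move=> x /pB ->; rewrite mulr0.
move=> x; have [xB|xB] := leP `|x| B; last first.
  by rewrite pB // mulr0 nC0 !mulr_ge0 // ltW.
apply: le_trans (nC_M _ _) _.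
have -> : 2 * M' * M = (M + M) * M' by ring.
apply: ler_pM; [exact: nC_ge0|exact: nC_ge0| |exact: hM'].
have szN : (size (vl t b (enum 'I_k)) <= N)%N.
  apply: leq_trans (leq_bigmax (F := fun b => \max_(t : 'S_k) size (vl t b (enum 'I_k))) b).
  exact: (leq_bigmax (F := fun t => size (vl t b (enum 'I_k)))).
have [h1 h2] := hM _ szN (fun v => @vl_norm t b _ v) (dgm x) (ex_intro2 _ _ x xB erefl).
apply: le_trans (nC_D _ _) _; rewrite nC_cR; apply: lerD => //.
apply: le_trans (nC_M _ _) _; rewrite nC_cR /nC /= normr0 normr1 add0r mul1r //.
Qed.

Lemma row_perm_vl s t b js : map (row_perm s) (vl t b js) = vl (t * s^-1)%g b js.
Proof.
rewrite /vl map_flatten -map_comp; congr flatten; apply: eq_map => j /=.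
have e (i : 'I_n) : row_perm s (delta_mx (t j) i) = delta_mx ((t * s^-1)%g j) i :> 'M[R]_(k, n).
  apply/matrixP => p q; rewrite !mxE permM; congr ((_ && _)%:R).
  by rewrite -(inj_eq (@perm_inj _ s^-1%g)) permK.
by rewrite !e.
Qed.

(** Permuting the blocks fixes the diagonal and only changes the summation index t to t * s^-1. *)
Lemma GWT_sym s g : smoothC g -> GWT phi (fun z => g (row_perm s z)) = GWT phi g.
Proof.
move=> sg; rewrite /GWT; congr (_ * _); apply: eq_bigr => b _.
rewrite [RHS](reindex_inj (@mulIg _ s^-1%g)) /=; apply: eq_bigr => t _; congr (_ * _).
congr Iint; apply: funext => x; congr (_ * _).
have dg : row_perm s (dgm x) = dgm x by apply/matrixP => i j; rewrite !mxE.
have rp (h : R) (v a : 'M[R]_(k, n)) : row_perm s (h *: v + a) = h *: row_perm s v + row_perm s a.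
  by apply/matrixP => i j; rewrite !mxE.
have it (f : 'M[R]_(k, n) -> R) : Defs.iterD (vl t b (enum 'I_k)) (fun z => f (row_perm s z)) (dgm x) =
    Defs.iterD (vl (t * s^-1)%g b (enum 'I_k)) f (dgm x).
  by rewrite (iterD_comp rp) row_perm_vl dg.
by rewrite /cD (it (fun y => reC (g y))) (it (fun y => imC (g y))).
Qed.

Lemma GWT_tensor (fs : 'I_k -> 'rV[R]_n -> R) : (forall j, smooth (fs j)) ->
  GWT phi (tensorR fs) = (k`!%:R)^-1 * Iint (fun x => PBil c (fun j => D2 (fs j) x) * phi x).
Proof.
move=> sfs; have rI := @Iint_cradon R n; rewrite /GWT; congr (_ * _).
have iz vs z : Defs.iterD vs (fun _ : 'M[R]_(k, n) => 0 : R) z = 0.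
  have := @iterD_sum R _ vs 'I_0 (index_enum _) xpredT (fun _ _ => 0 : R).
  have -> : (fun x : 'M[R]_(k, n) => \sum_(i < 0) (0 : R)) = fun=> 0 by apply: funext => x; rewrite big_ord0.
  move=> ->; first by rewrite big_ord0.
  by case.
have e b t x : cD (vl t b (enum 'I_k)) (tensorR fs) (dgm x) =
    \prod_(j < k) cR (D2 (fs (t j)) x (b j).1 (b j).2).
  rewrite /cD /tensorR /= iz cR0 mulr0 addr0 -cR_prod; congr cR.
  rewrite -/(tens fs) iterD_tens ?enum_uniq // /tens (reindex_inj (@perm_inj _ t)).
  apply: eq_bigr => j _; rewrite permK mem_enum.
  by have -> : row (t j) (dgm x) = x by apply/rowP => i; rewrite !mxE.
pose F b t x := c b * (\prod_(j < k) cR (D2 (fs (t j)) x (b j).1 (b j).2) * phi x).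
have CF b t : Cc (F b t).
  apply: CcZ; apply: CcM => //; apply: ccont_prod => j _; apply: ccont_cR.
  exact: D2_mcont.
have CFs b := (cradon_sum rI (index_enum _) (CF b)).
have -> : (fun x => PBil c (fun j => D2 (fs j) x) * phi x) = fun x => \sum_b \sum_(t : 'S_k) F b t x.
  apply: funext => x; rewrite /PBil big_distrl; apply: eq_bigr => b _ /=.
  by rewrite big_distrl; apply: eq_bigr => t _; rewrite /F /= mulrA.
rewrite (cradon_sum rI (index_enum _) (fun b => (CFs b).1)).2; apply: eq_bigr => b _.
rewrite (CFs b).2; apply: eq_bigr => t _; rewrite /F (cradonZ rI).
  by congr (_ * Iint _); apply: funext => x; rewrite e.
by apply: CcM => //; apply: ccont_prod => j _; apply: ccont_cR; exact: D2_mcont.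
Qed.

Variable Psi : ('rV[R]_n -> R) -> ('rV[R]_n -> C) -> C.
Hypothesis MA : MAVal k Psi.
Hypothesis hc : forall A : 'M[R]_n, psd A -> PA Psi A = PH c A.

Theorem GWT_isGW : isGW (fun f => Psi f phi) (GWT phi).
Proof.
split; first exact: GWT_cdistr.
split; first by move=> s g sg; exact: GWT_sym.
move=> fs hfs; rewrite GWT_tensor; last by move=> j; case: (hfs j).
by rewrite (polar_smooth MA hc).
Qed.

End GoodeyWeil.

(** * Complex exponentials as combinations of convex functions *)

Section Exponentials.
Variables (R : realType) (n : nat).
Local Notation C := R[i].
Implicit Types (w : 'rV[C]_n) (x y v : 'rV[R]_n).

Definition vre w : 'rV[R]_n := \row_i reC (w 0 i).
Definition vim w : 'rV[R]_n := \row_i imC (w 0 i).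

Lemma reC_dotC w x : reC (dotC w x) = dotR (vre w) x.
Proof.
rewrite /dotC /dotR; elim/big_ind2: _ => [//|a b p q h1 h2|i _]; first by rewrite reC_D h1 h2.
by rewrite reC_M mxE /= mulr0 subr0.
Qed.
Lemma imC_dotC w x : imC (dotC w x) = dotR (vim w) x.
Proof.
rewrite /dotC /dotR; elim/big_ind2: _ => [//|a b p q h1 h2|i _]; first by rewrite imC_D h1 h2.
by rewrite imC_M mxE /= mulr0 add0r.
Qed.

(** The real part of exp(i (<w, x> + th)). Phase - pi / 2 gives the imaginary part of the
    exponential, and keeping th free makes the family stable under derivatives. *)
Definition Eth w (th : R) x : R := expR (- dotR (vim w) x) * cos (dotR (vre w) x + th).
Definition Hup w x : R := expR (dotR (vre w) x * dotR (vre w) x + dotR (vim w) x * dotR (vim w) x).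

Lemma cexpE w x : cexp (cI R * dotC w x) = cR (Eth w 0 x) + cI R * cR (Eth w (- (pi / 2)) x).
Proof.
rewrite /cexp /Eth reC_M imC_M reC_dotC imC_dotC addr0 /= !mul0r !mul1r sub0r add0r.
have -> : cos (dotR (vre w) x - pi / 2) = sin (dotR (vre w) x).
  by rewrite cosB cos_pihalf sin_pihalf mulr0 add0r mulr1.
by rewrite !cRM; ring.
Qed.

Lemma sm_dot a : sm (dotR a : 'rV[R]_n -> R).
Proof. by apply: sm_lin; [exact: dotR_cont|move=> x t v; rewrite dotRD dotRZ]. Qed.

Lemma sm_Eth w th : sm (Eth w th).
Proof.
apply: sm_mul; last by apply: sm_cos; apply: sm_add; [exact: sm_dot|exact: sm_cst].
have -> : (fun x => expR (- dotR (vim w) x)) = (fun x => expR (-1 * dotR (vim w) x)).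
  by apply: funext => x; rewrite mulN1r.
by apply: sm_exp; apply: sm_mul; [exact: sm_cst|exact: sm_dot].
Qed.

Lemma sm_Hup w : sm (Hup w).
Proof. by apply: sm_exp; apply: sm_add; apply: sm_mul; exact: sm_dot. Qed.

Lemma dotR_delta (a : 'rV[R]_n) (i : 'I_n) : dotR a (delta_mx 0 i) = a 0 i.
Proof.
rewrite /dotR (bigD1 i) //= big1 ?addr0 => [|j ji]; first by rewrite mxE !eqxx mulr1.
by rewrite mxE (negPf ji) andbF mulr0.
Qed.

Lemma derive_Eth w th x v : derive (Eth w th) x v =
  - dotR (vim w) v * Eth w th x + dotR (vre w) v * Eth w (th + pi / 2) x.
Proof.
set A := dotR (vre w) x; set B := dotR (vim w) x; set al := dotR (vre w) v; set be := dotR (vim w) v.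
have D : is_derive (0 : R) (1 : R) (fun t : R => Eth w th (x + t *: v))
   (- be * Eth w th x + al * Eth w (th + pi / 2) x).
  have -> : (fun t : R => Eth w th (x + t *: v)) = (fun t : R => expR (- B + t * - be) * cos (A + th + t * al)).
    by apply: funext => t; rewrite /Eth !dotRD !dotRZ -/A -/B -/al -/be; congr (expR _ * cos _); ring.
  have dl (p q t : R) : is_derive t (1 : R) (fun s : R => p + s * q) q.
    by apply: is_derive_eq; rewrite /= /GRing.scale /=; ring.
  have i1 := @is_derive1_comp R expR (fun s => - B + s * - be) 0 _ _ (is_derive_expR _) (dl _ _ 0).
  have i2 := @is_derive1_comp R cos (fun s => A + th + s * al) 0 _ _ (is_derive_cos _) (dl _ _ 0).
  apply: is_derive_eq; rewrite /= /GRing.scale /= /Eth -/A -/B !mul0r !addr0.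
  by rewrite addrA cosDpihalf; ring.
by have [_ ->] := is_derive_of_line D.
Qed.

Lemma D2_Eth w th x (p q : 'I_n) : D2 (Eth w th) x p q =
  (vim w 0 p * vim w 0 q - vre w 0 p * vre w 0 q) * Eth w th x -
  (vim w 0 p * vre w 0 q + vre w 0 p * vim w 0 q) * Eth w (th + pi / 2) x.
Proof.
rewrite mxE /=.
have -> : (fun a => derive (Eth w th) a (delta_mx 0 q)) =
   fun a => - vim w 0 q * Eth w th a + (vre w 0 q * Eth w (th + pi / 2) a).
  by apply: funext => a; rewrite derive_Eth !dotR_delta.
have s0 := sm_smooth (sm_Eth w th); have s1 := sm_smooth (sm_Eth w (th + pi / 2)).
have s2 : smooth (fun a => vre w 0 q * Eth w (th + pi / 2) a).
  by apply: sm_smooth; apply: sm_mul; [exact: sm_cst|exact: sm_Eth].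
have := congr1 (fun g => g x) (@iterD_lin R _ [:: delta_mx 0 p] (- vim w 0 q) _ _ s0 s2) => /= ->.
have z : smooth (fun _ : 'rV[R]_n => 0 : R) by apply: sm_smooth; exact: sm_cst.
have -> : (fun a => vre w 0 q * Eth w (th + pi / 2) a) = (fun a => vre w 0 q * Eth w (th + pi / 2) a + 0).
  by apply: funext => a; rewrite addr0.
have := congr1 (fun g => g x) (@iterD_lin R _ [:: delta_mx 0 p] (vre w 0 q) _ _ s1 z) => /= ->.
have -> : derive (fun _ : 'rV[R]_n => 0 : R) x (delta_mx 0 p) = 0 by rewrite derive_cst.
rewrite !derive_Eth.
have -> : Eth w (th + pi / 2 + pi / 2) x = - Eth w th x.
  rewrite /Eth; have -> : dotR (vre w) x + (th + pi / 2 + pi / 2) = dotR (vre w) x + th + pi by lra.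
  by rewrite cosDpi mulrN.
by rewrite !dotR_delta; ring.
Qed.

(** Along a line the oscillating part has second derivative at least -(al^2 + be^2) e^W, and [Hup]
    at least 2 (al^2 + be^2) e^E. Since E - W has the form X^2 + Y^2 + Y >= -1/4, e^W is at most 2
    e^E. *)
Lemma Eth_Hup_convex w th : convexR (fun x => Eth w th x + Hup w x).
Proof.
apply: (@convex_line R n) => y v.
set A0 := dotR (vre w) y; set B := dotR (vim w) y; pose A := A0 + th.
set al := dotR (vre w) v; set be := dotR (vim w) v.
pose U (s : R) := A + s * al; pose W (s : R) := - B + s * - be.
pose E (s : R) := (A0 + s * al) * (A0 + s * al) + (B + s * be) * (B + s * be).
pose E1 (s : R) := 2 * (A0 + s * al) * al + 2 * (B + s * be) * be.
pose du (s : R) := expR (W s) * (- be * cos (U s) - al * sin (U s)) + expR (E s) * E1 s.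
pose psi (s : R) := expR (W s) * ((be * be - al * al) * cos (U s) + 2 * al * be * sin (U s)) +
  expR (E s) * (2 * (al * al + be * be) + E1 s * E1 s).
have dl (p q t : R) : is_derive t (1 : R) (fun s : R => p + s * q) q.
  by apply: is_derive_eq; rewrite /= /GRing.scale /=; ring.
have dW (s : R) : is_derive s (1 : R) (fun s => expR (W s)) (expR (W s) * - be).
  exact: (@is_derive1_comp R expR W s _ _ (is_derive_expR _) (dl _ _ s)).
have dc (s : R) : is_derive s (1 : R) (fun s => cos (U s)) (- sin (U s) * al).
  exact: (@is_derive1_comp R cos U s _ _ (is_derive_cos _) (dl _ _ s)).
have ds (s : R) : is_derive s (1 : R) (fun s => sin (U s)) (cos (U s) * al).
  exact: (@is_derive1_comp R sin U s _ _ (is_derive_sin _) (dl _ _ s)).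
have dE0 (s : R) : is_derive s (1 : R) E (E1 s).
  have i1 := dl A0 al s; have i2 := dl B be s.
  by rewrite /E; apply: is_derive_eq; rewrite /E1 /= /GRing.scale /=; ring.
have dE (s : R) : is_derive s (1 : R) (fun s => expR (E s)) (expR (E s) * E1 s).
  exact: (@is_derive1_comp R expR E s _ _ (is_derive_expR _) (dE0 s)).
have dE1 (s : R) : is_derive s (1 : R) E1 (2 * (al * al + be * be)).
  by rewrite /E1; apply: is_derive_eq; rewrite /= /GRing.scale /=; ring.
have -> : (fun s => Eth w th (y + s *: v) + Hup w (y + s *: v)) =
    (fun s => expR (W s) * cos (U s) + expR (E s)).
  apply: funext => s; rewrite /Eth /Hup !dotRD !dotRZ -/A0 -/B -/al -/be.
  by congr (expR _ * cos _ + expR _); rewrite /W /U /E /A; ring.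
apply: (@cvx1_d2 R _ du psi).
- move=> s; have i1 := dW s; have i2 := dc s; have i3 := dE s.
  by apply: is_derive_eq; rewrite /du /= /GRing.scale /=; ring.
- move=> s; have i1 := dW s; have i2 := dc s; have i3 := dE s; have i4 := ds s; have i5 := dE1 s.
  by rewrite /du; apply: is_derive_eq; rewrite /psi /= /GRing.scale /=; ring.
move=> s; rewrite /psi.
set cc := cos (U s); set ss := sin (U s).
have cs1 : cc * cc + ss * ss = 1 by have := cos2Dsin2 (U s); rewrite !expr2.
have c1 : 0 <= 1 + cc by have := cos_geN1 (U s); rewrite -/cc; lra.
(* The right side is minus the real part of (al + i be)^2 e^{iU}. In real terms, (1 + cos U) Q is a
   square; cos U = -1 is treated apart. *)
have quad : - (al * al + be * be) <= (be * be - al * al) * cc + 2 * al * be * ss.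
  rewrite -subr_ge0; set Q := _ - _.
  have QE : (1 + cc) * Q = (be * (1 + cc) + al * ss) * (be * (1 + cc) + al * ss).
    have s2 : ss * ss = (1 - cc) * (1 + cc) by rewrite mulrBl !mulrDr; lra.
    have -> : (be * (1 + cc) + al * ss) * (be * (1 + cc) + al * ss) =
      be * be * (1 + cc) * (1 + cc) + 2 * al * be * ss * (1 + cc) + al * al * (ss * ss) by ring.
    by rewrite s2 /Q; ring.
  move: c1; rewrite le_eqVlt => /orP[/eqP c0|c0].
    have cm : cc = -1 by lra.
    have s0 : ss * ss = 0 by move: cs1; rewrite cm; lra.
    have {}s0 : ss = 0 by apply/eqP; rewrite -sqrf_eq0 expr2 s0.
    by rewrite /Q cm s0; have := sqr_ge0 al; rewrite expr2; lra.
  by rewrite -(pmulr_rge0 _ c0) QE -expr2 sqr_ge0.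
have ex : expR (W s) <= 2 * expR (E s).
  have -> : expR (E s) = expR (E s - W s) * expR (W s) by rewrite -expRD subrK.
  have h := expR_ge1Dx (E s - W s).
  have k : 3 / 4 <= 1 + (E s - W s).
    have -> : W s = - (B + s * be) by rewrite /W; ring.
    rewrite /E; move: (A0 + s * al) (B + s * be) => X Y.
    by have := sqr_ge0 (Y + 1 / 2); have := sqr_ge0 X; rewrite !expr2; lra.
  have := expR_ge0 (W s); have := le_trans k h; move: (expR (W s)) (expR (E s - W s)) => p q h1 h2.
  have := ler_wpM2r h2 h1; lra.
have ab : 0 <= al * al + be * be by rewrite addr_ge0 // -expr2 sqr_ge0.
have h1 := ler_wpM2l (expR_ge0 (W s)) quad.
have h2 := ler_wpM2r ab ex.
have h3 : 0 <= expR (E s) * (E1 s * E1 s) by rewrite mulr_ge0 ?expR_ge0 // -expr2 sqr_ge0.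
move: h1 h2 h3; rewrite mulrN => h1 h2 h3.
have -> : expR (E s) * (2 * (al * al + be * be) + E1 s * E1 s) =
  2 * expR (E s) * (al * al + be * be) + expR (E s) * (E1 s * E1 s) by ring.
by move: h1 h2 h3; move: (expR (W s) * _) (expR (W s) * _) (2 * expR _ * _) (expR (E s) * _) => *; lra.
Qed.

Lemma Hup_convex w : convexR (Hup w).
Proof.
apply: (@convex_line R n) => y v.
set A0 := dotR (vre w) y; set B := dotR (vim w) y.
set al := dotR (vre w) v; set be := dotR (vim w) v.
pose E (s : R) := (A0 + s * al) * (A0 + s * al) + (B + s * be) * (B + s * be).
pose E1 (s : R) := 2 * (A0 + s * al) * al + 2 * (B + s * be) * be.
have dl (p q t : R) : is_derive t (1 : R) (fun s : R => p + s * q) q.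
  by apply: is_derive_eq; rewrite /= /GRing.scale /=; ring.
have dE0 (s : R) : is_derive s (1 : R) E (E1 s).
  have i1 := dl A0 al s; have i2 := dl B be s.
  by rewrite /E; apply: is_derive_eq; rewrite /E1 /= /GRing.scale /=; ring.
have dE (s : R) : is_derive s (1 : R) (fun s => expR (E s)) (expR (E s) * E1 s).
  exact: (@is_derive1_comp R expR E s _ _ (is_derive_expR _) (dE0 s)).
have dE1 (s : R) : is_derive s (1 : R) E1 (2 * (al * al + be * be)).
  by rewrite /E1; apply: is_derive_eq; rewrite /= /GRing.scale /=; ring.
have -> : (fun s => Hup w (y + s *: v)) = (fun s => expR (E s)).
  by apply: funext => s; rewrite /Hup !dotRD !dotRZ.
apply: (@cvx1_d2 R _ (fun s => expR (E s) * E1 s) (fun s => expR (E s) * (2 * (al * al + be * be) + E1 s * E1 s))).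
- move=> s; have i1 := dE s; have i2 := dE1 s.
  by apply: is_derive_eq; rewrite /= /GRing.scale /=; ring.
move=> s; rewrite mulr_ge0 ?expR_ge0 // addr_ge0 -?expr2 ?sqr_ge0 // mulr_ge0 //.
by rewrite addr_ge0 // sqr_ge0.
Qed.

(* [exp(i <w, x>)] is the combination of the convex functions [expf w r] with coefficients [expc r];
   adding [Hup] makes the oscillating parts convex. *)
Definition expf w (r : 'I_3) : 'rV[R]_n -> R :=
  if r == 0 :> nat then fun x => Eth w 0 x + Hup w x
  else if r == 1 :> nat then fun x => Eth w (- (pi / 2)) x + Hup w x else Hup w.
Definition expc (r : 'I_3) : C :=
  if r == 0 :> nat then 1 else if r == 1 :> nat then cI R else - (1 + cI R).

Lemma expf_ok w r : convexR (expf w r) /\ smooth (expf w r).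
Proof.
rewrite /expf; case: ifP => _; [|case: ifP => _]; split;
  try exact: Eth_Hup_convex; try exact: Hup_convex; apply: sm_smooth; try exact: sm_Hup;
  by apply: sm_add; [exact: sm_Eth|exact: sm_Hup].
Qed.

Lemma expf_sum w x : \sum_(r < 3) expc r * cR (expf w r x) = cexp (cI R * dotC w x).
Proof. by rewrite !big_ord_recl big_ord0 /expc /expf /= cexpE !cRD; ring. Qed.

Lemma D2E (f : 'rV[R]_n -> R) x (p q : 'I_n) : D2 f x p q = Defs.iterD [:: delta_mx 0 p; delta_mx 0 q] f x.
Proof. by rewrite mxE. Qed.

Lemma D2D (f g : 'rV[R]_n -> R) x (p q : 'I_n) : smooth f -> smooth g ->
  D2 (fun x => f x + g x) x p q = D2 f x p q + D2 g x p q.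
Proof.
move=> sf sg.
have -> : (fun x => f x + g x) = (fun x => 1 * f x + g x) by apply: funext => z; rewrite mul1r.
apply: (etrans (D2E _ _ _ _)); rewrite (iterD_lin _ 1 sf sg) mul1r.
exact: (f_equal2 +%R (esym (D2E _ _ _ _)) (esym (D2E _ _ _ _))).
Qed.

(** The coefficients [expc] sum to 0, so [Hup] drops out; what is left is the Hessian of exp(i <w,
    x>). *)
Lemma expf_D2 w x (p q : 'I_n) : \sum_(r < 3) expc r * cR (D2 (expf w r) x p q) =
  - (w 0 p * w 0 q) * cexp (cI R * dotC w x).
Proof.
rewrite 3!big_ord_recl big_ord0.
have -> : expf w ord0 = fun x => Eth w 0 x + Hup w x by [].
have -> : expf w (lift ord0 ord0) = fun x => Eth w (- (pi / 2)) x + Hup w x by [].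
have -> : expf w (lift ord0 (lift ord0 ord0)) = Hup w by [].
have -> : expc ord0 = 1 by [].
have -> : expc (lift ord0 ord0) = cI R by [].
have -> : expc (lift ord0 (lift ord0 ord0)) = - (1 + cI R) by [].
have sE th := sm_smooth (sm_Eth w th); have sH := sm_smooth (sm_Hup w).
pose G th := (vim w 0 p * vim w 0 q - vre w 0 p * vre w 0 q) * Eth w th x -
  (vim w 0 p * vre w 0 q + vre w 0 p * vim w 0 q) * Eth w (th + pi / 2) x.
have GE th : D2 (fun x => Eth w th x + Hup w x) x p q = G th + D2 (Hup w) x p q.
  by apply: (etrans (D2D _ _ _ (sE th) sH)); congr (_ + _); exact: D2_Eth.
(* rewriting with [GE] would make unification unfold [expR] and [pi] *)
have key (a b d : C) (u0 v0 u1 v1 : R) : u0 = v0 -> u1 = v1 ->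
  a * cR u0 + (b * cR u1 + d) = a * cR v0 + (b * cR v1 + d) by move=> -> ->.
apply: (etrans (key _ _ _ _ _ _ _ (GE 0) (GE (- (pi / 2))))).
rewrite cexpE /G.
have -> : - (pi / 2) + pi / 2 = 0 :> R by rewrite addrC subrr.
have -> : Eth w (0 + pi / 2) x = - Eth w (- (pi / 2)) x.
  rewrite /Eth -mulrN; congr (_ * _); rewrite add0r.
  by rewrite cosDpihalf cosB cos_pihalf sin_pihalf mulr0 mulr1 add0r.
have -> : vim w 0 p = imC (w 0 p) by rewrite mxE.
have -> : vim w 0 q = imC (w 0 q) by rewrite mxE.
have -> : vre w 0 p = reC (w 0 p) by rewrite mxE.
have -> : vre w 0 q = reC (w 0 q) by rewrite mxE.
move: (Eth w 0 x) (Eth w (- (pi / 2)) x) (D2 (Hup w) x p q) => X Y Z.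
by apply: C_ext; rewrite !(reC_D, imC_D, reC_M, imC_M, reC_N, imC_N) /=; ring.
Qed.

Lemma cexpD (a b : C) : cexp (a + b) = cexp a * cexp b.
Proof.
rewrite /cexp reC_D imC_D expRD cosD sinD.
by apply: C_ext; rewrite !(reC_D, imC_D, reC_M, imC_M, reC_N, imC_N) /=; ring.
Qed.

Lemma cexp0 : cexp (0 : C) = 1.
Proof.
rewrite /cexp reC0 imC0 expR0 cos0 sin0.
by apply: C_ext; rewrite !(reC_D, imC_D, reC_M, imC_M) /=; ring.
Qed.

End Exponentials.

(** * The Fourier-Laplace transform, and uniqueness and vanishing of the polynomial *)

Section FourierLaplace.
Variables (R : realType) (n k : nat).
Local Notation C := R[i].
Variable c : {ffun 'I_k -> 'I_n * 'I_n} -> C.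
Implicit Types (z : 'M[C]_(k, n)) (x : 'rV[R]_n) (F : 'I_k -> 'I_n * 'I_n -> C).

(** [PBil] over complex entries, which admits z_j z_j^T for complex z_j and lets scalars and sums be
    moved through the slots. *)
Definition PBC F : C := \sum_(b : {ffun 'I_k -> 'I_n * 'I_n}) \sum_(s : 'S_k)
  c b * \prod_(j < k) F (s j) (b j).

Lemma PBC_ext F F' : (forall j p, F j p = F' j p) -> PBC F = PBC F'.
Proof.
move=> h; apply: eq_bigr => b _; apply: eq_bigr => s _; congr (_ * _).
by apply: eq_bigr => j _.
Qed.

Lemma PBC_scale (a : 'I_k -> C) F : PBC (fun j p => a j * F j p) = (\prod_j a j) * PBC F.
Proof.
rewrite /PBC big_distrr; apply: eq_bigr => b _; rewrite big_distrr; apply: eq_bigr => s _ /=.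
rewrite big_split /= mulrCA; congr (_ * _).
by rewrite [RHS](reindex_inj (@perm_inj _ s)).
Qed.

Lemma PBC_distr (I : finType) (F : 'I_k -> I -> 'I_n * 'I_n -> C) :
  PBC (fun j p => \sum_r F j r p) = \sum_(g : {ffun 'I_k -> I}) PBC (fun j p => F j (g j) p).
Proof.
rewrite /PBC [RHS]exchange_big; apply: eq_bigr => b _; rewrite [RHS]exchange_big; apply: eq_bigr => s _ /=.
rewrite -big_distrr; congr (_ * _) => /=.
rewrite (reindex_inj (@perm_inj _ s^-1%g)) /= bigA_distr_bigA; apply: eq_bigr => g _ /=.
by rewrite (reindex_inj (@perm_inj _ s)); apply: eq_bigr => j _; rewrite permK.
Qed.

Definition Qc z : C := PBC (fun j p => z j p.1 * z j p.2).

(** Reindexing b moves each permutation from the variables to the coefficients. *)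
Lemma Qc_poly22 : poly22 Qc.
Proof.
exists (fun b => \sum_(s : 'S_k) c [ffun j => b (s j)]) => z.
under [RHS]eq_bigr do rewrite big_distrl.
rewrite /Qc /PBC exchange_big [RHS]exchange_big; apply: eq_bigr => s _ /=.
rewrite (reindex (fun b : {ffun 'I_k -> 'I_n * 'I_n} => [ffun j => b (s j)])) /=; last first.
  exists (fun b : {ffun 'I_k -> 'I_n * 'I_n} => [ffun j => b (s^-1%g j)]) => b _;
  by apply/ffunP => j; rewrite !ffunE ?permK ?permKV.
apply: eq_bigr => b _; congr (_ * _).
rewrite [RHS](reindex_inj (@perm_inj _ s)); apply: eq_bigr => j _; by rewrite ffunE.
Qed.

Lemma Qc_symm : symmQ Qc.
Proof.
move=> t z; apply: eq_bigr => b _; rewrite [RHS](reindex_inj (mulIg t)).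
apply: eq_bigr => s _; congr (_ * _); apply: eq_bigr => j _.
by rewrite !mxE permM.
Qed.

Lemma dotC_sum (I : finType) (w : I -> 'rV[C]_n) x : dotC (\sum_j w j) x = \sum_j dotC (w j) x.
Proof.
rewrite /dotC exchange_big; apply: eq_bigr => i _ /=; by rewrite summxE big_distrl.
Qed.

Lemma cexp_sum (I : finType) (a : I -> C) : cexp (\sum_j a j) = \prod_j cexp (a j).
Proof. by apply: (big_morph (@cexp R) (@cexpD R) (@cexp0 R)). Qed.

Lemma cexp_ccont (w : 'rV[C]_n) : ccont (fun x => cexp (cI R * dotC w x)).
Proof.
have -> : (fun x => cexp (cI R * dotC w x)) =
    fun x => cR (Eth w 0 x) + cI R * cR (Eth w (- (pi / 2)) x).
  by apply: funext => x; exact: cexpE.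
have h th : ccont (fun x => cR (Eth w th x)).
  by apply: ccont_cR; apply: smooth_cont; apply: sm_smooth; exact: sm_Eth.
by apply: ccontD; [exact: h|apply: ccontM; [exact: ccont_cst|exact: h]].
Qed.

Lemma cdistr_sum (T : ('M[R]_(k, n) -> C) -> C) (I : Type) (r : seq I) (a : I -> C)
    (G : I -> 'M[R]_(k, n) -> R) : cdistr T -> (forall i, smooth (G i)) ->
  smoothC (fun y => \sum_(i <- r) a i * cR (G i y)) /\
  T (fun y => \sum_(i <- r) a i * cR (G i y)) = \sum_(i <- r) a i * T (fun y => cR (G i y)).
Proof.
move=> [linT _] sG.
have s0 : smooth (fun _ : 'M[R]_(k, n) => 0 : R) by apply: sm_smooth; exact: sm_cst.
have sC0 : smoothC (fun _ : 'M[R]_(k, n) => 0 : C) by [].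
have T0 : T (fun=> 0) = 0.
  have := linT 1 _ _ sC0 sC0; rewrite mulr0 addr0 mul1r => e.
  by apply: (@addrI _ (T (fun=> 0))); rewrite addr0 -e.
elim: r => [|i r [IH1 IH2]].
  have -> : (fun y => \sum_(i <- [::]) a i * cR (G i y)) = fun=> 0 by apply: funext => y; rewrite big_nil.
  by rewrite big_nil T0.
have -> : (fun y => \sum_(j <- i :: r) a j * cR (G j y)) =
   (fun y => a i * cR (G i y) + \sum_(j <- r) a j * cR (G j y)).
  by apply: funext => y; rewrite big_cons.
have sGi : smoothC (fun y => cR (G i y)) by exact: (conj (sG i) s0).
rewrite big_cons (linT (a i) _ _ sGi IH1) IH2; split; last by [].
case: IH1 => h1 h2.
have sl (t : R) (h : 'M[R]_(k, n) -> R) : smooth h -> smooth (fun y => t * G i y + h y).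
  move=> sh; apply: sm_smooth; apply: sm_add; last exact: (sm_base sh).
  by apply: sm_mul; [exact: sm_cst|exact: (sm_base (sG i))].
split.
  have -> : (fun y => reC (a i * cR (G i y) + \sum_(j <- r) a j * cR (G j y))) =
    (fun y => reC (a i) * G i y + reC (\sum_(j <- r) a j * cR (G j y))).
    by apply: funext => y; rewrite reC_D reC_M /= mulr0 subr0.
  exact: sl.
have -> : (fun y => imC (a i * cR (G i y) + \sum_(j <- r) a j * cR (G j y))) =
    (fun y => imC (a i) * G i y + imC (\sum_(j <- r) a j * cR (G j y))).
  by apply: funext => y; rewrite imC_D imC_M /= mulr0 add0r.
exact: sl.
Qed.

Variable Psi : ('rV[R]_n -> R) -> ('rV[R]_n -> C) -> C.
Hypothesis MA : MAVal k Psi.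
Hypothesis hc : forall A : 'M[R]_n, psd A -> PA Psi A = PH c A.

(** Multilinearity moves the sum over g into the slots, where [expf_D2] leaves -exp(i <z_j, x>) z_j
    z_j^T; the scalars factor out and the exponentials multiply. *)
Lemma sum_PBil_expf z x :
  \sum_(g : {ffun 'I_k -> 'I_3}) (\prod_j @expc R (g j)) * PBil c (fun j => D2 (expf (row j z) (g j)) x) =
  (-1) ^+ k * Qc z * cexp (cI R * dotC (\sum_(j < k) row j z) x).
Proof.
pose F j (r : 'I_3) (p : 'I_n * 'I_n) : C := @expc R r * cR (D2 (expf (row j z) r) x p.1 p.2).
transitivity (\sum_(g : {ffun 'I_k -> 'I_3}) PBC (fun j p => F j (g j) p)).
  by apply: eq_bigr => g _; exact/esym/PBC_scale.
rewrite -PBC_distr.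
rewrite (@PBC_ext _ (fun j p => (-1 * cexp (cI R * dotC (row j z) x)) * (z j p.1 * z j p.2))); last first.
  by move=> j p; rewrite /F expf_D2 !mxE; ring.
rewrite PBC_scale -/(Qc z) big_split prodr_const card_ord -cexp_sum -big_distrr -dotC_sum /=.
by rewrite mulrAC.
Qed.

(** The kernel is a finite complex combination of tensor products of smooth convex functions, and on
    these [isGW] prescribes the value of T, which [polar_smooth] computes. *)
Lemma FL_formula phi T z : Cc phi -> isGW (fun f => Psi f phi) T ->
  FL T z = (-1) ^+ k / (k`!%:R) * Qc z * FT phi (\sum_(j < k) row j z).
Proof.
move=> cphi [dT [_ hT]]; rewrite /FL; set w := \sum_(j < k) row j z.
pose G (g : {ffun 'I_k -> 'I_3}) (j : 'I_k) := expf (row j z) (g j).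
have GC g j : convexR (G g j) /\ smooth (G g j) by exact: expf_ok.
have -> : (fun y : 'M[R]_(k, n) => \prod_(j < k) cexp (cI R * dotC (row j z) (row j y))) =
    fun y => \sum_(g : {ffun 'I_k -> 'I_3}) (\prod_j @expc R (g j)) * cR (tens (G g) y).
  apply: funext => y; under eq_bigr do rewrite -expf_sum.
  rewrite bigA_distr_bigA; apply: eq_bigr => g _; by rewrite big_split /tens cR_prod.
have sG g : smooth (tens (G g)) by apply: tens_smooth => j; case: (GC g j).
rewrite (cdistr_sum _ _ dT sG).2.
have rI := @Iint_cradon R n.
have CF (g : {ffun 'I_k -> 'I_3}) : Cc (fun x => (\prod_j @expc R (g j)) * (PBil c (fun j => D2 (G g j) x) * phi x)).
  by apply: CcZ; apply: CcM => //; apply: PBil_ccont => j; apply: D2_mcont; case: (GC g j).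
have e1 (g : {ffun 'I_k -> 'I_3}) : (\prod_j @expc R (g j)) * T (fun y => cR (tens (G g) y)) =
    (k`!%:R)^-1 * Iint (fun x => (\prod_j @expc R (g j)) * (PBil c (fun j => D2 (G g j) x) * phi x)).
  rewrite (cradonZ rI); last first.
    by apply: CcM => //; apply: PBil_ccont => j; apply: D2_mcont; case: (GC g j).
  by rewrite (hT (G g) (GC g)) (polar_smooth MA hc) // mulrCA.
under eq_bigr do rewrite e1.
rewrite -big_distrr /= -(cradon_sum rI (index_enum _) CF).2.
have -> : (fun x => \sum_(g : {ffun 'I_k -> 'I_3})
    (\prod_j @expc R (g j)) * (PBil c (fun j => D2 (G g j) x) * phi x)) =
    (fun x => (-1) ^+ k * Qc z * (phi x * cexp (cI R * dotC w x))).
  apply: funext => x; rewrite [phi x * _]mulrC [RHS]mulrA -sum_PBil_expf big_distrl.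
  by apply: eq_bigr => g _; rewrite mulrA.
rewrite (cradonZ rI); last first.
  have := CcM cphi (cexp_ccont w); congr Cc; by apply: funext => x; rewrite mulrC.
by rewrite -[FT phi w]/(Iint (fun x => phi x * cexp (cI R * dotC w x))) !mulrA [_^-1 * _]mulrC.
Qed.

Lemma Qrep_Qc : Qrep Psi Qc.
Proof. by split; [exact: Qc_poly22|split; [exact: Qc_symm|move=> *; exact: FL_formula]]. Qed.

(** Modulating [phi0] by exp(-i <w, .>), with w the sum of the rows of z, makes the Fourier factor
    1; [GWT] supplies a distribution to which both representations apply. *)
Lemma Qrep_unique Q' : Qrep Psi Q' -> forall z, Q' z = Qc z.
Proof.
move=> [_ [_ hQ]] z; set w := \sum_(j < k) row j z.
pose phi x := cexp (cI R * dotC (- w) x) * phi0 x.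
have cphi : Cc phi by apply: CcM; [exact: phi0_Cc|exact: cexp_ccont].
have FT1 : FT phi w = 1.
  rewrite -(@Iint_phi0 R n) -[FT phi w]/(Iint (fun x => phi x * cexp (cI R * dotC w x))).
  congr Iint; apply: funext => x; rewrite /phi mulrAC -cexpD -mulrDr.
  have -> (v : 'rV[C]_n) : dotC (- v) x = - dotC v x.
    by rewrite /dotC -sumrN; apply: eq_bigr => i _; rewrite mxE mulNr.
  by rewrite addrC subrr mulr0 cexp0 mul1r.
have gw := GWT_isGW cphi MA hc.
have := hQ _ cphi _ gw z; rewrite (FL_formula _ cphi gw) -/w FT1 !mulr1 => e.
apply/esym; apply: (mulfI _ e); apply: mulf_neq0; first by rewrite signr_eq0.
by rewrite invr_eq0 pnatr_eq0 -lt0n fact_gt0.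
Qed.

(** On psd matrices [PH c] is [PA], which sees only the form; adding s * 1 and continuing
    polynomially from large s reaches all matrices. *)
Lemma PH_qM A A' : (forall x, qM A x = qM A' x) -> PH c A = PH c A'.
Proof.
move=> h; apply/eqP; rewrite -subr_eq0; apply/eqP.
pose T := Num.max (mxl1 A) (mxl1 A').
have psdT (B : 'M[R]_n) (s : R) : mxl1 B <= s -> psd (B + s *: 1%:M).
  move=> hs; have := @psd_diag R n B (fun=> s) (fun _ => hs); congr psd; congr (_ + _).
  by apply/matrixP => i j; rewrite !mxE; case: eqP; rewrite ?mulr1n ?mulr0n ?mulr1 ?mulr0.
have := @polyfun_zero R (fun s => PH c (A + s *: 1%:M) - PH c (A' + s *: 1%:M)) T.
move=> /(_ _ _ 0); rewrite !scale0r !addr0; apply; first by apply: polyfunB; exact: PH_polyfun.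
move=> s; rewrite ge_max => /andP[h1 h2].
rewrite -!hc; try exact: psdT.
by rewrite (@PA_eq _ _ Psi _ (A' + s *: 1%:M)) ?subrr // => x; rewrite !qM_lin h.
Qed.

Lemma sumrk_map (I : Type) (r : seq I) (v : I -> 'rV[R]_n) (t : I -> R) :
  sumrk (map v r) (map t r) = \sum_(i <- r) t i *: rk (v i).
Proof. by elim: r => [|i r IH] /=; rewrite ?big_nil // big_cons IH. Qed.

(** Qc only tests rank-one matrices, but the frame writes the form of A as a combination of such
    forms, and multilinearity expands [PH c] into values of Qc at matrices with rows in the
    frame. *)
Lemma PH_zero : (forall z, Qc z = 0) -> forall A, PH c A = 0.
Proof.
move=> hQ A; rewrite (PH_qM (fun x => esym (sumrk_frame A x))) add0r sumrk_map big_enum /=.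
set B := \sum_i _.
suff : PBC (fun j p => cR (B p.1 p.2)) = 0.
  (* With equal arguments all k! permutations contribute the same term. *)
  have -> : PBC (fun j p => cR (B p.1 p.2)) = k`!%:R * PH c B.
    rewrite /PBC /PH big_distrr; apply: eq_bigr => b _ /=.
    by rewrite sumr_const card_Sn mulr_natl.
  move=> /eqP; rewrite mulf_eq0 pnatr_eq0 -leqn0 leqNgt fact_gt0 /=.
  by move/eqP.
rewrite (@PBC_ext _ (fun j p => \sum_i cR (fc A i) * (cR (fv R i 0 p.1) * cR (fv R i 0 p.2)))); last first.
  by move=> j p; rewrite summxE cR_sum; apply: eq_bigr => i _; rewrite !mxE !cRM.
rewrite PBC_distr big1 // => g _; rewrite PBC_scale.
rewrite (@PBC_ext _ (fun j p => (\matrix_(j, i) cR (fv R (g j) 0 i)) j p.1 *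
    (\matrix_(j, i) cR (fv R (g j) 0 i)) j p.2)) -/(Qc _) ?hQ ?mulr0 // => j p.
by rewrite !mxE.
Qed.

End FourierLaplace.

Theorem theorem6p18 (R : realType) (n k : nat)
    (Psi : ('rV[R]_n -> R) -> ('rV[R]_n -> R[i]) -> R[i]) :
  MAVal k Psi ->
  exists Q : 'M[R[i]]_(k, n) -> R[i],
    Qrep Psi Q /\
    (forall Q' : 'M[R[i]]_(k, n) -> R[i], Qrep Psi Q' -> forall z, Q' z = Q z) /\
    ((forall z, Q z = 0) <->
     (forall f, convexR f -> forall phi, Cc phi -> Psi f phi = 0)).
Proof.
move=> MA.
(* When [Psi] vanishes, the zero coefficient family represents it, which gives [Q = 0] at once. *)
have [c [hc hz]] : exists c : {ffun 'I_k -> 'I_n * 'I_n} -> R[i],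
    (forall A, psd A -> PA Psi A = PH c A) /\
    ((forall f, convexR f -> forall phi, Cc phi -> Psi f phi = 0) -> forall z, Qc c z = 0).
  have [h|h] := pselect (forall f, convexR f -> forall phi, Cc phi -> Psi f phi = 0).
    exists (fun=> 0); split => [A pA|_ z].
      rewrite /PH big1 => [|b _]; last by rewrite mul0r.
      by apply: h; [exact: convex_qM|exact: phi0_Cc].
    by rewrite /Qc /PBC big1 // => b _; rewrite big1 // => s _; rewrite mul0r.
  by have [c hc] := PA_PH MA; exists c; split => // /h.
exists (Qc c); split; first exact: (Qrep_Qc MA hc).
split; first by move=> Q' hQ' z; exact: (Qrep_unique MA hc hQ').
split; last exact: hz.
by move=> hQ; apply: (Psi_zero MA hc); exact: (PH_zero hc hQ).
Qed.
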